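(* Let $(M,g)$ be a Riemannian manifold with $\dim M\ge3$ and let $G$ be a natural metric on $TM$ characterized by the functions $\alpha,\beta$. Then $(TM,G)$ is flat if and only if $(M,g)$ is flat and $$\beta(t)=\frac{t(\dot\alpha(t))^2+2\alpha(t)\dot\alpha(t)}{\alpha(t)}\quad\text{for all }t\ge0.$$
   Context: All objects are $C^\infty$; a dot denotes derivative; $n=\dim M$. $\pi:TM\to M$ is the tangent bundle, $K:TTM\to TM$ the connection map of the Levi-Civita connection $\nabla$ of $g$ (the velocity at $0$ of a curve $Y(s)$ in $TM$ is sent to its covariant derivative $\frac{\nabla Y}{ds}(0)$). For $q\in M$, $u=(u_1,\dots,u_n)$ an orthonormal basis of $M_q$, $\xi\in\mathbb{R}^n$ and $v=\sum_i\xi^iu_i$, let $e_i(q,u,\xi),e_{n+i}(q,u,\xi)\in(TM)_v$ ($1\le i\le n$) be the vectors with $\pi_*(e_i)=u_i$, $K(e_i)=0$, $\pi_*(e_{n+i})=0$, $K(e_{n+i})=u_i$. A natural metric on $TM$ is a Riemannian metric $G$ such that $\pi:(TM,G)\to(M,g)$ is a Riemannian submersion, the horizontal spaces $\ker K_v$ and vertical spaces $\ker\pi_{*v}$ are $G$-orthogonal, and the matrix of $G$ in the basis $e_1(q,u,\xi),\dots,e_{2n}(q,u,\xi)$ depends only on $\xi$. Equivalently, there are differentiable functions $\alpha,\beta:[0,+\infty)\to\mathbb{R}$ with $\alpha(t)>0$ and $\alpha(t)+t\beta(t)>0$ for all $t\ge0$ (the functions characterizing $G$) such that at $(q,u,\xi)$: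 $G(e_i,e_j)=\delta_{ij}$, $G(e_i,e_{n+j})=0$, $G(e_{n+i},e_{n+j})=\alpha(|\xi|^2)\delta_{ij}+\beta(|\xi|^2)\xi^i\xi^j$ for $1\le i,j\le n$. Flat means that the curvature tensor vanishes identically. *)

(* Defs.v *)
From HB Require Import structures.
From mathcomp Require Import all_boot all_order all_algebra.
From mathcomp Require Import all_classical all_reals all_analysis.
Import Order.TTheory GRing.Theory Num.Theory.
Import numFieldNormedType.Exports.

Set Implicit Arguments.
Unset Strict Implicit.
Unset Printing Implicit Defensive.

Local Open Scope classical_set_scope.
Local Open Scope ring_scope.

(** * Smooth functions *)

(* [C_on k U f]: on the open set U, f has continuous iterated directional
   derivatives up to order k.  For finite-dimensional V this is C^k. *)
Fixpoint C_on (R : realType) (V W : normedModType R) (k : nat) (U : set V)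
    (f : V -> W) : Prop :=
  (forall x, U x -> {for x, continuous f}) /\
  match k with
  | 0%N => True
  | k'.+1 => (forall x v, U x -> derivable f x v) /\
             (forall v, C_on k' U (fun x => 'D_v f x))
  end.

Definition smooth_on (R : realType) (V W : normedModType R) (U : set V)
  (f : V -> W) : Prop := forall k, C_on k U f.

(* Difference quotient and derivative of a function defined on [0, +oo[
   (one-sided at 0); values at negative arguments are irrelevant. *)
Definition halfquot (R : realType) (a : R -> R) (t : R) : R -> R :=
  fun s => (a s - a t) / (s - t).

Definition halfpoint (R : realType) (t : R) : set_system R :=
  within [set s | 0 <= s] t^'.

Definition halfder (R : realType) (a : R -> R) (t : R) : R :=
  lim (halfquot a t @ halfpoint t).

Definition halfsmooth (R : realType) (a : R -> R) : Prop :=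
  forall (k : nat) (t : R), 0 <= t ->
    cvg (halfquot (iter k (@halfder R) a) t @ halfpoint t).

(** * Manifolds, as sets endowed with a (not necessarily maximal) atlas *)

Record charted (R : realType) (n : nat) := Charted {
  pt : Type;
  idx : Type;
  dom : idx -> set pt;
  chart : idx -> pt -> 'rV[R]_n  (* only meaningful on [dom i] *)
}.

Section Manifold.
Variables (R : realType) (n : nat) (X : charted R n).
Implicit Types (i j : idx X) (p q : pt X).

Definition img i (A : set (pt X)) : set 'rV[R]_n :=
  chart i @` (dom i `&` A).

(* f o (chart i)^-1, extended by 0 outside the image of the chart *)
Definition loc (W : lmodType R) i (f : pt X -> W) (y : 'rV[R]_n) : W :=
  xget 0 [set w | exists p, [/\ dom i p, chart i p = y & w = f p]].

(* the topology determined by the atlas *)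
Definition mopen (A : set (pt X)) : Prop := forall i, open (img i A).

Record manifold : Prop := Manifold {
  mf_nonempty : exists p : pt X, True;
  mf_cover : forall p, exists i, dom i p;
  mf_inj : forall i, set_inj (dom i) (chart i);
  mf_open : forall i j, open (img i (dom j));
  mf_smooth : forall i j, smooth_on (img i (dom j)) (loc i (chart j));
  mf_hausdorff : forall p q, p <> q -> exists A B : set (pt X),
    [/\ mopen A, mopen B, A p, B q & A `&` B = set0];
  mf_second_countable : exists B : set (set (pt X)),
    [/\ countable B, (forall b, B b -> mopen b) &
        forall A p, mopen A -> A p -> exists b, [/\ B b, b p & b `<=` A]]
}.

(** ** Tangent vectors *)

(* A tangent vector at p is the family of its components in all charts around
   p, related by the differentials of the transition maps; the components in
   the charts that do not contain p are set to 0, so that tangent vectors at p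
   are equal exactly when their components are. *)
Definition vect : Type := idx X -> 'rV[R]_n.

Definition tangent p (v : idx X -> 'rV[R]_n) : Prop :=
  (forall i, ~ dom i p -> v i = 0) /\
  (forall i j, dom i p -> dom j p ->
     v j = 'D_(v i) (loc i (chart j)) (chart i p)).

Definition bvec (k : 'I_n) : 'rV[R]_n := delta_mx 0 k.

(* the coordinate vector d/dx^k at p for the chart i *)
Definition coordvec i (k : 'I_n) p : idx X -> 'rV[R]_n :=
  fun j => if `[< dom j p >] then
             'D_(bvec k) (loc i (chart j)) (chart i p) else 0.

(* c is a curve in X, smooth near the parameter 0 *)
Definition curve (c : R -> pt X) : Prop :=
  exists i (e : R), [/\ 0 < e, (forall s, `|s| < e -> dom i (c s)) &
    smooth_on [set s : R | `|s| < e] (fun s : R => chart i (c s))].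

Definition velocity (c : R -> pt X) (s : R) : idx X -> 'rV[R]_n :=
  fun i => if `[< dom i (c s) >] then derive1 (fun t => chart i (c t)) s else 0.

(** ** Riemannian metrics and curvature *)

(* [g p v w] is only meaningful for v and w tangent at p *)
Definition bilin : Type :=
  pt X -> (idx X -> 'rV[R]_n) -> (idx X -> 'rV[R]_n) -> R.

Definition gmat (g : bilin) i : 'rV[R]_n -> 'M[R]_n :=
  loc i (fun p => \matrix_(k, l) g p (coordvec i k p) (coordvec i l p)).

Record riemannian (g : bilin) : Prop := Riemannian {
  rm_linear : forall p (a : R) u v w,
    tangent p u -> tangent p v -> tangent p w ->
    g p (a *: u + v) w = a * g p u w + g p v w;
  rm_sym : forall p u v, tangent p u -> tangent p v -> g p u v = g p v u;
  rm_pos : forall p u, tangent p u -> u <> 0 -> 0 < g p u u;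
  rm_smooth : forall i, smooth_on (img i setT) (gmat g i)
}.

Definition dgmat (g : bilin) i (a b c : 'I_n) (y : 'rV[R]_n) : R :=
  'D_(bvec a) (fun z => gmat g i z b c) y.

(* Christoffel symbols Gamma^k_ab of the Levi-Civita connection *)
Definition christoffel (g : bilin) i (k a b : 'I_n) (y : 'rV[R]_n) : R :=
  2^-1 * \sum_s invmx (gmat g i y) k s *
    (dgmat g i a b s y + dgmat g i b a s y - dgmat g i s a b y).

(* R(d_a, d_b) d_c = \sum_k curvcoef k c a b *: d_k, for the convention
   R(X, Y) = [nabla_X, nabla_Y] - nabla_[X, Y] *)
Definition curvcoef (g : bilin) i (k c a b : 'I_n) (y : 'rV[R]_n) : R :=
  'D_(bvec a) (christoffel g i k b c) y - 'D_(bvec b) (christoffel g i k a c) y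
  + \sum_s (christoffel g i k a s y * christoffel g i s b c y
            - christoffel g i k b s y * christoffel g i s a c y).

Definition curvature (g : bilin) p (u v w : idx X -> 'rV[R]_n) :
    idx X -> 'rV[R]_n :=
  fun i => if `[< dom i p >] then
    \row_k \sum_a \sum_b \sum_c
      curvcoef g i k c a b (chart i p) * u i 0 a * v i 0 b * w i 0 c
  else 0.

Definition flat (g : bilin) : Prop :=
  forall p u v w, tangent p u -> tangent p v -> tangent p w ->
    curvature g p u v w = 0.

End Manifold.

(** * Differentials and Riemannian submersions *)

Section Maps.
Variables (R : realType) (m n : nat) (X : charted R m) (Y : charted R n).

Definition smooth_map (F : pt X -> pt Y) : Prop :=
  forall (i : idx X) (j : idx Y),
    open (img i (F @^-1` dom j)) /\
    smooth_on (img i (F @^-1` dom j)) (loc i (fun p => chart j (F p))).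

(* sends the velocity c'(0) of a curve c from p to (F o c)'(0) *)
Definition differential (F : pt X -> pt Y) (p : pt X)
    (v : idx X -> 'rV[R]_m) : idx Y -> 'rV[R]_n :=
  xget 0 [set w | exists c : R -> pt X,
    [/\ curve c, c 0 = p, velocity c 0 = v & w = velocity (fun s => F (c s)) 0]].

Record riemannian_submersion (G : bilin X) (g : bilin Y)
    (F : pt X -> pt Y) : Prop := RiemannianSubmersion {
  rs_smooth : smooth_map F;
  rs_surj : forall q, exists p, F p = q;
  rs_dsurj : forall p w, tangent (F p) w ->
    exists2 v, tangent p v & differential F p v = w;
  rs_isometry : forall p v v', tangent p v -> tangent p v' ->
    (forall z, tangent p z -> differential F p z = 0 -> G p v z = 0) ->
    (forall z, tangent p z -> differential F p z = 0 -> G p v' z = 0) ->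
    g (F p) (differential F p v) (differential F p v') = G p v v'
}.

End Maps.

(** * The tangent bundle *)

Section TangentBundle.
Variables (R : realType) (n : nat) (M : charted R n).

Record tpoint := TPoint {
  foot : pt M;
  tvec : idx M -> 'rV[R]_n;
  tvecP : tangent foot tvec
}.

(* The charts of TM are those of M, (q, v) being sent to the coordinates of q
   followed by the components of v. *)
Definition TM : charted R (n + n) := @Charted R (n + n) tpoint (idx M)
  (fun i => foot @^-1` dom i)
  (fun i x => row_mx (chart i (foot x)) (tvec x i)).

Definition bundle_proj : pt TM -> pt M := foot.

Variable g : bilin M.

(* covariant derivative nabla Y / ds of a vector field Y along the curve
   [foot (Y s)] *)
Definition covder (Y : R -> pt TM) (s : R) : idx M -> 'rV[R]_n :=
  fun i => let q := foot (Y s) in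
    let c' := derive1 (fun t => chart i (foot (Y t))) s in
    if `[< dom i q >] then
      derive1 (fun t => tvec (Y t) i) s +
      \row_k \sum_a \sum_b
        christoffel g i k a b (chart i q) * c' 0 a * tvec (Y s) i 0 b
    else 0.

Definition connection_map (x : pt TM) (v : idx TM -> 'rV[R]_(n + n)) :
    idx M -> 'rV[R]_n :=
  xget 0 [set w | exists Y : R -> pt TM,
    [/\ curve Y, Y 0 = x, velocity Y 0 = v & w = covder Y 0]].

Definition orthonormal_basis (q : pt M) (u : 'I_n -> idx M -> 'rV[R]_n) : Prop :=
  (forall i, tangent q (u i)) /\ (forall i j, g q (u i) (u j) = (i == j)%:R).

(* x = (q, v) with v = \sum_i xi^i u_i, and e is the basis e_1, ..., e_2n of
   (TM)_v attached to (q, u, xi) *)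
Record adapted_basis (x : pt TM) (u : 'I_n -> idx M -> 'rV[R]_n)
    (xi : 'rV[R]_n) (e : 'I_(n + n) -> idx TM -> 'rV[R]_(n + n)) : Prop :=
  AdaptedBasis {
  ab_basis : orthonormal_basis (foot x) u;
  ab_vec : tvec x = \sum_i xi 0 i *: u i;
  ab_tangent : forall a, tangent x (e a);
  ab_hpi : forall i, differential bundle_proj x (e (lshift n i)) = u i;
  ab_hK : forall i, connection_map x (e (lshift n i)) = 0;
  ab_vpi : forall i, differential bundle_proj x (e (rshift n i)) = 0;
  ab_vK : forall i, connection_map x (e (rshift n i)) = u i
}.

Record natural_metric (G : bilin TM) : Prop := NaturalMetric {
  nm_riemannian : riemannian G;
  nm_submersion : riemannian_submersion G g bundle_proj;
  nm_orth : forall x v w, tangent x v -> tangent x w ->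
    connection_map x v = 0 -> differential bundle_proj x w = 0 -> G x v w = 0;
  nm_matrix : exists B : 'rV[R]_n -> 'M[R]_(n + n),
    forall x u xi e, adapted_basis x u xi e ->
      \matrix_(a, b) G x (e a) (e b) = B xi
}.

Definition sqnorm (xi : 'rV[R]_n) : R := \sum_i xi 0 i ^+ 2.

Record characterized_by (G : bilin TM) (alpha beta : R -> R) : Prop :=
  CharacterizedBy {
  cb_alpha_smooth : halfsmooth alpha;
  cb_beta_smooth : halfsmooth beta;
  cb_alpha_pos : forall t, 0 <= t -> 0 < alpha t;
  cb_beta_pos : forall t, 0 <= t -> 0 < alpha t + t * beta t;
  cb_hh : forall x u xi e i j, adapted_basis x u xi e ->
    G x (e (lshift n i)) (e (lshift n j)) = (i == j)%:R;
  cb_hv : forall x u xi e i j, adapted_basis x u xi e ->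
    G x (e (lshift n i)) (e (rshift n j)) = 0;
  cb_vv : forall x u xi e i j, adapted_basis x u xi e ->
    G x (e (rshift n i)) (e (rshift n j)) =
      alpha (sqnorm xi) * (i == j)%:R + beta (sqnorm xi) * xi 0 i * xi 0 j
}.

End TangentBundle.

(* Main.v *)
From HB Require Import structures.
From mathcomp Require Import all_boot all_order all_algebra.
From mathcomp Require Import all_classical all_reals all_analysis.
From mathcomp Require Import ring lra.
Require Import Defs.
Import Order.TTheory GRing.Theory Num.Theory.
Import numFieldNormedType.Exports.

Set Implicit Arguments.
Unset Strict Implicit.
Unset Printing Implicit Defensive.

Local Open Scope classical_set_scope.
Local Open Scope ring_scope.

(** In a chart, write [y] for the fibre coordinate, [r = g(y,y)] and, for a
tangent vector [Z = (a, b)] of [TM], [B = b + Gamma(a, y)] for its vertical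
part; then [G(Z, Z') = g(a, a') + alpha(r) g(B, B') + beta(r) g(y, B) g(y, B')].

If [G] is flat, then so is [g], because along the zero section the Christoffel
symbols of [G] in horizontal directions are those of [g].  The fibres are
totally geodesic, so each of them is flat for [alpha g + beta y y]; since
[n >= 3] there are orthonormal [u, v] orthogonal to [y], and the equation
[R(u, v) v = 0] is the stated formula for [beta].

Conversely, under this formula the fibrewise map [zeta = sqrt(alpha(r)) y]
satisfies [alpha(r) g(B, B') + beta(r) g(y, B) g(y, B') = g(D zeta, D zeta)].
Hence [G] has the metric matrix [diag(g, g)] in the coframe [(dx, D zeta)], for
which [diag(Gamma, Gamma)] is metric; it is torsion free and flat exactly
because [g] is flat, so it is the Levi-Civita connection of [G]. *)

(** * Differential calculus *)

(** Smoothness is given only through iterated directional derivatives, and [alpha], [beta] are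
    smooth on a closed half-line whose end [0] is reached by [r] on the zero section.
    Differentiability, symmetry of second derivatives and a chain rule valid at the end point
    therefore have to be derived before any geometry.

    The Christoffel symbols of [G] involve the inverse of a matrix of size [2n], which is never
    computed: a candidate for the connection is guessed and then identified, either by pairing with
    all vectors in the Koszul formula or by the uniqueness of the metric torsion-free connection.

    Choosing [u], [v] orthogonal to [y] removes from [R(u, v) v], paired with [u], every derivative
    of [beta] and every second derivative of [alpha], and leaves an equation linear in [beta]. The
    other direction reads it as [beta = 2 alpha' + t alpha'^2 / alpha], the coefficient of
    [g(y, B) g(y, B')] produced by differentiating the factor [sqrt(alpha(r))]. *)

Lemma derive_comp_affine (R : realType) (V V' W : normedModType R) (f : V' -> W)
    (h : V -> V') (x v : V) (w : V') :
    (forall t : R, h (t *: v + x) = t *: w + h x) ->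
  (derivable (f \o h) x v <-> derivable f (h x) w) /\
  'D_v (f \o h) x = 'D_w f (h x).
Proof.
move=> hE; rewrite /derivable /derive.
(* The two difference quotients are the same function of [t], so derivability and derivative are
   transferred together. *)
suff -> : (fun t : R => t^-1 *: ((f \o h \o shift x) (t *: v) - (f \o h) x)) =
          (fun t : R => t^-1 *: ((f \o shift (h x)) (t *: w) - f (h x))) by [].
by apply/funext => t /=; rewrite hE.
Qed.

Lemma derive_ext (R : realType) (V V' : normedModType R) (f h : V -> V') x v :
  f =1 h -> 'D_v f x = 'D_v h x.
Proof. by move=> /funext ->. Qed.

Lemma derive_line (R : realType) (V W : normedModType R) (f : V -> W) (x v : V)
    (t : R) :
  (derivable (fun s : R => f (s *: v + x)) t 1 <-> derivable f (t *: v + x) v) /\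
  'D_1 (fun s : R => f (s *: v + x)) t = 'D_v f (t *: v + x).
Proof.
apply: (derive_comp_affine f (h := fun s : R => s *: v + x)) => s.
by rewrite [_%:A]mulr1 scalerDl addrA.
Qed.

(** On the line through [x] in direction [v] this is the one-variable chain rule with [s |-> c * s],
    which also covers [c = 0]. *)
Lemma deriveZdir (R : realType) (V W : normedModType R) (f : V -> W) (x v : V)
    (c : R) : derivable f x v ->
  derivable f x (c *: v) /\ 'D_(c *: v) f x = c *: 'D_v f x.
Proof.
move=> dfv.
pose F s := f (s *: v + x).
have /derivable1_diffP dF : derivable F 0 1.
  by apply/(derive_line f x v 0).1; rewrite scale0r add0r.
pose m : R -> R := fun s => c * s.
have mE : m = c \*: @id R by [].
have dm : derivable m 0 1.
  by rewrite mE; apply: derivableZ; exact: derivable_id.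
have h t : f (t *: (c *: v) + x) = (F \o m) t by rewrite /F /m/= scalerA mulrC.
have dFm : differentiable (F \o m) 0.
  apply: differentiable_comp; last by rewrite /m mulr0.
  exact/derivable1_diffP.
have [d1 d2] := derive_line f x (c *: v) 0.
rewrite scale0r add0r in d1 d2; split.
  apply/d1; have -> : (fun s : R => f (s *: (c *: v) + x)) = F \o m by apply/funext.
  exact/diff_derivable.
rewrite -d2; have -> : (fun s : R => f (s *: (c *: v) + x)) = F \o m by apply/funext.
have dF0 : differentiable F (m 0) by rewrite /m mulr0.
have dm0 : differentiable m 0 by apply/derivable1_diffP.
rewrite [LHS]deriveE// (diff_comp dm0 dF0)/=.
have -> /= : 'd m 0 1 = c *: (1 : R).
  rewrite -deriveE; last exact/derivable1_diffP.
  by rewrite mE deriveZ; [rewrite derive_id|exact: derivable_id].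
rewrite linearZ/= /m mulr0 -deriveE//.
by rewrite (derive_line f x v 0).2 scale0r add0r.
Qed.

(** Here [c] is a predicted increment: a bound on the error of the derivative along the segment
    bounds the error of the increment, and no intermediate point has to be tracked. *)
Lemma mean_value_le (R : realType) (V : normedModType R) (f : V -> R) (y v : V)
    (c e : R) :
    (forall t : R, 0 <= t <= 1 ->
      derivable f (t *: v + y) v /\ `|'D_v f (t *: v + y) - c| <= e) ->
  `|f (v + y) - f y - c| <= e.
Proof.
move=> H.
pose F (s : R) := f (s *: v + y).
have dF (t : R) : 0 <= t <= 1 -> is_derive t (1 : R) F ('D_v f (t *: v + y)).
  move=> t01; have [dft _] := H t t01; have [a b] := derive_line f y v t.
  exact: (DeriveDef (a.2 dft) b).
have [||t tI] := @MVT_segment R F (fun t : R => 'D_v f (t *: v + y)) 0 1 ler01.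
- by move=> t tI; apply: dF; rewrite !ltW ?(itvP tI).
- apply: derivable_within_continuous => t; rewrite in_itv/= => tI.
  by have [] := dF _ tI.
rewrite subr0 mulr1 {1 2}/F scale1r scale0r add0r => ->.
by have [] := H t; rewrite ?(itvP tI).
Qed.
Lemma mx_entry_norm (R : realType) (m n : nat) (A : 'M[R]_(m, n)) i j :
  `|A i j| <= `|A|.
Proof. by rewrite [leRHS]/Num.Def.normr/= mx_normrE; apply: (le_bigmax _ (fun p => `|A p.1 p.2|) (i, j)). Qed.

Lemma mx_norm_le (R : realType) (m n : nat) (A : 'M[R]_(m, n)) (c : R) :
  0 <= c -> (forall i j, `|A i j| <= c) -> `|A| <= c.
Proof.
move=> c0 H; rewrite [leLHS]/Num.Def.normr/= mx_normrE.
by rewrite (bigmax_le _ c0)//= => -[i j] _; exact: H.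
Qed.

Lemma nbhs_normP (R : realType) (V : normedModType R) (x : V) (P : set V) :
  nbhs x P <-> exists2 d : R, 0 < d & forall y, `|y - x| < d -> P y.
Proof.
split=> [/nbhs_ballP[d d0 dP]|[d d0 dP]].
  by exists d => // y yd; apply: dP; rewrite -ball_normE/= distrC.
by apply/nbhs_ballP; exists d => // y; rewrite -ball_normE/= distrC; exact: dP.
Qed.

Lemma differentiable_norm (R : realType) (V W : normedModType R) (f : V -> W)
    (x : V) (L : {linear V -> W}) : continuous L ->
  (forall e : R, 0 < e -> exists2 d : R, 0 < d &
    forall h, `|h| < d -> `|f (h + x) - (f x + L h)| <= e * `|h|) ->
  differentiable f x.
Proof.
move=> Lc H.
have fL : f \o shift x = cst (f x) + L +o_ (0 : V) id.
  apply/eqaddoP => e /H[d d0 dP].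
  by apply/nbhs_normP; exists d => // h; rewrite subr0 => /dP.
by apply/diff_locallyP; rewrite (diff_unique Lc fL).
Qed.

(** Passes from directional to total differentiability. The increment [h] is built up one coordinate
    at a time; each partial increment is controlled by the mean value theorem and the continuity of
    the partial derivatives. *)
Lemma differentiable_C1 (R : realType) (n : nat) (U : set 'rV[R]_n)
    (f : 'rV[R]_n -> R) (x : 'rV[R]_n) :
  open U -> U x -> C_on 1 U f -> differentiable f x.
Proof.
move=> oU Ux [_ [dU cU]].
pose L (v : 'rV[R]_n) := \sum_k v 0 k * 'D_(bvec R k) f x.
have Llin : linear L.
  move=> a u v; rewrite /L scaler_sumr -big_split/=; apply: eq_bigr => k _.
  by rewrite !mxE mulrDl -[RHS]/(a * _ + _) mulrA.
pose Lm := GRing.isLinear.Build _ _ _ _ L Llin.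
pose LL : {linear 'rV[R]_n -> R} := HB.pack L Lm.
have Lc : continuous LL.
  apply: continuous_big => [|k _ v]; first exact: add_continuous.
  by apply: (@cvgMr_tmp _ _ (nbhs v) _ (fun u : 'rV[R]_n => u 0 k)); exact: coord_continuous.
apply: (differentiable_norm Lc) => _/posnumP[e].
(* The [n] coordinate increments cost [n] times this bound; dividing by [n.+1] keeps it meaningful
   when [n = 0]. *)
have e0 : 0 < e%:num / n.+1%:R by rewrite divr_gt0.
have [d d0 dP] : exists2 d : R, 0 < d & forall y, `|y - x| < d ->
    U y /\ forall k, `|'D_(bvec R k) f x - 'D_(bvec R k) f y| <= e%:num / n.+1%:R.
  apply/nbhs_normP/filterI; first exact: open_nbhs_nbhs.
  apply: (filter_forall (nbhs_filter x)) => k.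
  have := (cU (bvec R k)).1 x Ux.
  by move/cvgrPdist_le => /(_ _ e0).
exists d => // h hd.
have splitE (a b c r s : R) : a - b - (r + s) = (c - b - s) + (a - c - r) by ring.
  (* Truncation to the first [m] coordinates, interpolating between [tr 0 = 0] and [tr n = h]. *)
  pose tr (m : nat) : 'rV[R]_n := \row_k (if (k < m)%N then h 0 k else 0).
  have trP m : (m <= n)%N ->
    `|f (tr m + x) - f x - \sum_(k < n | (k < m)%N) h 0 k * 'D_(bvec R k) f x|
      <= m%:R * (e%:num / n.+1%:R * `|h|).
    elim: m => [|m IH] mn.
      have -> : tr 0%N = 0 by apply/rowP => k; rewrite !mxE.
      by rewrite add0r subrr big_pred0// subr0 normr0 mul0r.
    pose k := Ordinal mn.
    have trS : tr m.+1 = h 0 k *: bvec R k + tr m.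
      apply/rowP => j; rewrite !mxE/= ltnS leq_eqVlt -val_eqE/=.
      have [jm|jm] := eqVneq (j : nat) m.
        by rewrite jm ltnn addr0 mulr1 /=; congr (h 0 _); apply/val_inj.
      by rewrite mulr0 add0r.
    have mv : `|f (h 0 k *: bvec R k + (tr m + x)) - f (tr m + x) - h 0 k * 'D_(bvec R k) f x| <= e%:num / n.+1%:R * `|h|.
      apply: mean_value_le => t /andP[t0 t1].
      have [] := dP (t *: (h 0 k *: bvec R k) + (tr m + x)).
        rewrite addrA addrK.
        apply: le_lt_trans hd; apply: mx_norm_le => // i j; rewrite ord1 !mxE/=.
        have [jk|jk] := eqVneq j k.
          rewrite jk ltnn addr0 mulr1 normrM (ger0_norm t0).
          by apply: le_trans (mx_entry_norm h 0 k); rewrite ler_piMl.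
        rewrite mulr0 mulr0 add0r; case: ifP => _; first exact: mx_entry_norm.
        by rewrite normr0.
      move=> Uz /(_ k) Dk.
      have [dz Dz] := deriveZdir (h 0 k) (dU _ (bvec R k) Uz).
      split; first exact: dz.
      rewrite Dz -[_ *: _]/(_ * _) -mulrBr normrM distrC mulrC.
      by apply: ler_pM => //; exact: mx_entry_norm.
    rewrite trS -(addrA _ (tr m) x) (bigD1 k)/=; last exact: ltnSn.
    rewrite [X in _ - (_ + X)](_ : _ = \sum_(i < n | (i < m)%N) h 0 i * 'D_(bvec R i) f x); last first.
      apply: eq_bigl => j; rewrite ltnS -val_eqE/=.
      by rewrite (ltn_neqAle j m) andbC.
    rewrite -natr1 mulrDl mul1r.
    rewrite (splitE _ _ (f (tr m + x))).
    by apply: le_trans (ler_normD _ _) _; apply: lerD => //; apply: IH; exact: ltnW.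
  have := trP n (leqnn n).
  have -> : tr n = h by apply/rowP => k; rewrite !mxE ltn_ord.
  rewrite (eq_bigl xpredT) => [H|k]; last by rewrite ltn_ord.
  rewrite opprD addrA.
  apply: le_trans H _; rewrite mulrA; apply: ler_wpM2r => //.
  rewrite mulrCA ler_piMr// ler_pdivrMr// mul1r ler_nat.
  exact: leqnSn.
Qed.
(** Along the line through [x] the inner map becomes a curve [phi], which need not be straight; this
    is why the outer map is assumed differentiable and not merely derivable in one direction. *)
Lemma derive_chain (R : realType) (V W X : normedModType R) (F : V -> W)
    (f : W -> X) (x v : V) :
  derivable F x v -> differentiable f (F x) ->
  derivable (f \o F) x v /\ 'D_v (f \o F) x = 'D_('D_v F x) f (F x).
Proof.
move=> dF df; pose phi (t : R) := F (t *: v + x).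
have [a b] := derive_line F x v 0; rewrite scale0r add0r in a b.
have dphi : differentiable phi 0 by apply/derivable1_diffP/a.
have df0 : differentiable f (phi 0) by rewrite /phi scale0r add0r.
have dc : differentiable (f \o phi) 0 by exact: differentiable_comp.
have [c d] := derive_line (f \o F) x v 0; rewrite scale0r add0r in c d.
split; first by apply/c/derivable1_diffP.
rewrite -d [LHS](deriveE _ dc) (diff_comp dphi df0)/= -(deriveE _ dphi) [X in 'd f _ X]b.
by rewrite /phi scale0r add0r -deriveE.
Qed.

Lemma deriveDdir (R : realType) (V W : normedModType R) (f : V -> W) (x u v : V)
    (a : R) : differentiable f x ->
  'D_(a *: u + v) f x = a *: 'D_u f x + 'D_v f x.
Proof. by move=> df; rewrite !deriveE// linearP. Qed.

Lemma derive_sumdir (R : realType) (n : nat) (W : normedModType R)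
    (f : 'rV[R]_n -> W) (x u : 'rV[R]_n) : differentiable f x ->
  'D_u f x = \sum_k u 0 k *: 'D_(bvec R k) f x.
Proof.
move=> df; rewrite deriveE// {1}(row_sum_delta u) linear_sum/=.
by apply: eq_bigr => k _; rewrite linearZ/= -deriveE.
Qed.

(** * Symmetry of second derivatives *)

Section Schwarz.
Variables (R : realType) (V : normedModType R).

(** The mean value inequality is applied twice, first to [phi z = f (s *: u + z) - f z] along
    [s *: v], then to ['D_v f] along [s *: u]; each use contributes one factor [s]. *)
Lemma second_difference (U : set V) (f : V -> R) (x u v : V) (e : R) :
  open U -> U x -> C_on 2 U f -> 0 < e ->
  exists2 d : R, 0 < d & forall s : R, 0 <= s -> s < d ->
   `|f (s *: u + (s *: v + x)) - f (s *: v + x) - (f (s *: u + x) - f x)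
     - s ^+ 2 * 'D_u ('D_v f) x| <= s ^+ 2 * e.
Proof.
move=> oU Ux [_ [dU cU]] e0.
have [_ [dUv cUv]] := cU v.
have [d d0 dP] : exists2 d : R, 0 < d & forall y, `|y - x| < d ->
    U y /\ `|'D_u ('D_v f) x - 'D_u ('D_v f) y| <= e.
  apply/nbhs_normP/filterI; first exact: open_nbhs_nbhs.
  have := (cUv u).1 x Ux.
  by move/cvgrPdist_le => /(_ _ e0).
(* For [s < d / c] the parallelogram spanned by [s *: u] and [s *: v] at [x] stays within [d] of
   [x]; the summand [1] keeps [c] positive when both vectors vanish. *)
pose c := `|u| + `|v| + 1.
have c0 : 0 < c by rewrite ltr_wpDl// addr_ge0.
exists (d / c); first exact: divr_gt0.
move=> s s0; rewrite ltr_pdivlMr// => sd.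
have near_x (a b : R) : 0 <= a <= 1 -> 0 <= b <= 1 ->
    `|(a *: (s *: u) + (b *: (s *: v) + x)) - x| < d.
  move=> /andP[a0 a1] /andP[b0 b1]; rewrite addrA addrK.
  apply: le_lt_trans sd; apply: le_trans (ler_normD _ _) _.
  rewrite !normrZ !ger0_norm// /c !mulrDr mulr1 -addrA lerD//.
    by rewrite ler_piMl// mulr_ge0.
  apply: ler_wpDr => //.
  by rewrite ler_piMl// mulr_ge0.
have Uab a b ha hb := (dP _ (near_x a b ha hb)).1.
have I1 : 0 <= (1 : R) <= 1 by rewrite ler01 lexx.
have I0 : 0 <= (0 : R) <= 1 by rewrite ler01 lexx.
pose phi z := f (s *: u + z) - f z.
have := @mean_value_le R V phi x (s *: v) (s ^+ 2 * 'D_u ('D_v f) x) (s ^+ 2 * e).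
rewrite /phi; apply => t t01.
have U1 := Uab 1 t I1 t01; rewrite scale1r in U1.
have U0 := Uab 0 t I0 t01; rewrite scale0r add0r in U0.
have [d1 D1] := @derive_comp_affine R V V R f (fun z => s *: u + z) (t *: (s *: v) + x) (s *: v) (s *: v) (fun r => addrCA _ _ _).
have e1 : derivable (fun z => f (s *: u + z)) (t *: (s *: v) + x) (s *: v).
  by apply/d1; have [] := deriveZdir s (dU _ v U1).
have e2 : derivable f (t *: (s *: v) + x) (s *: v).
  by have [] := deriveZdir s (dU _ v U0).
have D1' : 'D_(s *: v) (fun z => f (s *: u + z)) (t *: (s *: v) + x) = 'D_(s *: v) f (s *: u + (t *: (s *: v) + x)) := D1.
split; first exact: derivableB.
rewrite deriveB// D1' (deriveZdir s (dU _ v U1)).2 (deriveZdir s (dU _ v U0)).2.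
have := @mean_value_le R V ('D_v f) (t *: (s *: v) + x) (s *: u) (s * 'D_u ('D_v f) x) (s * e).
have -> (A B : R) : s *: A - s *: B - s ^+ 2 * 'D_u ('D_v f) x = s * (A - B - s * 'D_u ('D_v f) x).
  rewrite -[s *: A]/(s * A) -[s *: B]/(s * B); ring.
rewrite normrM (ger0_norm s0) expr2 -mulrA => H; apply: ler_wpM2l => //.
apply: H => r r01.
have Ur := Uab r t r01 t01.
have [dr Dr] := deriveZdir s (dUv _ u Ur).
split; first exact: dr.
rewrite Dr -[s *: _]/(s * _) -mulrBr normrM (ger0_norm s0) distrC ler_wpM2l//.
exact: (dP _ (near_x r t r01 t01)).2.
Qed.

(** The second difference over a parallelogram is symmetric in the two sides, and after division by
    [s ^+ 2] it is close to both mixed derivatives for the same small [s]. *)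
Lemma derive_schwarz (U : set V) (f : V -> R) (x u v : V) :
  open U -> U x -> C_on 2 U f -> 'D_u ('D_v f) x = 'D_v ('D_u f) x.
Proof.
move=> oU Ux cf; apply/eqP; rewrite -subr_eq0 -normr_le0.
apply/ler_addgt0Pr => e e0; rewrite add0r.
have e2 : 0 < e / 2 by rewrite divr_gt0.
have [d1 d10 H1] := second_difference u v oU Ux cf e2.
have [d2 d20 H2] := second_difference v u oU Ux cf e2.
pose s := Num.min d1 d2 / 2.
have m0 : 0 < Num.min d1 d2 by rewrite lt_min d10.
have s0 : 0 < s by rewrite divr_gt0.
have sm : s < Num.min d1 d2 by rewrite ltr_pdivrMr// ltr_pMr// ltr1n.
move: (sm); rewrite lt_min => /andP[sd1 sd2].
have {H1} := H1 s (ltW s0) sd1; have {H2} := H2 s (ltW s0) sd2.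
rewrite (addrCA (s *: u)).
set A := f _; set B := f _; set C := f _; set D := f _.
set P := 'D_v _ _; set Q := 'D_u _ _ => H2 H1.
have s20 : 0 < s ^+ 2 by rewrite exprn_gt0.
rewrite -(ler_pM2l s20) -[leLHS]/(s ^+ 2 * `|Q - P|) -{1}(ger0_norm (ltW s20)) -normrM.
have E : s ^+ 2 * (Q - P) = (A - B - (C - D) - s ^+ 2 * P) - (A - C - (B - D) - s ^+ 2 * Q) by ring.
rewrite E; apply: (le_trans (ler_normB _ _)).
by apply: le_trans (lerD H2 H1) _; rewrite -mulrDr -splitr.
Qed.

End Schwarz.

(** * Closure properties of functions of class C^k *)

Section COn.
Variables (R : realType) (V : normedModType R).
Implicit Types (U : set V) (k : nat).

Lemma C_on_cont (W : normedModType R) k U (f : V -> W) x :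
  C_on k U f -> U x -> {for x, continuous f}.
Proof. by case: k => [|k] [cf _]; exact: cf. Qed.

Lemma C_on_derivable (W : normedModType R) k U (f : V -> W) x v :
  C_on k.+1 U f -> U x -> derivable f x v.
Proof. by move=> [_ [df _]]; exact: df. Qed.

Lemma C_on_derive (W : normedModType R) k U (f : V -> W) v :
  C_on k.+1 U f -> C_on k U ('D_v f).
Proof. by move=> [_ [_]]; exact. Qed.

Lemma C_onW (W : normedModType R) k U (f : V -> W) :
  C_on k.+1 U f -> C_on k U f.
Proof.
elim: k f => [|k IH] f [cf [df Df]]; first by split.
by split => //; split => // v; exact/IH.
Qed.

Lemma C_on_le (W : normedModType R) k l U (f : V -> W) :
  (l <= k)%N -> C_on k U f -> C_on l U f.
Proof.
move=> /subnK <-; elim: (k - l)%N => // m IH.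
by rewrite addSn => /C_onW.
Qed.

Lemma C_on_sub (W : normedModType R) k U U' (f : V -> W) :
  U' `<=` U -> C_on k U f -> C_on k U' f.
Proof.
move=> s; elim: k f => [|k IH] f [cf]; first by split => // x /s /cf.
move=> [df Df]; split => [x /s /cf//|]; split => [x v /s|v]; first exact: df.
exact/IH/Df.
Qed.

Lemma near_open_eq (T : Type) U (f g : V -> T) x : open U -> U x ->
  {in U, f =1 g} -> {near x, f =1 g}.
Proof.
move=> oU Ux fg; apply: filterS (open_nbhs_nbhs (conj oU Ux)) => y Uy.
by apply: fg; rewrite inE.
Qed.

Lemma eq_derive_on (W : normedModType R) U (f g : V -> W) x v : open U -> U x ->
  {in U, f =1 g} -> 'D_v f x = 'D_v g x.
Proof. by move=> oU Ux fg; apply: near_eq_derive; exact: near_open_eq fg. Qed.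

Lemma eq_C_on (W : normedModType R) k U (f g : V -> W) : open U ->
  {in U, f =1 g} -> C_on k U f -> C_on k U g.
Proof.
move=> oU.
have ec (F G : V -> W) x : {in U, F =1 G} -> {for x, continuous F} -> U x ->
    {for x, continuous G}.
  move=> FG cF Ux; have nFG := near_open_eq oU Ux FG.
  have H : G @ x --> G x.
    rewrite -(nbhs_singleton nFG); apply: cvg_trans cF; exact: near_eq_cvg.
  exact: H.
elim: k f g => [|k IH] f g fg [cf].
  by split => // x Ux; exact: ec fg (cf x Ux) Ux.
move=> [df Df]; split; first by move=> x Ux; exact: ec fg (cf x Ux) Ux.
split => [x v Ux|v].
  by apply: near_eq_derivable (df x v Ux); exact: near_open_eq fg.
apply: IH (Df v) => x; rewrite inE => Ux.
exact: eq_derive_on fg.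
Qed.

Lemma C_on_cst (W : normedModType R) k U (c : W) : C_on k U (fun _ : V => c).
Proof.
elim: k c => [|k IH] c; split; try by move=> x _; exact: cvg_cst.
  by [].
split => [x v _|v]; first exact: derivable_cst.
by rewrite (_ : (fun x => 'D_v _ x) = fun=> 0); last by apply/funext => x; exact: derive_cst.
Qed.

Variable U : set V.
Hypothesis oU : open U.

Lemma C_on_add (W : normedModType R) k (f g : V -> W) : C_on k U f -> C_on k U g ->
  C_on k U (fun x => f x + g x).
Proof.
elim: k f g => [|k IH] f g [cf Hf] [cg Hg].
  by split => // x Ux; apply: cvgD; [exact: cf|exact: cg].
split; first by move=> x Ux; apply: cvgD; [exact: cf|exact: cg].
case: Hf => df Df; case: Hg => dg Dg.
split => [x v Ux|v]; first exact: (derivableD (df _ v Ux) (dg _ v Ux)).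
apply: (eq_C_on (f := fun x => 'D_v f x + 'D_v g x)) => //; last exact: (IH _ _ (Df v) (Dg v)).
by move=> x; rewrite inE => Ux; rewrite [RHS](deriveD (df _ v Ux) (dg _ v Ux)).
Qed.

Lemma C_on_mul k (f g : V -> R) : C_on k U f -> C_on k U g ->
  C_on k U (fun x => f x * g x).
Proof.
elim: k f g => [|k IH] f g cf cg.
  by split => // x Ux; apply: cvgM; [exact: (C_on_cont cf)|exact: (C_on_cont cg)].
split; first by move=> x Ux; apply: cvgM; [exact: (C_on_cont cf)|exact: (C_on_cont cg)].
split => [x v Ux|v].
  exact: (derivableM (C_on_derivable (v:=v) cf Ux) (C_on_derivable (v:=v) cg Ux)).
apply: (eq_C_on (f := fun x => f x * 'D_v g x + g x * 'D_v f x)) => //.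
  move=> x; rewrite inE => Ux.
  by rewrite [RHS](deriveM (C_on_derivable (v:=v) cf Ux) (C_on_derivable (v:=v) cg Ux)).
by apply: C_on_add; apply: IH; [exact: C_onW|exact: C_on_derive|exact: C_onW|exact: C_on_derive].
Qed.

Lemma C_on_scale k c (f : V -> R) : C_on k U f -> C_on k U (fun x => c * f x).
Proof. by move=> cf; apply: C_on_mul => //; exact: C_on_cst. Qed.

Lemma C_on_opp k (f : V -> R) : C_on k U f -> C_on k U (fun x => - f x).
Proof.
move=> cf; have := C_on_scale (-1) cf; apply: eq_C_on => // x _.
by rewrite mulN1r.
Qed.

Lemma C_on_sub2 k (f g : V -> R) : C_on k U f -> C_on k U g ->
  C_on k U (fun x => f x - g x).
Proof. by move=> cf cg; apply: C_on_add => //; exact: C_on_opp. Qed.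

Lemma C_on_sum k (I : Type) (r : seq I) (P : pred I) (f : I -> V -> R) :
  (forall i, P i -> C_on k U (f i)) -> C_on k U (fun x => \sum_(i <- r | P i) f i x).
Proof.
move=> H; elim: r => [|i r IH].
  apply: (eq_C_on (f := fun=> 0 : R)) => //; last exact: C_on_cst.
  by move=> x _; rewrite big_nil.
apply: (eq_C_on (f := fun x => (if P i then f i x else 0) + \sum_(i <- r | P i) f i x)) => //.
  by move=> x _; rewrite big_cons; case: ifP => // _; rewrite add0r.
apply: C_on_add => //; case: (boolP (P i)) => Pi; [exact: H|exact: C_on_cst].
Qed.

Lemma C_on_prod k (I : Type) (r : seq I) (P : pred I) (f : I -> V -> R) :
  (forall i, P i -> C_on k U (f i)) -> C_on k U (fun x => \prod_(i <- r | P i) f i x).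
Proof.
move=> H; elim: r => [|i r IH].
  apply: (eq_C_on (f := fun=> 1 : R)) => //; last exact: C_on_cst.
  by move=> x _; rewrite big_nil.
apply: (eq_C_on (f := fun x => (if P i then f i x else 1) * \prod_(i <- r | P i) f i x)) => //.
  by move=> x _; rewrite big_cons; case: ifP => // _; rewrite mul1r.
apply: C_on_mul => //; case: (boolP (P i)) => Pi; [exact: H|exact: C_on_cst].
Qed.

Lemma C_on_inv k (f : V -> R) : (forall x, U x -> f x != 0) ->
  C_on k U f -> C_on k U (fun x => (f x)^-1).
Proof.
move=> f0; elim: k => [|k IH] cf.
  by split => // x Ux; apply: cvgV; [exact: f0|exact: (C_on_cont cf)].
split; first by move=> x Ux; apply: cvgV; [exact: f0|exact: (C_on_cont cf)].
split => [x v Ux|v].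
  exact: (derivableV (f0 _ Ux) (C_on_derivable (v:=v) cf Ux)).
apply: (eq_C_on (f := fun x => - ((f x)^-1 * (f x)^-1 * 'D_v f x))) => //.
  move=> x; rewrite inE => Ux.
  rewrite [RHS](deriveV (f0 _ Ux) (C_on_derivable cf Ux)).
  by rewrite -[_ *: _]/(_ * _) mulNr -invfM -expr2.
apply: C_on_opp; apply: C_on_mul; last exact: C_on_derive.
by apply: C_on_mul; apply: IH; exact: C_onW.
Qed.

Lemma derive_sqrt_comp (f : V -> R) x v : 0 < f x -> derivable f x v ->
  derivable (fun y => Num.sqrt (f y)) x v /\
  'D_v (fun y => Num.sqrt (f y)) x = 'D_v f x / (2 * Num.sqrt (f x)).
Proof.
move=> f0 df; have ds := is_derive1_sqrt f0.
have ds1 : derivable (@Num.sqrt R) (f x) 1 := @ex_derive _ _ _ _ _ _ _ ds.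
have dd : differentiable (@Num.sqrt R) (f x) by apply/derivable1_diffP.
have [a b] := derive_chain df dd; split; first exact: a.
rewrite [LHS]b -[X in 'D_X _ _]mulr1 (deriveZdir ('D_v f x) ds1).2.
by rewrite derive_val.
Qed.

Lemma C_on_sqrt k (f : V -> R) : (forall x, U x -> 0 < f x) ->
  C_on k U f -> C_on k U (fun x => Num.sqrt (f x)).
Proof.
move=> f0.
have cs x : {for x, continuous f} -> {for x, continuous (fun y => Num.sqrt (f y))}.
  by move=> cf; apply: continuous_comp; [exact: cf|exact: sqrt_continuous].
elim: k => [|k IH] cf.
  by split => // x Ux; exact/cs/(C_on_cont cf).
split; first by move=> x Ux; exact/cs/(C_on_cont cf).
split => [x v Ux|v].
  exact: (derive_sqrt_comp (f0 _ Ux) (C_on_derivable cf Ux)).1.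
apply: (eq_C_on (f := fun x => 'D_v f x * (2 * Num.sqrt (f x))^-1)) => //.
  move=> x; rewrite inE => Ux.
  by rewrite (derive_sqrt_comp (f0 _ Ux) (C_on_derivable cf Ux)).2.
apply: C_on_mul; first exact: C_on_derive.
apply: C_on_inv => [x Ux|]; first by rewrite mulf_neq0// gt_eqF// sqrtr_gt0 f0.
by apply: C_on_scale; apply: IH; exact: C_onW.
Qed.

End COn.

(** For linear [h] the derivative is [('D_(h v) f) \o h], again a composition of the same shape, so
    the induction works for values in any normed space. *)
Lemma C_on_comp_lin (R : realType) (V V' W : normedModType R) k (U : set V')
    (f : V' -> W) (h : {linear V -> V'}) :
  continuous h -> C_on k U f -> C_on k (h @^-1` U) (f \o h).
Proof.
move=> ch; elim: k f => [|k IH] f cf.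
  by split => // x Ux; apply: continuous_comp; [exact: ch|exact: (C_on_cont cf)].
split; first by move=> x Ux; apply: continuous_comp; [exact: ch|exact: (C_on_cont cf)].
have aff x v (t : R) : h (t *: v + x) = t *: h v + h x by rewrite linearP.
split => [x v Ux|v].
  by apply/(derive_comp_affine f (aff x v)).1; exact: (C_on_derivable cf).
rewrite (_ : (fun x => 'D_v _ x) = ('D_(h v) f) \o h).
  by apply: IH; exact: C_on_derive.
by apply/funext => x; exact: (derive_comp_affine f (aff x v)).2.
Qed.

Lemma C_on_lin (R : realType) (V V' : normedModType R) k (U : set V)
    (h : {linear V -> V'}) : continuous h -> C_on k U h.
Proof.
move=> ch; case: k => [|k]; split; try by move=> x _; exact: ch.
  by [].
have dh x v : derivable h x v by exact/diff_derivable/linear_differentiable.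
split => // v; rewrite (_ : (fun x => 'D_v _ x) = fun=> h v); first exact: C_on_cst.
apply/funext => x; rewrite deriveE; last exact/linear_differentiable.
by rewrite diff_lin.
Qed.

Lemma C_on_entry (R : realType) (V : normedModType R) (m n : nat) k (U : set V)
   (F : V -> 'M[R]_(m, n)) i j :
  open U -> C_on k U F -> C_on k U (fun x => F x i j).
Proof.
move=> oU.
have cij (G : V -> 'M[R]_(m, n)) : (forall x, U x -> {for x, continuous G}) ->
    forall x, U x -> {for x, continuous (fun y => G y i j)}.
  move=> cG x Ux; apply: (@continuous_comp _ _ _ G (fun M : 'M[R]_(m, n) => M i j)); first exact: cG.
  exact: coord_continuous.
elim: k F => [|k IH] F [cF HF]; first by split => //; exact: cij.
case: HF => dF DF; split; first exact: cij.
split => [x v Ux|v]; first by have /derivable_mxP := dF x v Ux; exact.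
apply: eq_C_on oU _ (IH _ (DF v)) => x; rewrite inE => Ux.
by rewrite derive_mx ?mxE//; exact: dF.
Qed.

Lemma C_on_coord (R : realType) (m n : nat) k (U : set 'M[R]_(m, n)) i j :
  C_on k U (fun M : 'M[R]_(m, n) => M i j).
Proof.
suff : C_on k setT (fun M : 'M[R]_(m, n) => M i j) by exact: C_on_sub.
apply: (C_on_entry i j (F := id)); first exact: openT.
by apply: (@C_on_lin _ _ _ _ _ idfun) => x; exact: cvg_id.
Qed.

(** * Composition with functions smooth on a closed half-line *)

Section Halfsmooth.
Variable R : realType.
Implicit Types (a : R -> R).

(* Caratheodory's slope function: it extends the difference quotient of [a] at
   [t] by the one-sided derivative, and turns the chain rule into a product. *)
Definition halfslope a (t s : R) : R :=
  if s == t then halfder a t else halfquot a t s.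

Lemma halfslopeE a t s : a s = a t + halfslope a t s * (s - t).
Proof.
rewrite /halfslope /halfquot; case: eqVneq => [->|st].
  by rewrite subrr mulr0 addr0.
by rewrite divfK ?subr_eq0// addrC subrK.
Qed.

Lemma cvg_halfslope (T : Type) (F : set_system T) {FF : Filter F} a (t : R) (phi : T -> R) :
  cvg (halfquot a t @ halfpoint t) -> phi @ F --> t -> (\near F, 0 <= phi F) ->
  halfslope a t (phi y) @[y --> F] --> halfder a t.
Proof.
move=> ca cphi phi0; apply/cvgrPdist_le => e e0.
move/cvgrPdist_le : ca => /(_ _ e0)/nbhs_ballP[d /= d0 dP].
move/cvgrPdist_lt : cphi => /(_ _ d0) cphi.
apply: filterS2 cphi phi0 => y yd y0; rewrite /halfslope.
case: eqVneq => [_|yt]; first by rewrite subrr normr0 ltW.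
by apply: dP.
Qed.

Variables (V : normedModType R) (U : set V).
Hypothesis oU : open U.

(** [r] may reach the end point [0], where [a] has only a one-sided derivative. As [r] stays
    nonnegative, the slope of [a] along [r] still converges, and the difference quotient of [a \o r]
    is this slope times that of [r]. *)
Lemma halfder_chain a (r : V -> R) x v : U x -> (forall y, U y -> 0 <= r y) ->
    cvg (halfquot a (r x) @ halfpoint (r x)) -> derivable r x v ->
  derivable (a \o r) x v /\ 'D_v (a \o r) x = halfder a (r x) * 'D_v r x.
Proof.
move=> Ux r0 ca dr.
pose phi (h : R) := r (h *: v + x).
have phi00 : phi 0 = r x by rewrite /phi scale0r add0r.
have dphi : {for 0, continuous phi}.
  apply/differentiable_continuous/derivable1_diffP.
  by apply/(derive_line r x v 0).1; rewrite scale0r add0r.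
have nphi : \forall h \near (0 : R)^', 0 <= phi h.
  apply: (@nbhs_dnbhs _ (0 : R)).
  have /nbhs_normP[d d0 dP] : nbhs x U by exact: open_nbhs_nbhs.
  apply/nbhs_normP; exists (d / (`|v| + 1)); first by rewrite divr_gt0// ltr_wpDl.
  move=> h; rewrite subr0 ltr_pdivlMr ?ltr_wpDl// => hd.
  apply/r0/dP; rewrite addrK normrZ; apply: le_lt_trans hd.
  by rewrite ler_wpM2l// lerDl.
have cphi : phi @ (0 : R)^' --> r x.
  rewrite -phi00; apply: cvg_trans dphi; apply: cvg_app; exact: cvg_within.
have cs : halfslope a (r x) (phi y) @[y --> (0 : R)^'] --> halfder a (r x).
  exact: cvg_halfslope.
have H : h^-1 *: ((a \o r \o shift x) (h *: v) - (a \o r) x) @[h --> 0^']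
   --> halfder a (r x) * 'D_v r x.
  have -> : (fun h : R => h^-1 *: ((a \o r \o shift x) (h *: v) - (a \o r) x)) =
     (fun h : R => halfslope a (r x) (phi h) * (h^-1 *: ((r \o shift x) (h *: v) - r x))).
    apply/funext => h /=; rewrite [a (r (h *: v + x))](halfslopeE a (r x)).
    rewrite -/(phi h) -[LHS]/(_ * _) -[X in _ * X = _]/(_ - _) -[h^-1 *: _]/(_ * _).
    by rewrite addrAC subrr add0r mulrCA.
  have dr' : h^-1 *: ((r \o shift x) (h *: v) - r x) @[h --> (0 : R)^'] --> 'D_v r x := dr.
  exact: (cvgM cs dr').
split; last exact: (cvg_lim _ H).
by apply/cvg_ex; exists (halfder a (r x) * 'D_v r x).
Qed.

Lemma halfder_cont a (r : V -> R) x : U x -> (forall y, U y -> 0 <= r y) ->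
    cvg (halfquot a (r x) @ halfpoint (r x)) -> {for x, continuous r} ->
  {for x, continuous (a \o r)}.
Proof.
move=> Ux r0 ca cr.
have nr : \near x, 0 <= r x.
  by apply: filterS (open_nbhs_nbhs (conj oU Ux)) => y; exact: r0.
have cs : halfslope a (r x) (r y) @[y --> x] --> halfder a (r x).
  exact: cvg_halfslope.
have H : a (r x) + halfslope a (r x) (r y) * (r y - r x) @[y --> x] --> a (r x) + halfder a (r x) * (r x - r x).
  apply: cvgD; first exact: cvg_cst.
  apply: cvgM => //; apply: cvgB => //; exact: cvg_cst.
rewrite subrr mulr0 addr0 in H.
rewrite /continuous_at /=; apply: cvg_trans H.
by apply: near_eq_cvg; apply: nearW => y /=; rewrite -halfslopeE.
Qed.

Lemma halfsmooth_halfder a : halfsmooth a -> halfsmooth (halfder a).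
Proof. by move=> sa k t t0; have := sa k.+1 t t0; rewrite iterSr. Qed.

Lemma C_on_halfsmooth k a (r : V -> R) : halfsmooth a ->
  (forall y, U y -> 0 <= r y) -> C_on k U r -> C_on k U (a \o r).
Proof.
move=> + r0; elim: k a => [|k IH] a sa cr.
  by split => // x Ux; exact: halfder_cont Ux r0 (sa 0%N _ (r0 _ Ux)) (C_on_cont cr Ux).
split; first by move=> x Ux; exact: halfder_cont Ux r0 (sa 0%N _ (r0 _ Ux)) (C_on_cont cr Ux).
have ch x v (Ux : U x) := halfder_chain Ux r0 (sa 0%N _ (r0 _ Ux)) (C_on_derivable (v := v) cr Ux).
split => [x v Ux|v]; first exact: (ch x v Ux).1.
apply: (eq_C_on (f := fun x => (halfder a \o r) x * 'D_v r x)) => //.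
  by move=> x; rewrite inE => Ux; rewrite (ch x v Ux).2.
apply: C_on_mul => //; last exact: C_on_derive.
by apply: IH; [exact: halfsmooth_halfder|exact: C_onW].
Qed.

End Halfsmooth.

(** * Calculus of matrix-valued functions *)

Section MatrixDerivative.
Variables (R : realType) (V : normedModType R).
Implicit Types (x v : V) (U : set V).

(** Regularity entry by entry reduces each rule for matrix functions to the scalar one. *)
Definition mC k U m n (F : V -> 'M[R]_(m, n)) :=
  forall i j, C_on k U (fun x => F x i j).

Definition dmx m n v (F : V -> 'M[R]_(m, n)) x : 'M[R]_(m, n) :=
  \matrix_(i, j) 'D_v (fun y => F y i j) x.

Lemma dmxE m n v (F : V -> 'M[R]_(m, n)) x a b :
  dmx v F x a b = 'D_v (fun y => F y a b) x.
Proof. by rewrite mxE. Qed.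

Lemma mC_le k l U m n (F : V -> 'M[R]_(m, n)) :
  (l <= k)%N -> mC k U F -> mC l U F.
Proof. by move=> lk cF i j; exact: C_on_le (cF i j). Qed.

Lemma mC_dmx k U m n v (F : V -> 'M[R]_(m, n)) : mC k.+1 U F -> mC k U (dmx v F).
Proof.
move=> cF i j; rewrite (_ : (fun x => _) = 'D_v (fun y => F y i j)).
  exact: C_on_derive.
by apply/funext => x; rewrite mxE.
Qed.

Variable U : set V.
Hypothesis oU : open U.

Lemma eq_dmx m n v x (F G : V -> 'M[R]_(m, n)) : U x -> {in U, F =1 G} ->
  dmx v F x = dmx v G x.
Proof.
move=> Ux FG; apply/matrixP => i j; rewrite !mxE.
by apply: eq_derive_on Ux _ => // y Uy; rewrite FG.
Qed.

Lemma eq_mC k m n (F G : V -> 'M[R]_(m, n)) : {in U, F =1 G} ->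
  mC k U F -> mC k U G.
Proof. by move=> FG cF i j; apply: eq_C_on (cF i j) => // y Uy; rewrite FG. Qed.

Lemma mC_cst k m n (A : 'M[R]_(m, n)) : mC k U (fun _ => A).
Proof. by move=> i j; exact: C_on_cst. Qed.

Lemma mC_add k m n (F G : V -> 'M[R]_(m, n)) : mC k U F -> mC k U G ->
  mC k U (fun x => F x + G x).
Proof.
move=> cF cG i j; apply: (eq_C_on (f := fun x => F x i j + G x i j)) => //.
  by move=> x _; rewrite mxE.
exact: C_on_add.
Qed.

Lemma mC_scale k m n (f : V -> R) (G : V -> 'M[R]_(m, n)) : C_on k U f -> mC k U G ->
  mC k U (fun x => f x *: G x).
Proof.
move=> cF cG i j; apply: (eq_C_on (f := fun x => f x * G x i j)) => //.
  by move=> x _; rewrite mxE.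
exact: C_on_mul.
Qed.

Lemma mC_mulmx k m n p (F : V -> 'M[R]_(m, n)) (G : V -> 'M[R]_(n, p)) :
  mC k U F -> mC k U G -> mC k U (fun x => F x *m G x).
Proof.
move=> cF cG i j; apply: (eq_C_on (f := fun x => \sum_s F x i s * G x s j)) => //.
  by move=> x _; rewrite mxE.
by apply: C_on_sum => // s _; exact: C_on_mul.
Qed.

Lemma mC_tr k m n (F : V -> 'M[R]_(m, n)) : mC k U F -> mC k U (fun x => (F x)^T).
Proof.
move=> cF i j; rewrite (_ : (fun x => _) = (fun x => F x j i)) //.
by apply/funext => x; rewrite mxE.
Qed.

Lemma mC_sum k m n (I : Type) (r : seq I) (P : pred I) (F : I -> V -> 'M[R]_(m, n)) :
  (forall i, P i -> mC k U (F i)) -> mC k U (fun x => \sum_(i <- r | P i) F i x).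
Proof.
move=> H i j; apply: (eq_C_on (f := fun x => \sum_(s <- r | P s) F s x i j)) => //.
  by move=> x _; rewrite summxE.
by apply: C_on_sum => // s Ps; exact: H.
Qed.

(** Cramer's rule: determinants are polynomial in the entries, and the inverse is the adjugate
    divided by the determinant. *)
Lemma mC_inv k n (F : V -> 'M[R]_n) : (forall x, U x -> F x \in unitmx) ->
  mC k U F -> mC k U (fun x => invmx (F x)).
Proof.
move=> uF cF.
have cdet m (G : V -> 'M[R]_m) : mC k U G -> C_on k U (fun x => \det (G x)).
  move=> cG; apply: C_on_sum => // s _; apply: C_on_scale => //.
  by apply: C_on_prod => // i _; exact: cG.
apply: (eq_mC (F := fun x => (\det (F x))^-1 *: \adj (F x))).
  by move=> x; rewrite inE => /uF ux; rewrite /invmx ux.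
apply: mC_scale.
  by apply: C_on_inv; [|move=> x /uF; rewrite unitmxE unitfE|exact: cdet].
move=> i j; apply: (eq_C_on (f := fun x => (-1) ^+ (j + i) * \det (row' j (col' i (F x))))) => //.
  by move=> x _; rewrite mxE.
apply: C_on_scale => //; apply: cdet => a b.
rewrite (_ : (fun x => _) = (fun x => F x (lift j a) (lift i b))); first exact: cF.
by apply/funext => x; rewrite !mxE.
Qed.

Lemma dmx_cst m n v (A : 'M[R]_(m, n)) x : dmx v (fun _ => A) x = 0.
Proof. by apply/matrixP => i j; rewrite !mxE; exact: derive_cst. Qed.

Lemma dmx_tr m n v (F : V -> 'M[R]_(m, n)) x :
  dmx v (fun y => (F y)^T) x = (dmx v F x)^T.
Proof.
apply/matrixP => i j; rewrite !mxE; congr ('D_v _ x).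
by apply/funext => y; rewrite mxE.
Qed.

Lemma dmx_add m n v (F G : V -> 'M[R]_(m, n)) x : U x -> mC 1 U F -> mC 1 U G ->
  dmx v (fun y => F y + G y) x = dmx v F x + dmx v G x.
Proof.
move=> Ux cF cG; apply/matrixP => i j; rewrite !mxE.
rewrite -(deriveD (C_on_derivable (v:=v) (cF i j) Ux) (C_on_derivable (v:=v) (cG i j) Ux)).
by congr ('D_v _ x); apply/funext => y; rewrite mxE.
Qed.

Lemma dmx_scale m n v (f : V -> R) (F : V -> 'M[R]_(m, n)) x : U x -> C_on 1 U f -> mC 1 U F ->
  dmx v (fun y => f y *: F y) x = 'D_v f x *: F x + f x *: dmx v F x.
Proof.
move=> Ux cf cF; apply/matrixP => i j; rewrite !mxE.
transitivity ('D_v (f * (fun y => F y i j)) x).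
  by congr ('D_v _ x); apply/funext => y; rewrite mxE.
rewrite (deriveM (C_on_derivable (v:=v) cf Ux) (C_on_derivable (v:=v) (cF i j) Ux)).
by rewrite addrC; congr (_ + _); rewrite mulrC.
Qed.

Lemma derive_sum_on (I : finType) (f : I -> V -> R) x v :
  (forall i, derivable (f i) x v) ->
  'D_v (fun y => \sum_i f i y) x = \sum_i 'D_v (f i) x.
Proof.
move=> H; apply: (@derive_val _ _ _ x v).
suff K (r : seq I) : is_derive x v (fun y => \sum_(i <- r) f i y) (\sum_(i <- r) 'D_v (f i) x).
  exact: K.
elim: r => [|i r IH].
  rewrite big_nil (_ : (fun y => _) = cst 0); first exact: is_derive_cst.
  by apply/funext => y; rewrite big_nil.
rewrite big_cons (_ : (fun y => _) = f i + (fun y => \sum_(i <- r) f i y)).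
  by apply: is_deriveD => //; exact/derivableP.
by apply/funext => y; rewrite big_cons.
Qed.

Lemma dmx_mulmx m n p v (F : V -> 'M[R]_(m, n)) (G : V -> 'M[R]_(n, p)) x :
  U x -> mC 1 U F -> mC 1 U G ->
  dmx v (fun y => F y *m G y) x = dmx v F x *m G x + F x *m dmx v G x.
Proof.
move=> Ux cF cG; apply/matrixP => i j; rewrite !mxE -big_split/=.
have dF a b := C_on_derivable (v:=v) (cF a b) Ux.
have dG a b := C_on_derivable (v:=v) (cG a b) Ux.
transitivity ('D_v (fun y => \sum_s F y i s * G y s j) x).
  by congr ('D_v _ x); apply/funext => y; rewrite mxE.
rewrite derive_sum_on => [|s]; last exact: (derivableM (dF i s) (dG s j)).
apply: eq_bigr => s _; rewrite (deriveM (dF i s) (dG s j)) !mxE addrC.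
by congr (_ + _); rewrite -[LHS]/(_ * _) mulrC.
Qed.

End MatrixDerivative.

(** The derivative of [f \o F] is a sum of products of first derivatives of [F] with partial
    derivatives of [f] composed with [F], so the induction on [k] closes; [differentiable_C1] gives
    access to the chain rule. *)
Lemma C_on_comp (R : realType) (V : normedModType R) (m k : nat) (U : set V)
    (W : set 'rV[R]_m) (F : V -> 'rV[R]_m) (f : 'rV[R]_m -> R) :
  open U -> open W -> (forall x, U x -> W (F x)) ->
  mC k U F -> C_on k W f -> C_on k U (f \o F).
Proof.
move=> oU oW UW.
have cF l : mC l U F -> forall x, U x -> {for x, continuous F}.
  move=> H x Ux; apply/cvgrPdist_le => e e0.
  have : \forall y \near x, forall k, `|F x 0 k - F y 0 k| <= e.
    apply: (filter_forall (nbhs_filter x)) => s.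
    by have /cvgrPdist_le := C_on_cont (H 0 s) Ux; apply.
  apply: filterS => y H2; apply: mx_norm_le; first exact: ltW.
  by move=> i j; rewrite ord1 !mxE.
have cc l (h : 'rV[R]_m -> R) x : mC l U F -> C_on l W h -> U x -> {for x, continuous (h \o F)}.
  move=> HF Hh Ux; apply: continuous_comp; first exact: (cF l).
  exact: (C_on_cont Hh (UW x Ux)).
elim: k f => [|k IH] f HF Hf; first by split=> // x; exact: cc HF Hf.
have HF1 := mC_le (ltn0Sn k) HF.
have ch x v : U x -> derivable (f \o F) x v /\
    'D_v (f \o F) x = \sum_l 'D_v (fun y => F y 0 l) x * 'D_(bvec R l) f (F x).
  move=> Ux.
  have dF : derivable F x v.
    by apply/derivable_mxP => i j; exact: (C_on_derivable (HF1 i j) Ux).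
  have df : differentiable f (F x).
    by apply: (differentiable_C1 oW (UW x Ux)); exact: C_on_le Hf.
  have [a b] := derive_chain dF df; split; first exact: a.
  rewrite b (derive_sumdir _ df); apply: eq_bigr => l _.
  by rewrite (derive_mx dF) mxE.
split; first by move=> x; exact: cc HF Hf.
split => [x v Ux|v]; first exact: (ch x v Ux).1.
apply: (eq_C_on (f := fun x => \sum_l 'D_v (fun y => F y 0 l) x * ('D_(bvec R l) f \o F) x)) => //.
  by move=> x; rewrite inE => Ux; rewrite (ch x v Ux).2.
apply: C_on_sum => // l _; apply: C_on_mul => //; first exact: C_on_derive.
apply: IH; first exact: mC_le HF.
exact: C_on_derive.
Qed.

(** * Atlases and tangent vectors *)

(* keeps unification from unfolding derivatives into limits *)
Local Opaque derive derivable derive1.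

(** The chart conditions that [M] and [TM] have in common. Metrics and curvature are treated over an
    [atlas], so that each result applies both to [g] and to [G]. *)
Record atlas (R : realType) (n : nat) (X : charted R n) : Prop := Atlas {
  at_inj : forall i, set_inj (dom i) (@chart R n X i);
  at_open : forall i j : idx X, open (img i (dom j));
  at_C : forall (i j : idx X) k, mC k (img i (dom j)) (loc i (chart j))
}.

Lemma manifold_atlas (R : realType) (n : nat) (X : charted R n) :
  manifold X -> atlas X.
Proof.
case=> _ _ inj op sm _ _; split => // i j k a b.
by apply: C_on_entry; [exact: op|exact: sm].
Qed.

Section Atlas.
Variables (R : realType) (n : nat) (X : charted R n).
Hypothesis atX : atlas X.
Implicit Types (i j l : idx X) (p q : pt X).

Lemma chart_inj i p q : dom i p -> dom i q -> chart i p = chart i q -> p = q.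
Proof. by move=> dp dq; apply: (at_inj atX (i := i)); rewrite inE. Qed.

Lemma loc_chart (W : lmodType R) i (f : pt X -> W) p :
  dom i p -> loc i f (chart i p) = f p.
Proof.
move=> dp; apply: xget_subset1; first by exists p.
by move=> _ _ [q [dq /(chart_inj dq dp)-> ->]] [s [ds /(chart_inj ds dp)-> ->]].
Qed.

Lemma img_chart i (A : set (pt X)) p : dom i p -> img i A (chart i p) <-> A p.
Proof.
move=> dp; split=> [[q [dq Aq] /(chart_inj dq dp)<-//]|Ap].
by exists p.
Qed.

Lemma trans_derivable i j p w : dom i p -> dom j p ->
  derivable (loc i (chart j)) (chart i p) w.
Proof.
move=> di dj; apply/derivable_mxP => a b.
by apply: (C_on_derivable (at_C atX i j 1%N a b)); exact/img_chart.
Qed.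

Lemma trans_entry i j p w a b : dom i p -> dom j p ->
  'D_w (loc i (chart j)) (chart i p) a b =
  'D_w (fun y => loc i (chart j) y a b) (chart i p).
Proof. by move=> di dj; rewrite derive_mx ?mxE//; exact: trans_derivable. Qed.

Lemma trans_diff i j p a b : dom i p -> dom j p ->
  differentiable (fun y => loc i (chart j) y a b) (chart i p).
Proof.
move=> di dj; apply: (differentiable_C1 (U := img i (dom j))).
- exact: at_open.
- exact/img_chart.
- exact: at_C.
Qed.

Lemma trans_linear i j p (c : R) u v : dom i p -> dom j p ->
  'D_(c *: u + v) (loc i (chart j)) (chart i p) =
  c *: 'D_u (loc i (chart j)) (chart i p) + 'D_v (loc i (chart j)) (chart i p).
Proof.
move=> di dj; apply/rowP => k; have E w := trans_entry w 0 k di dj.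
rewrite 2!mxE [X in _ = _ + X]E [X in _ = _ * X + _]E [LHS]E.
exact: (deriveDdir _ _ _ (trans_diff 0 k di dj)).
Qed.

Lemma trans_comp (V : normedModType R) (F : V -> 'rV[R]_n) x v i j p :
    dom i p -> dom j p -> F x = chart i p -> derivable F x v ->
  derivable (loc i (chart j) \o F) x v /\
  'D_v (loc i (chart j) \o F) x = 'D_('D_v F x) (loc i (chart j)) (chart i p).
Proof.
move=> di dj Fx dF.
have H a b := @derive_chain R V _ _ F (fun y => loc i (chart j) y a b) x v dF.
rewrite Fx in H.
have d1 : derivable (loc i (chart j) \o F) x v.
  by apply/derivable_mxP => a b; apply: (H a b _).1; exact: trans_diff.
split; first exact: d1.
apply/rowP => k; rewrite [RHS](trans_entry _ _ _ di dj).
have -> : 'D_v (loc i (chart j) \o F) x 0 k =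
    'D_v (fun t => loc i (chart j) (F t) 0 k) x by rewrite (derive_mx d1) mxE.
by apply: (H 0 k _).2; exact: trans_diff.
Qed.

Lemma trans_id i p w : dom i p -> 'D_w (loc i (chart i)) (chart i p) = w.
Proof.
move=> di; rewrite -[RHS](derive_id (chart i p) w).
apply: (eq_derive_on (U := img i (dom i))); first exact: at_open.
  exact/img_chart.
by move=> y; rewrite inE => -[q [dq _] <-]; rewrite loc_chart.
Qed.

Lemma trans_chain i j l p w : dom i p -> dom j p -> dom l p ->
  'D_w (loc i (chart l)) (chart i p) =
  'D_('D_w (loc i (chart j)) (chart i p)) (loc j (chart l)) (chart j p).
Proof.
move=> di dj dl; have F := trans_derivable (w := w) di dj.
have e : loc i (chart j) (chart i p) = chart j p by rewrite loc_chart.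
rewrite -(trans_comp dj dl e F).2.
apply: (eq_derive_on (U := img i (dom j) `&` img i (dom l))).
- by apply: openI; exact: at_open.
- by split; exact/img_chart.
- move=> y; rewrite inE => -[[q [diq djq] <-] /(img_chart _ diq) dlq].
  by rewrite /= !loc_chart.
Qed.

(** Evaluation in chart [i] identifies the tangent vectors at [p] with row vectors, and [mkvec i p]
    is the inverse map; [coordvec] is its value on [bvec]. *)
Definition mkvec i p (w : 'rV[R]_n) : idx X -> 'rV[R]_n :=
  fun j => if `[< dom j p >] then 'D_w (loc i (chart j)) (chart i p) else 0.

Lemma mkvec_in i p w j : dom j p ->
  mkvec i p w j = 'D_w (loc i (chart j)) (chart i p).
Proof. by rewrite /mkvec => /asboolP ->. Qed.

Lemma mkvec_self i p w : dom i p -> mkvec i p w i = w.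
Proof. by move=> di; rewrite mkvec_in// trans_id. Qed.

Lemma tangent_mkvec i p w : dom i p -> tangent p (mkvec i p w).
Proof.
move=> di; split=> [j /asboolPn/negbTE dj|j l dj dl]; first by rewrite /mkvec dj.
rewrite (mkvec_in _ _ dj) (mkvec_in _ _ dl); exact: trans_chain.
Qed.

Lemma tangent_ext i p u v : dom i p -> tangent p u -> tangent p v ->
  u i = v i -> u = v.
Proof.
move=> di [u0 tu] [v0 tv] uv; apply/funext => j.
have [dj|dj] := pselect (dom j p); last by rewrite u0// v0.
by rewrite (tu i j di dj) (tv i j di dj) uv.
Qed.

Lemma tangent_mkvecE i p v : dom i p -> tangent p v -> v = mkvec i p (v i).
Proof.
move=> di tv; apply: (tangent_ext di tv (tangent_mkvec _ di)).
by rewrite mkvec_self.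
Qed.

Lemma tangent_linear p (c : R) u v : tangent p u -> tangent p v ->
  tangent p (c *: u + v).
Proof.
move=> [u0 tu] [v0 tv]; split=> [i di|i j di dj].
  rewrite -[LHS]/(c *: u i + v i) (u0 _ di) (v0 _ di) scaler0; exact: addr0.
rewrite -[LHS]/(c *: u j + v j) -[X in derive _ _ X]/(c *: u i + v i).
by rewrite [RHS](trans_linear _ _ _ di dj) (tu i j di dj) (tv i j di dj).
Qed.

Lemma tangent0 p : tangent p (0 : idx X -> 'rV[R]_n).
Proof.
by split=> // i j di dj; rewrite -[X in derive _ _ X]/(0 : 'rV[R]_n) derive0.
Qed.

Lemma tangent_sum p (I : Type) (r : seq I) (c : I -> R) (u : I -> idx X -> 'rV[R]_n) :
  (forall s, tangent p (u s)) -> tangent p (\sum_(s <- r) c s *: u s).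
Proof.
move=> tu; elim: r => [|i r IH]; first by rewrite big_nil; exact: tangent0.
by rewrite big_cons; exact: (tangent_linear (c i) (tu i) IH).
Qed.

Section Curves.
Variable c : R -> pt X.
Hypothesis curve_c : curve c.

(** The definition of a curve provides a single chart; continuity and the transition maps carry
    derivability to every chart around [c 0]. *)
Lemma curve_chart j : dom j (c 0) ->
  (\forall t \near (0 : R), dom j (c t)) /\
  derivable (fun t => chart j (c t)) 0 1.
Proof.
move=> dj; have [i [e [e0 dc sc]]] := curve_c.
have di : dom i (c 0) by apply: dc; rewrite normr0.
have U0 : [set s : R | `|s| < e] 0 by rewrite /= normr0.
have cc : {for 0, continuous (fun t => chart i (c t))} := C_on_cont (sc 0%N) U0.
have dcc : derivable (fun t => chart i (c t)) 0 1 := C_on_derivable (sc 1%N) U0.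
have n1 : \forall t \near (0 : R), dom i (c t).
  by apply/nbhs_normP; exists e => // y; rewrite subr0; exact: dc.
have n2 : \forall t \near (0 : R), img i (dom j) (chart i (c t)).
  apply: cc; apply: open_nbhs_nbhs; split; first exact: at_open.
  exact/img_chart.
have nj : \forall t \near (0 : R), dom j (c t).
  by apply: filterS2 n1 n2 => t dt /(img_chart _ dt).
split; first exact: nj.
have [d _] := @trans_comp R (fun t => chart i (c t)) 0 1 i j (c 0) di dj erefl dcc.
apply: near_eq_derivable d; apply: filterS n1 => t dt /=.
by rewrite loc_chart.
Qed.

Lemma velocityE j : dom j (c 0) -> velocity c 0 j = 'D_1 (fun t => chart j (c t)) 0.
Proof. by rewrite /velocity => /asboolP ->; rewrite derive1E. Qed.

Lemma tangent_velocity : tangent (c 0) (velocity c 0).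
Proof.
split=> [i /asboolPn/negbTE di|i j di dj]; first by rewrite /velocity di.
have [ni ddi] := curve_chart di; rewrite (velocityE di) (velocityE dj).
have [_ <-] := @trans_comp R (fun t => chart i (c t)) 0 1 i j (c 0) di dj erefl ddi.
by apply: near_eq_derive; apply: filterS ni => t dt /=; rewrite loc_chart.
Qed.

End Curves.

(** Every tangent vector is a velocity, so the sets from which [differential] and [connection_map]
    choose their values are not empty. *)
Lemma line_curve i p w : dom i p ->
  exists c, [/\ curve c, c 0 = p & velocity c 0 = mkvec i p w].
Proof.
move=> di.
pose A (t : R) := [set q | dom i q /\ chart i q = t *: w + chart i p].
(* The curve must be total: where no point of the chart has the required coordinates, its value is
   [p]. *)
pose c (t : R) : pt X :=
  if pselect (exists q, A t q) is left e then sval (cid e) else p.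
have cA t : (exists q, A t q) -> A t (c t).
  by rewrite /c; case: pselect => // e _; exact: svalP.
have A0 : A 0 p by split; rewrite // scale0r add0r.
have c0 : c 0 = p.
  have [dq eq] := cA 0 (ex_intro _ p A0); apply: (chart_inj dq di).
  by rewrite eq scale0r add0r.
have /nbhs_normP[d d0 dP] : nbhs (chart i p) (img i (dom i)).
  by apply: open_nbhs_nbhs; split; [exact: at_open|exact/img_chart].
pose e := d / (`|w| + 1).
have e0 : 0 < e by rewrite divr_gt0// ltr_wpDl.
have cP t : `|t| < e -> dom i (c t) /\ chart i (c t) = t *: w + chart i p.
  rewrite ltr_pdivlMr ?ltr_wpDl// => td.
  have [q [dq _] eq] : img i (dom i) (t *: w + chart i p).
    apply: dP; rewrite addrK normrZ; apply: le_lt_trans td.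
    by rewrite ler_wpM2l// lerDl.
  by apply: cA; exists q.
have aff t : derivable (fun s : R => s *: w + chart i p) t 1 /\ 'D_1 (fun s : R => s *: w + chart i p) t = w.
  have [a b] := derive_line (@id 'rV[R]_n) (chart i p) w t.
  by split; [apply/a; exact: derivable_id|rewrite b derive_id].
have oe : open [set s : R | `|s| < e].
  rewrite openE => s /= se; apply/nbhs_normP; exists (e - `|s|); first by rewrite subr_gt0.
  move=> y ys /=; rewrite -[y](subrK s); apply: le_lt_trans (ler_normD _ _) _.
  by rewrite -ltrBrDr.
have cc : curve c.
  exists i, e; split => // [s /cP[]//|k].
  apply: (eq_C_on (f := fun s : R => s *: w + chart i p)) => //.
    by move=> t; rewrite inE => /cP[_ ->].
  have lin : linear (fun s : R => s *: w) by move=> a s t; rewrite scalerDl scalerA.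
  pose L : {linear R -> 'rV[R]_n} := HB.pack (fun s : R => s *: w) (GRing.isLinear.Build _ _ _ _ _ lin).
  apply: C_on_add => //; last exact: C_on_cst.
  by apply: (@C_on_lin _ _ _ _ _ L) => t; exact: scalel_continuous.
exists c; split => //.
apply: (@tangent_ext i p) => //.
- by rewrite -[in X in tangent X]c0; exact: tangent_velocity.
- exact: tangent_mkvec.
rewrite mkvec_self// velocityE ?c0//.
rewrite -[RHS](aff 0).2; apply: near_eq_derive.
by apply/nbhs_normP; exists e => // t; rewrite subr0 => /cP[].
Qed.

End Atlas.

(** * The atlas of the tangent bundle *)

Section TangentAtlas.
Variables (R : realType) (n : nat) (M : charted R n).
Hypothesis atM : atlas M.
Implicit Types (i j : idx M) (p q : pt M).

Lemma tpoint_eq (x y : tpoint M) : foot x = foot y -> tvec x = tvec y -> x = y.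
Proof.
case: x => p v tv; case: y => q w tw /= pq vw; subst q w.
by rewrite (Prop_irrelevance tv tw).
Qed.

Definition mkpt i p w (di : dom i p) : tpoint M := TPoint (tangent_mkvec atM w di).

Lemma TM_inj i : set_inj (@dom R (n + n) (TM M) i) (@chart R (n + n) (TM M) i).
Proof.
move=> x y; rewrite !inE => dx dy /= /eq_row_mx[cxy txy].
have xy : foot x = foot y by exact: (chart_inj atM dx dy).
apply: tpoint_eq => //; apply: (@tangent_ext _ _ M i (foot x)) => //; first exact: tvecP.
by rewrite xy; exact: tvecP.
Qed.

Definition domTM i j : set 'rV[R]_(n + n) := lsubmx @^-1` (img (X := M) i (dom j)).

Lemma open_domTM i j : open (domTM i j).
Proof.
apply: open_comp; last exact: at_open.
by move=> z _; exact: continuous_lsubmx.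
Qed.

Lemma img_TM i j : img (X := TM M) i (@dom R (n + n) (TM M) j) = domTM i j.
Proof.
apply/seteqP; split => z.
  by case=> x [dx dxj] <-; rewrite /domTM /= row_mxKl; exists (foot x).
case=> p [dp dpj] pz; exists (mkpt (rsubmx z) dp); first by [].
by rewrite /= mkvec_self// pz hsubmxK.
Qed.

Lemma loc_TM (W : lmodType R) i (f : tpoint M -> W) (x : tpoint M) : dom i (foot x) ->
  loc (X := TM M) i f (row_mx (chart i (foot x)) (tvec x i)) = f x.
Proof.
move=> dx; apply: xget_subset1; first by exists x.
move=> _ _ [y [dy cy ->]] [z [dz cz ->]]; congr f.
by apply: (@TM_inj i); rewrite ?inE// cy cz.
Qed.

Lemma trans_TM i j z : img (X := M) i (dom j) (lsubmx z) ->
  loc (X := TM M) i (chart (c := TM M) j) z =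
  row_mx (loc i (chart j) (lsubmx z)) ('D_(rsubmx z) (loc i (chart j)) (lsubmx z)).
Proof.
case=> p [dp dpj] pz.
have -> : z = row_mx (chart i (foot (mkpt (rsubmx z) dp))) (tvec (mkpt (rsubmx z) dp) i).
  by rewrite /= mkvec_self// pz hsubmxK.
rewrite loc_TM//= row_mxKl row_mxKr (loc_chart atM _ dp) (mkvec_in _ _ dpj).
by rewrite mkvec_self.
Qed.

Lemma derive_trans_sum i j k y u : img i (dom j) y ->
  'D_u (loc i (chart j)) y 0 k =
  \sum_l u 0 l * 'D_(bvec R l) (fun y => loc i (chart j) y 0 k) y.
Proof.
case=> p [dp dpj] <-; rewrite [LHS](trans_entry atM _ _ _ dp dpj).
by rewrite (derive_sumdir u (trans_diff atM 0 k dp dpj)).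
Qed.

Lemma trans_TM_C i j k :
  mC k (domTM i j) (loc (X := TM M) i (chart (c := TM M) j)).
Proof.
move=> a b; rewrite ord1 {a}.
have oU : open (domTM i j) by exact: open_domTM.
have cl l (f : 'rV[R]_n -> R) : C_on l (img (X := M) i (dom j)) f ->
    C_on l (domTM i j) (f \o (lsubmx : 'rV[R]_(n + n) -> 'rV[R]_n)).
  by apply: C_on_comp_lin => z; exact: continuous_lsubmx.
case: (split_ordP b) => c ->.
  apply: (eq_C_on (f := (fun y => loc (X := M) i (chart j) y 0 c) \o lsubmx)) => //.
    by move=> z; rewrite inE => Uz; rewrite trans_TM// row_mxEl.
  by apply: cl; exact: at_C.
apply: (eq_C_on (f := fun z : 'rV[R]_(n + n) => \sum_l z 0 (rshift n l) *
   ('D_(bvec R l) (fun y => loc (X := M) i (chart j) y 0 c) \o lsubmx) z)) => //.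
  move=> z; rewrite inE => Uz; rewrite trans_TM// row_mxEr derive_trans_sum//.
  by apply: eq_bigr => l _; rewrite mxE.
apply: C_on_sum => // l _; apply: C_on_mul => //; first exact: C_on_coord.
by apply: cl; apply: C_on_derive; exact: at_C.
Qed.

Lemma TM_atlas : atlas (TM M).
Proof.
split; first exact: TM_inj.
  by move=> i j; rewrite img_TM; exact: open_domTM.
by move=> i j k; rewrite img_TM; exact: trans_TM_C.
Qed.

(** The last sum is the Hessian of the base transition map applied to [lsubmx z] and the fibre
    vector. Because of it the fibre component alone has no invariant meaning, and a connection is
    needed to correct it. *)
Lemma derive_trans_TM i j (x : tpoint M) (z : 'rV[R]_(n + n)) :
  dom i (foot x) -> dom j (foot x) ->
  'D_z (loc (X := TM M) i (chart (c := TM M) j)) (chart (c := TM M) i x) =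
  row_mx ('D_(lsubmx z) (loc i (chart j)) (chart i (foot x)))
    ('D_(rsubmx z) (loc i (chart j)) (chart i (foot x)) +
     \row_k \sum_l tvec x i 0 l *
       'D_(lsubmx z) ('D_(bvec R l) (fun y => loc i (chart j) y 0 k)) (chart i (foot x))).
Proof.
move=> di dj.
have oU : open (domTM i j) by exact: open_domTM.
pose y : 'rV[R]_(n + n) := row_mx (chart i (foot x)) (tvec x i).
have Uy : domTM i j y.
  by rewrite /domTM /= row_mxKl; exact/img_chart.
have aff (t : R) : lsubmx (t *: z + y) = t *: lsubmx z + lsubmx y by rewrite linearP.
have aff1 (f : 'rV[R]_n -> R) := derive_comp_affine f aff.
apply/rowP => b; rewrite [LHS](trans_entry TM_atlas z 0 b di dj).
case: (split_ordP b) => c ->.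
  rewrite row_mxEl (trans_entry atM _ _ _ di dj).
  transitivity ('D_z ((fun y => loc (X := M) i (chart j) y 0 c) \o lsubmx) y).
    apply: (eq_derive_on _ oU Uy) => z'; rewrite inE => Uz.
    by rewrite trans_TM// row_mxEl.
  by rewrite (aff1 _).2 row_mxKl.
transitivity ('D_z (fun z : 'rV[R]_(n + n) => \sum_l z 0 (rshift n l) *
   ('D_(bvec R l) (fun y => loc (X := M) i (chart j) y 0 c) \o lsubmx) z) y).
  apply: (eq_derive_on _ oU Uy) => z'; rewrite inE => Uz.
  rewrite trans_TM// row_mxEr derive_trans_sum//.
  by apply: eq_bigr => l _; rewrite mxE.
have c1 l : derivable (fun z : 'rV[R]_(n + n) => z 0 (rshift n l)) y z.
  by apply: (C_on_derivable (k := 0%N) (U := setT)) => //; exact: C_on_coord.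
have D1 l : 'D_z (fun z : 'rV[R]_(n + n) => z 0 (rshift n l)) y = z 0 (rshift n l).
  have := derive_id y z; rewrite derive_mx; last exact: derivable_id.
  by move/rowP => /(_ (rshift n l)); rewrite mxE.
have c2 l : derivable ('D_(bvec R l) (fun y => loc (X := M) i (chart j) y 0 c) \o lsubmx) y z.
  apply/(aff1 _).1; rewrite row_mxKl.
  apply: (C_on_derivable (k := 0%N) (U := img i (dom j))); last exact/img_chart.
  by apply: C_on_derive; exact: at_C.
rewrite derive_sum_on => [|l]; last exact: (derivableM (c1 l) (c2 l)).
rewrite row_mxEr mxE [X in _ = X + _]derive_trans_sum; last exact/img_chart.
rewrite mxE -big_split/=; apply: eq_bigr => l _.
rewrite (deriveM (c1 l) (c2 l)) D1 (aff1 _).2 /= row_mxKl row_mxEr addrC.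
rewrite -[X in X + _]/(_ * _) -[X in _ + X = _]/(_ * _) mxE mulrC; congr (_ + _).
exact: mulrC.
Qed.

End TangentAtlas.

(** * Christoffel symbols and moving frames *)

Definition bil (R : pzRingType) (n : nat) (S : 'M[R]_n) (u v : 'rV[R]_n) : R :=
  (u *m S *m v^T) 0 0.

Section Bil.
Variables (R : comPzRingType) (n : nat) (S : 'M[R]_n).
Implicit Types u v w : 'rV[R]_n.

Lemma bilDl u v w : bil S (u + v) w = bil S u w + bil S v w.
Proof. by rewrite /bil !mulmxDl mxE. Qed.
Lemma bilDr u v w : bil S w (u + v) = bil S w u + bil S w v.
Proof. by rewrite /bil linearD/= mulmxDr mxE. Qed.
Lemma bilZl c u w : bil S (c *: u) w = c * bil S u w.
Proof. by rewrite /bil -!scalemxAl mxE. Qed.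
Lemma bilZr c u w : bil S w (c *: u) = c * bil S w u.
Proof. by rewrite /bil linearZ/= -scalemxAr mxE. Qed.
Lemma bil0l w : bil S 0 w = 0.
Proof. by rewrite /bil !mul0mx mxE. Qed.
Lemma bil0r w : bil S w 0 = 0.
Proof. by rewrite /bil trmx0 mulmx0 mxE. Qed.
Lemma bilE u v : bil S u v = \sum_k \sum_l u 0 k * S k l * v 0 l.
Proof.
rewrite /bil mxE exchange_big/=; apply: eq_bigr => l _.
by rewrite !mxE big_distrl.
Qed.
Lemma bilC u v : S^T = S -> bil S u v = bil S v u.
Proof.
move=> sS; rewrite !bilE exchange_big/=; apply: eq_bigr => l _.
apply: eq_bigr => k _; have -> : S k l = S l k by rewrite -{1}sS mxE.
by rewrite mulrC [u 0 k * _]mulrC mulrA.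
Qed.
Lemma bil_delta k l : bil S (delta_mx 0 k) (delta_mx 0 l) = S k l.
Proof. by rewrite /bil -rowE trmx_delta -colE !mxE. Qed.
End Bil.

Lemma bil_mul (R : comPzRingType) (m n : nat) (S : 'M[R]_n) (J : 'M[R]_(m, n)) u v :
  bil S (u *m J) (v *m J) = bil (J *m S *m J^T) u v.
Proof. by rewrite /bil trmx_mul !mulmxA. Qed.

Lemma bil_mxD (R : comPzRingType) (n : nat) (S T : 'M[R]_n) u v :
  bil (S + T) u v = bil S u v + bil T u v.
Proof. by rewrite /bil mulmxDr mulmxDl mxE. Qed.

Section Metric.
Variables (R : realType) (n : nat) (X : charted R n) (g : bilin X).
Hypotheses (atX : atlas X) (rg : riemannian g).
Implicit Types (i j : idx X) (p q : pt X).

Definition cdom i : set 'rV[R]_n := img i setT.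

Lemma cdomE i : cdom i = img i (dom i).
Proof. by apply/seteqP; split => y [p [dp _] <-]; exists p. Qed.

Lemma open_cdom i : open (cdom i).
Proof. by rewrite cdomE; exact: at_open. Qed.

Lemma cdom_chart i p : dom i p -> cdom i (chart i p).
Proof. by move=> dp; exists p. Qed.

Lemma g_suml p (I : Type) (r : seq I) (c : I -> R) (u : I -> idx X -> 'rV[R]_n) w :
  (forall s, tangent p (u s)) -> tangent p w ->
  g p (\sum_(s <- r) c s *: u s) w = \sum_(s <- r) c s * g p (u s) w.
Proof.
move=> tu tw; elim: r => [|s r IH].
  rewrite !big_nil; have t0 := @tangent0 R n X p.
  have := rm_linear rg (-1) t0 t0 tw.
  by rewrite scaler0 addr0 mulN1r addNr.
rewrite !big_cons (rm_linear rg (c s) (tu s) (tangent_sum atX r c tu) tw).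
by rewrite IH.
Qed.

Lemma g_sumr p (I : Type) (r : seq I) (c : I -> R) (u : I -> idx X -> 'rV[R]_n) w :
  (forall s, tangent p (u s)) -> tangent p w ->
  g p w (\sum_(s <- r) c s *: u s) = \sum_(s <- r) c s * g p w (u s).
Proof.
move=> tu tw; rewrite (rm_sym rg tw (tangent_sum atX r c tu)) (g_suml r c tu tw).
by apply: eq_bigr => s _; rewrite (rm_sym rg (tu s) tw).
Qed.

Lemma mkvec_sum i p w : dom i p ->
  mkvec i p w = \sum_k w 0 k *: coordvec i k p.
Proof.
move=> di; have tc k : tangent p (coordvec i k p) := tangent_mkvec atX (bvec R k) di.
apply: (tangent_ext di (tangent_mkvec atX w di) (tangent_sum atX _ _ tc)).
rewrite (mkvec_self atX w di) fct_sumE [LHS]row_sum_delta; apply: eq_bigr => k _.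
by rewrite -[RHS]/(w 0 k *: mkvec i p (bvec R k) i) (mkvec_self atX _ di).
Qed.

Lemma gmat_bil i p u v : dom i p -> tangent p u -> tangent p v ->
  g p u v = bil (gmat g i (chart i p)) (u i) (v i).
Proof.
move=> di tu tv.
have tc k : tangent p (coordvec i k p) := tangent_mkvec atX (bvec R k) di.
have e w : tangent p w -> w = \sum_k w i 0 k *: coordvec i k p.
  by move=> tw; rewrite -(mkvec_sum (w i) di); exact: tangent_mkvecE.
transitivity (g p (\sum_k u i 0 k *: coordvec i k p) v).
  by congr (g p _ v); exact: e.
rewrite (g_suml _ _ tc tv) bilE; apply: eq_bigr => k _.
transitivity (u i 0 k * g p (coordvec i k p) (\sum_l v i 0 l *: coordvec i l p)).
  by congr (_ * g p _ _); exact: e.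
rewrite (g_sumr _ _ tc (tc k)) big_distrr/=; apply: eq_bigr => l _.
rewrite /gmat (loc_chart atX _ di) mxE -mulrA; congr (_ * _); exact: mulrC.
Qed.

Lemma gmat_C i k : mC k (cdom i) (gmat g i).
Proof.
by move=> a b; apply: C_on_entry; [exact: open_cdom|exact: rm_smooth].
Qed.

Lemma gmat_sym i y : cdom i y -> (gmat g i y)^T = gmat g i y.
Proof.
case=> p [dp _] <-; apply/matrixP => k l.
rewrite mxE /gmat (loc_chart atX _ dp) !mxE.
exact: (rm_sym rg (tangent_mkvec atX _ dp) (tangent_mkvec atX _ dp)).
Qed.

Lemma gmat_pos i y w : cdom i y -> w != 0 -> 0 < bil (gmat g i y) w w.
Proof.
case=> p [dp _] <- w0; have tw := tangent_mkvec atX w dp.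
have := gmat_bil dp tw tw; rewrite (mkvec_self atX w dp) => <-.
apply: (rm_pos rg) => // H; move/eqP: w0; apply.
by rewrite -(mkvec_self atX w dp) H.
Qed.

Lemma gmat_unit i y : cdom i y -> gmat g i y \in unitmx.
Proof.
move=> Uy; rewrite -row_free_unit; apply/inj_row_free => v v0.
apply/eqP/negPn/negP => /(gmat_pos Uy).
by rewrite /bil v0 mul0mx mxE ltxx.
Qed.

(** Row [b] holds the components of the covariant derivative of [d_b] along [d_a]. Vectors are rows
    acted on from the right, so matrix products appear in the reverse order of the operators. *)
Definition chm i a y : 'M[R]_n := \matrix_(b, k) christoffel g i k a b y.

(** [w *m chv i u y] is the covariant derivative along [u] of the field with constant components
    [w]. *)
Definition chv i (u : 'rV[R]_n) y : 'M[R]_n := \sum_a u 0 a *: chm i a y.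

(** Christoffel symbols of the first kind. *)
Definition lowered i a b s y : R :=
  2^-1 * (dgmat g i a b s y + dgmat g i b a s y - dgmat g i s a b y).

Lemma dgmat_sym i a b c y : cdom i y -> dgmat g i a b c y = dgmat g i a c b y.
Proof.
move=> Uy; apply: (eq_derive_on _ (open_cdom (i:=i)) Uy) => z; rewrite inE => Uz.
by rewrite -[in LHS](gmat_sym Uz) mxE.
Qed.

Lemma chm_mul i a b y : cdom i y ->
  row b (chm i a y) = \row_s lowered i a b s y *m invmx (gmat g i y).
Proof.
move=> Uy; apply/rowP => k; rewrite !mxE /christoffel big_distrr/=.
apply: eq_bigr => s _; rewrite mxE /lowered.
have := trmx_inv (gmat g i y); rewrite gmat_sym// => /matrixP/(_ k s).
by rewrite mxE => ->; rewrite -mulrA; congr (_ * _); exact: mulrC.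
Qed.

Lemma chm_eq i a b y v : cdom i y ->
  (forall s, lowered i a b s y = (v *m gmat g i y) 0 s) -> row b (chm i a y) = v.
Proof.
move=> Uy H; rewrite chm_mul//.
have -> : \row_s lowered i a b s y = v *m gmat g i y by apply/rowP => s; rewrite mxE.
by rewrite mulmxK// gmat_unit.
Qed.

Lemma chm_gmat i a y : cdom i y ->
  chm i a y *m gmat g i y = \matrix_(b, s) lowered i a b s y.
Proof.
move=> Uy; apply/row_matrixP => b; rewrite row_mul chm_mul// mulmxKV ?gmat_unit//.
by apply/rowP => s; rewrite !mxE.
Qed.

Lemma chm_sym i a b k y : cdom i y -> chm i a y b k = chm i b y a k.
Proof.
move=> Uy; have /rowP/(_ k) : row b (chm i a y) = row a (chm i b y).
  rewrite !(chm_mul _ _ Uy); congr mulmx; apply/rowP => s; rewrite !mxE /lowered.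
  by rewrite (dgmat_sym s a b Uy) [dgmat _ _ _ _ _ _ + _]addrC.
by rewrite ![row _ _ 0 _]mxE.
Qed.

Lemma chm_compat i a y : cdom i y ->
  dmx (bvec R a) (gmat g i) y = chm i a y *m gmat g i y + gmat g i y *m (chm i a y)^T.
Proof.
move=> Uy; rewrite -[X in _ + X *m _](gmat_sym Uy) -trmx_mul chm_gmat//.
apply/matrixP => b s; rewrite !mxE -/(dgmat g i a b s y) /lowered.
by rewrite (dgmat_sym a s b Uy); field.
Qed.

(** Uniqueness of the Levi-Civita connection at one point. Lowering an index of [Y] turns
    compatibility into [dg_c(d, e) = Z c d e + Z c e d] and vanishing torsion into
    [Z c d e = Z d c e]; the combination defining [lowered] then isolates [Z]. *)
Lemma LC_uniq i y (Y : 'I_n -> 'M[R]_n) a : cdom i y ->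
    (forall b, dmx (bvec R b) (gmat g i) y = Y b *m gmat g i y + gmat g i y *m (Y b)^T) ->
    (forall b c, row c (Y b) = row b (Y c)) ->
  Y a = chm i a y.
Proof.
move=> Uy HY sY; apply/row_matrixP => b; apply/esym/chm_eq => // s.
pose Z c := Y c *m gmat g i y.
have dZ c d e : dgmat g i c d e y = Z c d e + Z c e d.
  have /matrixP/(_ d e) := HY c; rewrite mxE => H.
  rewrite /dgmat [LHS]H mxE; congr (_ + _).
  by rewrite -[X in X *m _](gmat_sym Uy) -trmx_mul mxE.
have sZ c d e : Z c d e = Z d c e.
  have : row d (Z c) = row c (Z d) by rewrite !row_mul sY.
  by move/rowP/(_ e); rewrite ![row _ _ 0 _]mxE.
rewrite -row_mul [RHS]mxE -/(Z a) /lowered !dZ.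
by rewrite (sZ b a s) (sZ s a b) (sZ s b a); field.
Qed.

Lemma dmx_sumdir (m l : nat) (F : 'rV[R]_n -> 'M[R]_(m, l)) i y u :
  cdom i y -> mC 1 (cdom i) F ->
  dmx u F y = \sum_a u 0 a *: dmx (bvec R a) F y.
Proof.
move=> Uy cF; apply/matrixP => b c; rewrite mxE summxE.
rewrite derive_sumdir; last exact: (differentiable_C1 (open_cdom (i:=i)) Uy).
by apply: eq_bigr => a _; rewrite !mxE.
Qed.

Lemma chm_C i a k : mC k (cdom i) (chm i a).
Proof.
move=> b c; have oU := open_cdom (i:=i).
apply: (eq_C_on (f := fun y => 2^-1 * \sum_s invmx (gmat g i y) c s *
    (dgmat g i a b s y + dgmat g i b a s y - dgmat g i s a b y))) => //.
  by move=> y _; rewrite mxE.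
apply: C_on_scale => //; apply: C_on_sum => // s _; apply: C_on_mul => //.
  by apply: mC_inv => [//|y|]; [exact: gmat_unit|exact: gmat_C].
have dC d e f : C_on k (cdom i) (dgmat g i d e f) by apply: C_on_derive; exact: gmat_C.
by apply: C_on_sub2 => //; apply: C_on_add.
Qed.

Lemma chv_C i u k : mC k (cdom i) (chv i u).
Proof.
have oU := open_cdom (i:=i); apply: mC_sum => // a _; apply: mC_scale => //.
  exact: C_on_cst.
exact: chm_C.
Qed.

Lemma chv_bvec i a y : chv i (bvec R a) y = chm i a y.
Proof.
rewrite /chv (bigD1 a)//= big1 ?addr0 ?mxE ?eqxx ?scale1r// => b ba.
by rewrite mxE (negbTE ba) andbF scale0r.
Qed.

Lemma chvD i u v y : chv i (u + v) y = chv i u y + chv i v y.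
Proof. by rewrite /chv -big_split/=; apply: eq_bigr => a _; rewrite mxE scalerDl. Qed.

Lemma chvZ i c u y : chv i (c *: u) y = c *: chv i u y.
Proof. by rewrite /chv scaler_sumr; apply: eq_bigr => a _; rewrite mxE scalerA. Qed.

Lemma chv0 i y : chv i 0 y = 0.
Proof. by rewrite /chv big1// => a _; rewrite mxE scale0r. Qed.

Lemma chv_sym i u w y : cdom i y -> w *m chv i u y = u *m chv i w y.
Proof.
move=> Uy; apply/rowP => k; rewrite !mxE.
under eq_bigr do rewrite summxE big_distrr/=.
under [RHS]eq_bigr do rewrite summxE big_distrr/=.
rewrite exchange_big/=; apply: eq_bigr => a _; apply: eq_bigr => b _.
by rewrite [X in _ * X = _]mxE [X in _ = _ * X]mxE (chm_sym a b k Uy) mulrCA.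
Qed.

Lemma chv_compat i u y : cdom i y ->
  dmx u (gmat g i) y = chv i u y *m gmat g i y + gmat g i y *m (chv i u y)^T.
Proof.
move=> Uy; rewrite (dmx_sumdir u Uy (gmat_C i 1)) /chv linear_sum/= mulmx_suml mulmx_sumr.
rewrite -big_split/=; apply: eq_bigr => a _.
by rewrite chm_compat// scalerDr linearZ/= -scalemxAl -scalemxAr.
Qed.

Definition curvm i a b y : 'M[R]_n := \matrix_(c, k) curvcoef g i k c a b y.

Lemma curvmE i a b y :
  curvm i a b y = dmx (bvec R a) (chm i b) y - dmx (bvec R b) (chm i a) y
    + (chm i b y *m chm i a y - chm i a y *m chm i b y).
Proof.
apply/matrixP => c k; rewrite !mxE /curvcoef; congr (_ - _ + _).
- by apply: derive_ext => z; rewrite mxE.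
- by apply: derive_ext => z; rewrite mxE.
rewrite sumrB; congr (_ - _); apply: eq_bigr => s _; rewrite !mxE; exact: mulrC.
Qed.

Lemma flatP : flat g <-> forall i y a b, cdom i y -> curvm i a b y = 0.
Proof.
split=> [fg i _ a b [p [dp _] <-]|H p u v w tu tv tw].
  apply/matrixP => c k; rewrite !mxE.
  have tm d := tangent_mkvec atX (bvec R d) dp.
  have := congr1 (fun f => f i) (fg p _ _ _ (tm a) (tm b) (tm c)).
  rewrite /curvature asboolT//= => /rowP/(_ k); rewrite !mxE.
  rewrite !(mkvec_self atX _ dp) (bigD1 a)//= [X in _ + X]big1 ?addr0; last first.
    move=> d da; rewrite big1// => e _; rewrite big1// => f _.
    by rewrite !mxE (negbTE da) /= mulr0 !mul0r.
  rewrite (bigD1 b)//= [X in _ + X]big1 ?addr0; last first.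
    move=> e eb; rewrite big1// => f _.
    by rewrite !mxE (negbTE eb) /= mulr0 !mul0r.
  rewrite (bigD1 c)//= [X in _ + X]big1 ?addr0; last first.
    by move=> f fc; rewrite !mxE (negbTE fc) /= mulr0.
  by rewrite !mxE !eqxx /= !mulr1.
apply/funext => i; rewrite /curvature; case: asboolP => // di.
apply/rowP => k; rewrite !mxE big1// => a _; rewrite big1// => b _.
rewrite big1// => c _; have /matrixP/(_ c k) := H i (chart i p) a b (cdom_chart di).
by rewrite !mxE => ->; rewrite !mul0r.
Qed.

End Metric.

(** [Ca] and [Wa] are connection matrices in two frames related by [T]; [Ta] is the derivative of
    [T] along [a], [Cab] that of [Cb], [Wab] that of [Wb], and [S] is the second derivative of [T],
    common to both orders. Eliminating [S] leaves the tensorial behaviour of curvature. *)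
Lemma frame_algebra (R : comPzRingType) (n : nat)
    (T Ca Cb Wa Wb Ta Tb Cab Cba Wab Wba S : 'M[R]_n) :
    Ca *m T = T *m Wa + Ta -> Cb *m T = T *m Wb + Tb ->
    Cab *m T + Cb *m Ta = Ta *m Wb + T *m Wab + S ->
    Cba *m T + Ca *m Tb = Tb *m Wa + T *m Wba + S ->
  (Cab - Cba + (Cb *m Ca - Ca *m Cb)) *m T =
  T *m (Wab - Wba + (Wb *m Wa - Wa *m Wb)).
Proof.
move=> ha hb /(canRL (addrK _)) hab /(canRL (addrK _)) hba.
rewrite mulmxDl !mulmxBl -!mulmxA ha hb hab hba !mulmxDr !mulmxN !mulmxA ha hb.
rewrite !mulmxDl.
move: (Ta *m Wb) (Tb *m Wa) (T *m Wab) (T *m Wba) (Cb *m Ta) (Ca *m Tb) => A B C D E F.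
move: (T *m Wa *m Wb) (T *m Wb *m Wa) => G H.
apply/matrixP => k l; rewrite !mxE; ring.
Qed.

(** * Connection and curvature in a moving frame *)

Section Frame.
Variables (R : realType) (n : nat) (X : charted R n) (g : bilin X).
Hypotheses (atX : atlas X) (rg : riemannian g).
Variables (i : idx X) (U : set 'rV[R]_n).
Hypotheses (oU : open U) (sU : U `<=` cdom i).
Variables (th D : 'rV[R]_n -> 'M[R]_n) (om : 'I_n -> 'rV[R]_n -> 'M[R]_n).
Hypotheses (thC : mC 2 U th) (DC : mC 1 U D) (omC : forall a, mC 1 U (om a)).
Hypothesis gE : forall y, U y -> gmat g i y = th y *m D y *m (th y)^T.
Hypothesis Dcompat : forall a y, U y ->
  dmx (bvec R a) D y = om a y *m D y + D y *m (om a y)^T.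
Hypothesis torsion : forall a b y, U y ->
  row b (th y *m om a y + dmx (bvec R a) th y) =
  row a (th y *m om b y + dmx (bvec R b) th y).

Let thC1 : mC 1 U th. Proof. exact: mC_le thC. Qed.

(** Non-degeneracy of [g] already forces [th] to be invertible. For the coframe [(dx, D zeta)] this
    replaces a proof that [zeta] is a local diffeomorphism on the fibres. *)
Lemma frame_unit y : U y -> th y \in unitmx.
Proof.
move=> Uy; have := gmat_unit atX rg (sU Uy); rewrite gE// -mulmxA.
by rewrite unitmx_mul => /andP[].
Qed.

(** Transported to the coordinate frame, [om] becomes a connection that is metric by [Dcompat] and
    torsion free by [torsion]; uniqueness identifies it with the Levi-Civita connection. *)
Lemma frame_christoffel a y : U y ->
  chm g i a y *m th y = th y *m om a y + dmx (bvec R a) th y.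
Proof.
move=> Uy; have uth := frame_unit Uy.
pose Y b := (th y *m om b y + dmx (bvec R b) th y) *m invmx (th y).
have YE b : Y b *m th y = th y *m om b y + dmx (bvec R b) th y by rewrite mulmxKV.
have <- : Y a = chm g i a y.
  apply: (LC_uniq atX rg _ (sU Uy)) => [b|b c]; last by rewrite /Y !row_mul torsion.
  have -> : dmx (bvec R b) (gmat g i) y = dmx (bvec R b) (fun z => th z *m D z *m (th z)^T) y.
    by apply: (eq_dmx oU _ Uy) => z; rewrite inE; exact: gE.
  rewrite (dmx_mulmx _ Uy); [|exact: mC_mulmx|exact: mC_tr].
  rewrite (dmx_mulmx _ Uy thC1 DC) dmx_tr Dcompat// gE//.
  have -> : th y *m D y *m (th y)^T *m (Y b)^T =
      th y *m D y *m (th y *m om b y + dmx (bvec R b) th y)^T.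
    by rewrite -YE (trmx_mul (Y b) (th y)) !mulmxA.
  have trE : (th y *m om b y + dmx (bvec R b) th y)^T =
      (om b y)^T *m (th y)^T + (dmx (bvec R b) th y)^T by rewrite raddfD/= trmx_mul.
  rewrite !mulmxA YE trE !(mulmxDl, mulmxDr) !mulmxA.
  by rewrite [X in _ = X + _]addrC !addrA.
exact: YE.
Qed.

(** Differentiating [frame_christoffel] once more produces second derivatives of [th], which are
    symmetric and cancel. *)
Lemma frame_curvature a b y : U y ->
  curvm g i a b y *m th y = th y *m (dmx (bvec R a) (om b) y - dmx (bvec R b) (om a) y
    + (om b y *m om a y - om a y *m om b y)).
Proof.
move=> Uy.
have chC c : mC 1 U (chm g i c) by move=> e f; apply: C_on_sub sU _; exact: chm_C.
have key c e : dmx (bvec R c) (chm g i e) y *m th y + chm g i e y *m dmx (bvec R c) th y =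
   dmx (bvec R c) th y *m om e y + th y *m dmx (bvec R c) (om e) y
     + dmx (bvec R c) (dmx (bvec R e) th) y.
  rewrite -(dmx_mulmx (bvec R c) Uy (chC e) thC1).
  rewrite -(dmx_mulmx (bvec R c) Uy thC1 (omC e)).
  have omth : mC 1 U (fun z => th z *m om e z) := mC_mulmx oU thC1 (omC e).
  have dth : mC 1 U (dmx (bvec R e) th) := mC_dmx (bvec R e) thC.
  rewrite -(dmx_add (bvec R c) Uy omth dth).
  by apply: (eq_dmx oU _ Uy) => z; rewrite inE; exact: frame_christoffel.
have schwarz : dmx (bvec R a) (dmx (bvec R b) th) y = dmx (bvec R b) (dmx (bvec R a) th) y.
  apply/matrixP => c e.
  rewrite [LHS](dmxE (bvec R a) (dmx (bvec R b) th)).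
  rewrite [RHS](dmxE (bvec R b) (dmx (bvec R a) th)).
  have E f : (fun z => dmx (bvec R f) th z c e) = 'D_(bvec R f) (fun z => th z c e).
    by apply/funext => z; rewrite dmxE.
  have H := derive_schwarz (bvec R a) (bvec R b) oU Uy (thC c e).
  exact: (etrans (congr1 (fun h => 'D_(bvec R a) h y) (E b))
    (etrans H (congr1 (fun h => 'D_(bvec R b) h y) (esym (E a))))).
have k1 := key a b; have k2 := key b a; rewrite schwarz in k1.
rewrite curvmE; exact: frame_algebra (frame_christoffel a Uy) (frame_christoffel b Uy) k1 k2.
Qed.

End Frame.

(** * Christoffel symbols under a change of charts *)

Section ChristoffelChange.
Variables (R : realType) (n : nat) (X : charted R n) (g : bilin X).
Hypotheses (atX : atlas X) (rg : riemannian g).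
Variables (i j : idx X).

Let U := img i (dom j).
Let oU : open U. Proof. exact: at_open. Qed.
Let tau := loc i (chart j).
Let J (y : 'rV[R]_n) : 'M[R]_n := \matrix_(a, k) 'D_(bvec R a) (fun z => tau z 0 k) y.

Let sU : U `<=` cdom i.
Proof. by move=> y [p [dp _] <-]; exact: cdom_chart. Qed.

Let tauU y : U y -> cdom j (tau y).
Proof. by case=> p [dp dj] <-; rewrite /tau (loc_chart atX _ dp); exact: cdom_chart. Qed.

Let tauC k : mC k U tau. Proof. exact: at_C. Qed.

Let JC k : mC k U J.
Proof.
move=> a b; apply: (eq_C_on (f := 'D_(bvec R a) (fun z => tau z 0 b))) => //.
  by move=> y _; rewrite mxE.
by apply: C_on_derive; exact: tauC.
Qed.

Let derive_tau u y : U y -> 'D_u tau y = u *m J y.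
Proof.
move=> Uy; apply/rowP => k; rewrite [LHS](derive_trans_sum atX k u Uy) mxE.
by apply: eq_bigr => l _; rewrite mxE.
Qed.

Let comp_C k (f : 'rV[R]_n -> R) : C_on k (cdom j) f -> C_on k U (f \o tau).
Proof.
have oW : open (cdom j) by exact: (open_cdom atX).
move=> cf; exact: (C_on_comp oU oW tauU (tauC k) cf).
Qed.

(** An instance of the moving frame: seen from chart [i], the coordinate frame of chart [j] has for
    [th] the Jacobian [J], and for [D] and [om] the metric and the Christoffel matrices of [j]
    composed with [tau]. The inhomogeneous term is the derivative of [J]. *)
Lemma christoffel_change u w p : dom i p -> dom j p ->
  w *m chv g i u (chart i p) *m J (chart i p) =
  (w *m J (chart i p)) *m chv g j (u *m J (chart i p)) (chart j p) +
  \row_k \sum_l w 0 l * 'D_u ('D_(bvec R l) (fun y => tau y 0 k)) (chart i p).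
Proof.
move=> di dj; set y := chart i p.
have Uy : U y by exact/img_chart.
have ty : tau y = chart j p by rewrite /tau (loc_chart atX _ di).
pose D z := gmat g j (tau z).
pose om a z := chv g j (row a (J z)) (tau z).
have DC : mC 1 U D 
  by move=> a b; exact: (comp_C (gmat_C atX rg j 1 a b)).
have dtau v z : U z -> derivable tau z v.
  by move=> Uz; apply/derivable_mxP => a b; exact: (C_on_derivable (tauC 1 a b) Uz).
have gE z : U z -> gmat g i z = J z *m D z *m (J z)^T.
  case=> q [qi qj] <-; have Uz : U (chart i q) by exists q.
  apply/matrixP => a b; rewrite -[LHS]bil_delta -[RHS]bil_delta -bil_mul.
  have tv c := tangent_mkvec atX (bvec R c) qi.
  have E c : bvec R c = mkvec i q (bvec R c) i := esym (mkvec_self atX _ qi).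
  apply: (etrans (congr2 (bil _) (E a) (E b))).
  apply: (etrans (esym (gmat_bil atX rg qi (tv a) (tv b)))).
  rewrite (gmat_bil atX rg qj (tv a) (tv b)) (mkvec_in _ (bvec R a) qj) (mkvec_in _ (bvec R b) qj).
  rewrite (derive_tau (bvec R a) Uz) (derive_tau (bvec R b) Uz).
  by rewrite /D /tau (loc_chart atX _ qi).
have Dcompat a z : U z -> dmx (bvec R a) D z = om a z *m D z + D z *m (om a z)^T.
  move=> Uz; rewrite /om -(chv_compat atX rg _ (tauU Uz)).
  apply/matrixP => b c; rewrite [LHS]dmxE.
  have df : differentiable (fun y => gmat g j y b c) (tau z).
    by apply: (differentiable_C1 (open_cdom atX (i:=j)) (tauU Uz)); exact: (gmat_C atX rg j 1 b c).
  have [_] := derive_chain (dtau (bvec R a) z Uz) df.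
  move=> ->; rewrite (derive_tau _ Uz) -rowE.
  exact: (esym (dmxE (row a (J z)) (gmat g j) (tau z) b c)).
have tors a b z : U z -> row b (J z *m om a z + dmx (bvec R a) J z) =
    row a (J z *m om b z + dmx (bvec R b) J z).
  move=> Uz.
  have rD c (A B : 'M[R]_n) : row c (A + B) = row c A + row c B.
    by apply/rowP => k; rewrite !mxE.
  have E3 : row b (dmx (bvec R a) J z) = row a (dmx (bvec R b) J z).
    apply/rowP => k; rewrite [LHS]mxE [RHS]mxE [LHS]dmxE [RHS]dmxE.
    have E c : (fun z => J z c k) = 'D_(bvec R c) (fun z => tau z 0 k).
      by apply/funext => x; rewrite mxE.
    have H := derive_schwarz (bvec R a) (bvec R b) oU Uz (tauC 2 0 k).
    exact: (etrans (congr1 (fun h => 'D_(bvec R a) h z) (E b))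
      (etrans H (congr1 (fun h => 'D_(bvec R b) h z) (esym (E a))))).
  rewrite !rD (row_mul b) (row_mul a) /om (chv_sym atX rg _ _ (tauU Uz)).
  exact: (congr1 (fun w => _ + w) E3).
have fr a := frame_christoffel atX rg oU sU (JC 2) DC gE Dcompat tors a Uy.
rewrite /chv mulmx_sumr mulmx_suml.
under eq_bigr do rewrite -scalemxAr -scalemxAl -mulmxA fr mulmxDr scalerDr.
rewrite big_split/=; congr (_ + _).
  rewrite -/(chv g j (u *m J y) (chart j p)).
  rewrite (chv_sym atX rg) ?ty//; last by rewrite -ty; exact: tauU.
  rewrite [u in RHS]row_sum_delta !mulmx_suml; apply: eq_bigr => a _.
  have Uj : cdom j (chart j p) by exact: cdom_chart.
  rewrite -!scalemxAl mulmxA; apply: (congr1 (fun z => u 0 a *: z)).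
  by rewrite /om ty (chv_sym atX rg _ _ Uj) rowE.
apply/rowP => k; rewrite summxE [RHS]mxE.
transitivity (\sum_a \sum_l u 0 a * (w 0 l * dmx (bvec R a) J y l k)).
  apply: eq_bigr => a _; rewrite mxE -big_distrr/=.
  by apply: (congr1 (fun z => u 0 a * z)); rewrite mxE.
rewrite exchange_big/=; apply: eq_bigr => l _.
have df : differentiable ('D_(bvec R l) (fun y => tau y 0 k)) y.
  by apply: (differentiable_C1 oU Uy); apply: C_on_derive; exact: tauC.
rewrite (derive_sumdir _ df) big_distrr/=; apply: eq_bigr => a _.
rewrite mulrCA dmxE.
have E : (fun z => J z l k) = 'D_(bvec R l) (fun z => tau z 0 k).
  by apply/funext => x; rewrite mxE.
by rewrite E.
Qed.

Lemma christoffel_trans u w p : dom i p -> dom j p ->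
  'D_(w *m chv g i u (chart i p)) tau (chart i p) =
  'D_w tau (chart i p) *m chv g j ('D_u tau (chart i p)) (chart j p) +
  \row_k \sum_l w 0 l * 'D_u ('D_(bvec R l) (fun y => tau y 0 k)) (chart i p).
Proof.
move=> di dj; have Uy : U (chart i p) by exact/img_chart.
rewrite (derive_tau (w *m _) Uy) (derive_tau w Uy) (derive_tau u Uy).
exact: christoffel_change.
Qed.

End ChristoffelChange.

(** * The matrix of a natural metric *)

(** Induction on the dimension by a Schur complement: [L] clears the first row and column of [S]
    outside the corner [a]. The remaining block [S2] is positive because it is [S] evaluated on the
    vectors [row_mx 0 w *m L]. *)
Lemma orthonormalize (R : realType) (n : nat) (S : 'M[R]_n) : S^T = S ->
  (forall w, w != 0 -> 0 < bil S w w) -> exists P : 'M[R]_n, P *m S *m P^T = 1%:M.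
Proof.
elim: n S => [|n IH] S sS pS; first by exists 0; apply/matrixP => -[].
move: S sS pS; rewrite -[n.+1]/(1 + n)%N => S sS pS.
pose a := ulsubmx S 0 0; pose b : 'rV_n := ursubmx S; pose S' := drsubmx S.
have ul : ulsubmx S = a%:M by rewrite [LHS]mx11_scalar.
have SE : S = block_mx a%:M b b^T S'.
  by rewrite -[LHS]submxK ul -/b -/S' /b trmx_ursub sS.
have sS' : S'^T = S' by rewrite /S' trmx_drsub sS.
have a0 : 0 < a.
  have := pS (delta_mx 0 (lshift n 0)); rewrite bil_delta => H.
  rewrite /a !mxE; apply: H; apply/eqP => /rowP/(_ (lshift n 0)).
  by rewrite !mxE !eqxx => /eqP; rewrite oner_eq0.
pose L : 'M[R]_(1 + n) := block_mx 1%:M 0 (- a^-1 *: b^T) 1%:M.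
pose S2 := S' - a^-1 *: (b^T *m b).
have LS : L *m S *m L^T = block_mx a%:M 0 0 S2.
  have L1 : L *m S = block_mx a%:M b 0 S2.
    rewrite SE /L mulmx_block !mul1mx !mul0mx !addr0; congr block_mx.
      by rewrite mul_mx_scalar scalerA mulrN mulfV ?gt_eqF// scaleN1r addNr.
    by rewrite -scalemxAl scaleNr addrC.
  rewrite L1 /L tr_block_mx mulmx_block !trmx1 !trmx0 !mul0mx !mulmx0 !mulmx1 !addr0 add0r.
  congr block_mx.
  by rewrite linearZ/= trmxK mul_scalar_mx scalerA mulrN mulfV ?gt_eqF// scaleN1r addNr.
have [||P PS] := IH S2.
- by rewrite /S2 raddfB/= linearZ/= trmx_mul trmxK sS'.
- move=> w w0.
  have -> : bil S2 w w = bil S (row_mx 0 w *m L) (row_mx 0 w *m L).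
    rewrite bil_mul LS /bil mul_row_block !mul0mx !mulmx0 !add0r tr_row_mx mul_row_col.
    by rewrite mul0mx add0r.
  apply: pS; apply: contraNneq w0 => H.
  have := congr1 rsubmx H; rewrite /L mul_row_block row_mxKr mulmx1 mul0mx add0r.
  by rewrite linear0 => ->.
pose Q : 'M[R]_(1 + n) := block_mx (Num.sqrt a)^-1%:M 0 0 P.
exists (Q *m L); rewrite trmx_mul !mulmxA -[Q *m L *m S]mulmxA -(mulmxA Q) LS.
rewrite /Q tr_block_mx !mulmx_block !trmx0 !mul0mx !mulmx0 !addr0 !add0r PS tr_scalar_mx.
rewrite -!scalar_mxM -[1%:M in RHS]submxK.
rewrite !(mul0mx, mulmx0, addr0).
have -> : (Num.sqrt a)^-1 * a * (Num.sqrt a)^-1 = 1.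
  rewrite -[X in _ * X * _](sqr_sqrtr (ltW a0)) expr2 mulrA mulVf ?mul1r ?mulfV//;
  by rewrite gt_eqF// sqrtr_gt0.
by rewrite scalar_mx_block submxK.
Qed.

Lemma derivable_row_mx (R : realType) (n1 n2 : nat) (A : R -> 'rV[R]_n1)
    (B : R -> 'rV[R]_n2) (t : R) : derivable (fun s => row_mx (A s) (B s)) t 1 ->
  [/\ derivable A t 1, derivable B t 1,
   'D_1 A t = lsubmx ('D_1 (fun s => row_mx (A s) (B s)) t) &
   'D_1 B t = rsubmx ('D_1 (fun s => row_mx (A s) (B s)) t)].
Proof.
move=> d; have /derivable_mxP e := d.
have eA k : (fun s => row_mx (A s) (B s) 0 (lshift n2 k)) = (fun s => A s 0 k).
  by apply/funext => s; rewrite row_mxEl.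
have eB k : (fun s => row_mx (A s) (B s) 0 (rshift n1 k)) = (fun s => B s 0 k).
  by apply/funext => s; rewrite row_mxEr.
have dA : derivable A t 1.
  by apply/derivable_mxP => i k; rewrite ord1; have := e 0 (lshift n2 k); rewrite eA.
have dB : derivable B t 1.
  by apply/derivable_mxP => i k; rewrite ord1; have := e 0 (rshift n1 k); rewrite eB.
split => //; apply/rowP => k; rewrite !mxE.
  by rewrite (derive_mx dA) (derive_mx d) !mxE eA.
by rewrite (derive_mx dB) (derive_mx d) !mxE eB.
Qed.

(** * Projection, connection map and adapted bases in charts *)

Section TangentBundleMaps.
Variables (R : realType) (n : nat) (M : charted R n) (g : bilin M).
Hypotheses (atM : atlas M) (coverM : forall p : pt M, exists i, dom i p).
Hypothesis rg : riemannian g.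
Implicit Types (i j : idx M) (x : tpoint M).

Let atTM : atlas (TM M). Proof. exact: TM_atlas. Qed.

Lemma curve_TM (c : R -> tpoint M) j : curve (X := TM M) c -> dom j (foot (c 0)) ->
  [/\ derivable (fun t => chart j (foot (c t))) 0 1,
      'D_1 (fun t => chart j (foot (c t))) 0 = lsubmx (velocity (X := TM M) c 0 j) &
      'D_1 (fun t => tvec (c t) j) 0 = rsubmx (velocity (X := TM M) c 0 j)].
Proof.
move=> cc dj; have [_ d] := curve_chart atTM cc dj.
rewrite (velocityE (X := TM M) dj).
by have [d1 d2 e1 e2] := derivable_row_mx d; split.
Qed.

(** All curves with velocity [v] give the same value and [line_curve] provides one, so the choice
    made in [differential] is determined. *)
Lemma differentialE x v : tangent (X := TM M) x v ->
  differential (X := TM M) (Y := M) (@bundle_proj R n M) x v = (fun j => lsubmx (v j)).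
Proof.
move=> tv.
have vE (c : R -> tpoint M) : curve (X := TM M) c -> c 0 = x -> velocity (X := TM M) c 0 = v ->
    velocity (X := M) (fun s => bundle_proj (c s)) 0 = (fun j => lsubmx (v j)).
  move=> cc c0 cv; apply/funext => j; rewrite /velocity /bundle_proj.
  case: asboolP => [dj|ndj].
    by have [_ e _] := curve_TM cc dj; rewrite derive1E e cv.
  by rewrite tv.1 ?linear0// => dj; apply: ndj; rewrite c0.
have [i di] := coverM (foot x).
have [c [cc c0 cv]] := line_curve atTM (v i) (di : dom (c := TM M) i x).
rewrite -(tangent_mkvecE atTM (di : dom (c := TM M) i x) tv) in cv.
apply: xget_subset1.
  by exists c; split => //; rewrite vE.
by move=> _ _ [c1 [? ? ? ->]] [c2 [? ? ? ->]]; rewrite !vE.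
Qed.

Definition conn x (v : idx M -> 'rV[R]_(n + n)) : idx M -> 'rV[R]_n := fun j =>
  if `[< dom j (foot x) >] then
    rsubmx (v j) + tvec x j *m chv g j (lsubmx (v j)) (chart j (foot x))
  else 0.

Lemma christoffel_row i (u w : 'rV[R]_n) y :
  \row_k \sum_a \sum_b christoffel g i k a b y * u 0 a * w 0 b = w *m chv g i u y.
Proof.
apply/rowP => k; rewrite !mxE exchange_big/=; apply: eq_bigr => b _.
rewrite summxE big_distrr/=; apply: eq_bigr => a _.
by rewrite !mxE [RHS]mulrC [u 0 a * _]mulrC.
Qed.

Lemma connection_mapE x v : tangent (X := TM M) x v ->
  connection_map g x v = conn x v.
Proof.
move=> tv.
have vE (c : R -> tpoint M) : curve (X := TM M) c -> c 0 = x -> velocity (X := TM M) c 0 = v ->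
    covder g c 0 = conn x v.
  move=> cc c0 cv; apply/funext => j; rewrite /covder /conn c0.
  case: asboolP => [dj|//].
  have dj0 : dom j (foot (c 0)) by rewrite c0.
  have [_ e1 e2] := curve_TM cc dj0.
  by rewrite !derive1E e1 e2 cv christoffel_row.
have [i di] := coverM (foot x).
have [c [cc c0 cv]] := line_curve atTM (v i) (di : dom (c := TM M) i x).
rewrite -(tangent_mkvecE atTM (di : dom (c := TM M) i x) tv) in cv.
apply: xget_subset1.
  by exists c; split => //; rewrite vE.
by move=> _ _ [c1 [? ? ? ->]] [c2 [? ? ? ->]]; rewrite !vE.
Qed.

(** Horizontal lift of [u] at [x]: the fibre component is the one for which [conn] vanishes. In the
    charts that do not contain the foot it is [0], as [tangent] requires. *)
Definition hvec x (u : idx M -> 'rV[R]_n) : idx M -> 'rV[R]_(n + n) := fun j =>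
  row_mx (u j) (if `[< dom j (foot x) >] then
    - (tvec x j *m chv g j (u j) (chart j (foot x))) else 0).

Definition vvec (u : idx M -> 'rV[R]_n) : idx M -> 'rV[R]_(n + n) :=
  fun j => row_mx 0 (u j).

Lemma tangent_TM x v : (forall i, ~ dom i (foot x) -> v i = 0) ->
    (forall i j, dom i (foot x) -> dom j (foot x) ->
      v j = 'D_(v i) (loc (X := TM M) i (chart (c := TM M) j)) (chart (c := TM M) i x)) ->
  tangent (X := TM M) x v.
Proof. by split. Qed.

(** The Hessian term in the transition maps of [TM] cancels the inhomogeneous term in the
    transformation law of the Christoffel symbols. *)
Lemma tangent_hvec x u : tangent (foot x) u -> tangent (X := TM M) x (hvec x u).
Proof.
move=> [u0 tu]; apply: tangent_TM => [i nd|i j di' dj'].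
  by rewrite /hvec (u0 _ nd) asboolF// row_mx0.
rewrite (derive_trans_TM atM _ di' dj') /hvec !asboolT// row_mxKl row_mxKr -(tu _ _ di' dj').
congr row_mx.
rewrite -[X in derive _ _ X]scaleN1r -[_ *: _]addr0 (trans_linear atM _ _ _ di' dj').
rewrite derive0 addr0 scaleN1r (christoffel_trans atM rg (u i) (tvec x i) di' dj').
have [_ tx] := tvecP x; rewrite -(tx _ _ di' dj') -(tu _ _ di' dj').
by rewrite opprD subrK.
Qed.

Lemma tangent_vvec x u : tangent (foot x) u -> tangent (X := TM M) x (vvec u).
Proof.
move=> [u0 tu]; apply: tangent_TM => [i nd|i j di' dj'].
  by rewrite /vvec (u0 _ nd) row_mx0.
rewrite (derive_trans_TM atM _ di' dj') /vvec row_mxKl row_mxKr derive0 -(tu _ _ di' dj').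
congr row_mx; rewrite -[LHS]addr0; congr (_ + _).
apply/rowP => k; rewrite !mxE big1// => l _.
by rewrite derive0 mulr0.
Qed.

Section AdaptedBasis.
Variables (x : tpoint M) (i : idx M).
Hypothesis di : dom i (foot x).
Let S := gmat g i (chart i (foot x)).
Variable P : 'M[R]_n.
Hypothesis PS : P *m S *m P^T = 1%:M.

Let u k : idx M -> 'rV[R]_n := mkvec i (foot x) (row k P).
Let tu k : tangent (foot x) (u k). Proof. exact: tangent_mkvec. Qed.

Definition adapted_frame (a : 'I_(n + n)) : idx (TM M) -> 'rV[R]_(n + n) :=
  match fintype.split a with inl k => hvec x (u k) | inr k => vvec (u k) end.

Lemma adapted_frame_l k : adapted_frame (lshift n k) = hvec x (u k).
Proof. by rewrite /adapted_frame (unsplitK (inl k)). Qed.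

Lemma adapted_frame_r k : adapted_frame (rshift n k) = vvec (u k).
Proof. by rewrite /adapted_frame (unsplitK (inr k)). Qed.

(** [characterized_by] constrains [G] on adapted bases only; here one is produced over each point,
    from the horizontal and vertical lifts of an orthonormal basis. *)
Lemma adapted_frameP :
  adapted_basis g x u (tvec x i *m invmx P) adapted_frame.
Proof.
have uP : P \in unitmx.
  by have : P *m (S *m P^T) = 1%:M; [rewrite mulmxA|move/mulmx1_unit => []].
have th k := tangent_hvec (tu k); have tv k := tangent_vvec (tu k).
split.
- split => // k l; rewrite (gmat_bil atM rg di (tu k) (tu l)) /u !(mkvec_self atM _ di).
  by rewrite !rowE bil_mul PS bil_delta mxE.
- apply: (tangent_ext di (tvecP x) (tangent_sum atM _ _ tu)).
  rewrite fct_sumE -[LHS](mulmxKV uP) mulmx_sum_row; apply: eq_bigr => k _.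
  by rewrite -[RHS]/(_ *: u k i) /u (mkvec_self atM _ di).
- by move=> a; rewrite /adapted_frame; case: fintype.split => k.
- move=> k; rewrite adapted_frame_l differentialE//.
  by apply/funext => j; rewrite row_mxKl.
- move=> k; rewrite adapted_frame_l connection_mapE//; apply/funext => j.
  rewrite /conn /hvec; case: asboolP => // dj.
  by rewrite row_mxKl row_mxKr addNr.
- move=> k; rewrite adapted_frame_r differentialE//.
  by apply/funext => j; rewrite row_mxKl.
- move=> k; rewrite adapted_frame_r connection_mapE//; apply/funext => j.
  rewrite /conn /vvec row_mxKl row_mxKr; case: asboolP => [dj|ndj].
    by rewrite chv0 mulmx0 addr0.
  by have [-> ] := tu k.
Qed.

End AdaptedBasis.
End TangentBundleMaps.

Lemma row_mx_sum (R : pzRingType) (m n1 n2 : nat) (I : Type) (r : seq I)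
    (f : I -> 'M[R]_(m, n1)) (h : I -> 'M[R]_(m, n2)) :
  \sum_(k <- r) row_mx (f k) (h k) = row_mx (\sum_(k <- r) f k) (\sum_(k <- r) h k).
Proof.
elim: r => [|k r IH]; first by rewrite !big_nil row_mx0.
by rewrite !big_cons IH add_row_mx.
Qed.

Lemma chv_sum (R : realType) (n : nat) (X : charted R n) (g : bilin X) i y
    (I : Type) (r : seq I) (c : I -> R) (v : I -> 'rV[R]_n) :
  chv g i (\sum_(k <- r) c k *: v k) y = \sum_(k <- r) c k *: chv g i (v k) y.
Proof.
elim: r => [|k r IH].
  by rewrite !big_nil chv0.
by rewrite !big_cons chvD chvZ IH.
Qed.

(** * The chart formula for G *)

Section NaturalMetric.
Variables (R : realType) (n : nat) (M : charted R n) (g : bilin M) (G : bilin (TM M)).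
Variables (alpha beta : R -> R).
Hypotheses (atM : atlas M) (coverM : forall p : pt M, exists i, dom i p).
Hypotheses (rg : riemannian g) (rG : riemannian G).
Hypothesis chG : characterized_by g G alpha beta.
Implicit Types (i j : idx M) (x : tpoint M).

Let atTM : atlas (TM M). Proof. exact: TM_atlas. Qed.

(** Chart expression of [conn] at the point with coordinates [(q, y)]. *)
Definition vpart i (q y : 'rV[R]_n) (z : 'rV[R]_(n + n)) : 'rV[R]_n :=
  rsubmx z + y *m chv g i (lsubmx z) q.

Definition Gform i (q y : 'rV[R]_n) (z z' : 'rV[R]_(n + n)) : R :=
  let S := gmat g i q in
  bil S (lsubmx z) (lsubmx z') +
  (alpha (bil S y y) * bil S (vpart i q y z) (vpart i q y z') +
   beta (bil S y y) * bil S y (vpart i q y z) * bil S y (vpart i q y z')).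

(** Both vectors are expanded in an adapted basis; the coefficients are the components of their
    [lsubmx] and [vpart] in the orthonormal basis formed by the rows of [P]. *)
Lemma G_formula x i z z' : dom i (foot x) ->
  tangent (X := TM M) x z -> tangent (X := TM M) x z' ->
  G x z z' = Gform i (chart i (foot x)) (tvec x i) (z i) (z' i).
Proof.
move=> di tz tz'; set q := chart i (foot x); set y := tvec x i.
have Uq : cdom i q by exact: cdom_chart.
pose S := gmat g i q.
have [P PS] := orthonormalize (gmat_sym atM rg Uq) (fun w => gmat_pos atM rg Uq).
have uP : P \in unitmx.
  by have : P *m (S *m P^T) = 1%:M; [rewrite mulmxA|move/mulmx1_unit => []].
(* In the coordinates [w *m invmx P] the form [bil S] is the Euclidean product. *)
have SE : S = invmx P *m (invmx P)^T.
  have := congr1 (fun A => invmx P *m A *m (invmx P)^T) PS.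
  rewrite mulmx1 !mulmxA mulVmx// mul1mx -mulmxA -trmx_mul mulVmx// trmx1 mulmx1.
  exact.
have ab := adapted_frameP atM coverM rg di PS.
set e := adapted_frame g x i P in ab; set xi := tvec x i *m invmx P in ab.
have te a : tangent (X := TM M) x (e a) := ab_tangent ab a.
pose C (w : 'rV[R]_(n + n)) : 'rV[R]_(n + n) :=
  row_mx (lsubmx w *m invmx P) (vpart i q y w *m invmx P).
have zE w : tangent (X := TM M) x w -> w = \sum_s C (w i) 0 s *: e s.
  move=> tw.
  apply: (@tangent_ext R (n + n) (TM M) i x w _ di tw (tangent_sum atTM _ _ te)).
  rewrite fct_sumE big_split_ord/=.
  have El k : (C (w i) 0 (lshift n k) *: e (lshift n k)) i =
     row_mx ((lsubmx (w i) *m invmx P) 0 k *: row k P)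
       (- (y *m ((lsubmx (w i) *m invmx P) 0 k *: chv g i (row k P) q))).
    rewrite /C row_mxEl /e adapted_frame_l -[LHS]/(_ *: hvec g x _ i) /hvec asboolT//.
    by rewrite (mkvec_self atM _ di) scale_row_mx scalerN -scalemxAr.
  have Er k : (C (w i) 0 (rshift n k) *: e (rshift n k)) i =
     row_mx 0 ((vpart i q y (w i) *m invmx P) 0 k *: row k P).
    rewrite /C row_mxEr /e adapted_frame_r -[LHS]/(_ *: vvec _ i) /vvec.
    by rewrite (mkvec_self atM _ di) scale_row_mx scaler0.
  rewrite (eq_bigr _ (fun k _ => El k)) (eq_bigr _ (fun k _ => Er k)) !row_mx_sum.
  have s0 : \sum_(k < n) (0 : 'rV[R]_n) = 0 by rewrite big1.
  rewrite s0 add_row_mx addr0 -!mulmx_sum_row sumrN -mulmx_sumr -chv_sum.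
  by rewrite -mulmx_sum_row !mulmxKV// addrC /vpart addrK hsubmxK.
have bilP (a b : 'rV[R]_n) : bil S a b = \sum_k (a *m invmx P) 0 k * (b *m invmx P) 0 k.
  rewrite SE /bil (mulmxA a) -(mulmxA _ _ b^T) -trmx_mul mxE.
  by apply: eq_bigr => k _; rewrite [X in _ * X = _]mxE.
have rE : sqnorm xi = bil S y y.
  by rewrite bilP; apply: eq_bigr => k _; rewrite expr2.
pose c := C (z i); pose c' := C (z' i).
transitivity (\sum_a \sum_b c 0 a * c' 0 b * G x (e a) (e b)).
  rewrite {1}(zE z tz) (g_suml atTM rG _ _ te tz'); apply: eq_bigr => a _.
  rewrite {1}(zE z' tz') (g_sumr atTM rG _ _ te (te a)) big_distrr/=.
  by apply: eq_bigr => b _; rewrite mulrA.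
have gr k l : G x (e (rshift n k)) (e (lshift n l)) = 0.
  by rewrite (rm_sym rG (te _) (te _)) (cb_hv chG _ _ ab).
rewrite big_split_ord/=.
have lE k : \sum_b c 0 (lshift n k) * c' 0 b * G x (e (lshift n k)) (e b) =
    (lsubmx (z i) *m invmx P) 0 k * (lsubmx (z' i) *m invmx P) 0 k.
  rewrite big_split_ord/= [X in _ + X]big1 ?addr0 => [|l _]; last first.
    by rewrite (cb_hv chG _ _ ab) mulr0.
  rewrite (bigD1 k)//= big1 ?addr0 => [|l lk].
    by rewrite (cb_hh chG _ _ ab) eqxx mulr1 /c /c' /C !row_mxEl.
  by rewrite (cb_hh chG _ _ ab) eq_sym (negbTE lk) mulr0.
have rE' k : \sum_b c 0 (rshift n k) * c' 0 b * G x (e (rshift n k)) (e b) =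
    alpha (bil S y y) * ((vpart i q y (z i) *m invmx P) 0 k *
       (vpart i q y (z' i) *m invmx P) 0 k) +
    beta (bil S y y) * (xi 0 k * (vpart i q y (z i) *m invmx P) 0 k) *
      bil S y (vpart i q y (z' i)).
  rewrite big_split_ord/= big1 ?add0r => [|l _]; last by rewrite gr mulr0.
  transitivity (\sum_l (c 0 (rshift n k) * c' 0 (rshift n l) * (alpha (bil S y y) * (k == l)%:R)
      + beta (bil S y y) * (xi 0 k * c 0 (rshift n k)) * (xi 0 l * c' 0 (rshift n l)))).
    by apply: eq_bigr => l _; rewrite (cb_vv chG _ _ ab) rE; ring.
  rewrite big_split/= -big_distrr/=; congr (_ + _).
    rewrite (bigD1 k)//= big1 ?addr0 => [|l lk]; last first.
      by rewrite eq_sym (negbTE lk) !mulr0.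
    by rewrite eqxx mulr1 mulrC /c /c' /C !row_mxEr.
  congr (_ * _); first by rewrite /c /C row_mxEr.
  by rewrite bilP; apply: eq_bigr => l _; rewrite /c' /C row_mxEr.
rewrite (eq_bigr _ (fun k _ => lE k)) (eq_bigr _ (fun k _ => rE' k)) /Gform -/S.
rewrite [X in _ = X + _]bilP; congr (_ + _); rewrite big_split/= -big_distrr/= -big_distrl/= -big_distrr/=.
by rewrite -!bilP.
Qed.

Lemma bil_gmat i q y z z' : cdom i q ->
  bil (gmat G i (row_mx q y)) z z' = Gform i q y z z'.
Proof.
case=> p [dp _] <-; pose x := mkpt atM y dp.
have di : dom i (foot x) := dp.
have tz w := tangent_mkvec atTM w (di : dom (c := TM M) i x).
have := G_formula di (tz z) (tz z').
rewrite !(mkvec_self atTM _ (di : dom (c := TM M) i x)).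
have -> : tvec x i = y by rewrite /= (mkvec_self atM _ dp).
move=> <-; rewrite (gmat_bil atTM rG (di : dom (c := TM M) i x) (tz z) (tz z')).
rewrite !(mkvec_self atTM _ (di : dom (c := TM M) i x)).
by rewrite /= (mkvec_self atM _ dp).
Qed.

Lemma cdom_TM i q y : cdom (X := TM M) i (row_mx q y) <-> cdom i q.
Proof.
rewrite (cdomE (X := TM M)) (img_TM atM) cdomE.
by rewrite /domTM /= row_mxKl.
Qed.

End NaturalMetric.

Lemma derive_bil (R : realType) (V : normedModType R) (U : set V) (n : nat)
    (S : V -> 'M[R]_n) (u w : V -> 'rV[R]_n) x v : U x ->
    open U -> mC 1 U S -> mC 1 U u -> mC 1 U w ->
  is_derive x v (fun z => bil (S z) (u z) (w z))
    (bil (dmx v S x) (u x) (w x) + bil (S x) (dmx v u x) (w x)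
     + bil (S x) (u x) (dmx v w x)).
Proof.
move=> Ux oU cS cu cw.
have c1 : mC 1 U (fun z => u z *m S z) := mC_mulmx oU cu cS.
have ct : mC 1 U (fun z => (w z)^T) := mC_tr cw.
have c2 : mC 1 U (fun z => u z *m S z *m (w z)^T) := mC_mulmx oU c1 ct.
apply: DeriveDef; first exact: (C_on_derivable (c2 0 0) Ux).
rewrite /bil -[LHS](dmxE v (fun z => u z *m S z *m (w z)^T) x 0 0).
rewrite (dmx_mulmx v Ux c1 ct) (dmx_mulmx v Ux cu cS) dmx_tr mulmxDl !mxE.
by rewrite [X in X + _]addrC.
Qed.

Lemma bil_sep (R : realType) (n : nat) (S : 'M[R]_n) (u v : 'rV[R]_n) :
  (forall w, w != 0 -> 0 < bil S w w) -> (forall A, bil S u A = bil S v A) -> u = v.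
Proof.
move=> pS H; apply/eqP; rewrite -subr_eq0; apply/negPn/negP => /pS.
by rewrite -scaleN1r bilDl bilZl H mulN1r subrr ltxx.
Qed.

(** * The Koszul formula and curvature for constant fields *)

Section Koszul.
Variables (R : realType) (n : nat) (X : charted R n) (g : bilin X).
Hypotheses (atX : atlas X) (rg : riemannian g).
Variable i : idx X.
Implicit Types (y u v w : 'rV[R]_n).

Lemma bil_dgmat u w w' y : cdom i y ->
  'D_u (fun z => bil (gmat g i z) w w') y = bil (dmx u (gmat g i) y) w w'.
Proof.
move=> Uy; have oU : open (cdom i) by exact: (open_cdom atX).
have [_ ->] := derive_bil u Uy oU (gmat_C atX rg i 1) (@mC_cst R _ (cdom i) 1 _ _ w) (@mC_cst R _ (cdom i) 1 _ _ w').
by rewrite !dmx_cst bil0l bil0r !addr0.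
Qed.

(** The fields are extended with constant components, so the bracket terms of the general formula
    vanish. *)
Lemma koszul u w A y : cdom i y ->
  2 * bil (gmat g i y) (w *m chv g i u y) A =
  bil (dmx u (gmat g i) y) w A + bil (dmx w (gmat g i) y) u A
  - bil (dmx A (gmat g i) y) u w.
Proof.
move=> Uy; rewrite !(chv_compat atX rg _ Uy).
have bD B u1 u2 : bil (chv g i B y *m gmat g i y + gmat g i y *m (chv g i B y)^T) u1 u2 =
   bil (gmat g i y) (u1 *m chv g i B y) u2 + bil (gmat g i y) u1 (u2 *m chv g i B y).
  by rewrite /bil mulmxDr mulmxDl mxE trmx_mul !mulmxA.
rewrite !bD (chv_sym atX rg w u Uy) (chv_sym atX rg u A Uy) (chv_sym atX rg w A Uy).
rewrite (bilC w _ (gmat_sym atX rg Uy)); ring.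
Qed.

(** Identifies a covariant derivative from a guessed value, without inverting the metric matrix. *)
Lemma chv_eq u w v y : cdom i y ->
    (forall A, bil (dmx u (gmat g i) y) w A + bil (dmx w (gmat g i) y) u A
      - bil (dmx A (gmat g i) y) u w = 2 * bil (gmat g i y) v A) ->
  w *m chv g i u y = v.
Proof.
move=> Uy H; apply: (bil_sep (fun z => gmat_pos atX rg Uy)) => A.
by apply: (@mulfI _ 2); rewrite ?pnatr_eq0// -H koszul.
Qed.

Lemma dmx_suml (m l : nat) (I : finType) (c : I -> R) (F : I -> 'rV[R]_n -> 'M[R]_(m, l)) u y :
  cdom i y -> (forall s, mC 1 (cdom i) (F s)) ->
  dmx u (fun z => \sum_s c s *: F s z) y = \sum_s c s *: dmx u (F s) y.
Proof.
move=> Uy cF; have oU : open (cdom i) by exact: (open_cdom atX).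
have cc (d : R) : C_on 1 (cdom i) (fun _ : 'rV[R]_n => d) by exact: C_on_cst.
have cs s : mC 1 (cdom i) (fun z => c s *: F s z) := mC_scale oU (cc (c s)) (cF s).
elim: (index_enum I) => [|s r IH].
  rewrite big_nil -[RHS](dmx_cst u (0 : 'M[R]_(m, l)) y); congr (dmx u _ y).
  by apply/funext => z; rewrite big_nil.
rewrite big_cons -IH.
transitivity (dmx u (fun z => c s *: F s z + \sum_(s <- r) c s *: F s z) y).
  by congr (dmx u _ y); apply/funext => z; rewrite big_cons.
rewrite (dmx_add u Uy (cs s)); last by apply: mC_sum => // a _; exact: cs.
by rewrite (dmx_scale u Uy (cc (c s)) (cF s)) derive_cst scale0r add0r.
Qed.

Lemma curvm_sum u v y : cdom i y ->
  \sum_a \sum_b (u 0 a * v 0 b) *: curvm g i a b y =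
  dmx u (chv g i v) y - dmx v (chv g i u) y
  + (chv g i v y *m chv g i u y - chv g i u y *m chv g i v y).
Proof.
move=> Uy.
have cC a : mC 1 (cdom i) (chm g i a) := chm_C atX rg i a 1.
have cV w : mC 1 (cdom i) (chv g i w) := chv_C atX rg i w 1.
have E1 w w' : dmx w (chv g i w') y = \sum_a \sum_b (w 0 a * w' 0 b) *: dmx (bvec R a) (chm g i b) y.
  rewrite (dmx_sumdir atX w Uy (cV w')); apply: eq_bigr => a _.
  rewrite /chv (dmx_suml _ _ Uy cC) scaler_sumr.
  by apply: eq_bigr => b _; rewrite scalerA.
have E2 w w' : chv g i w' y *m chv g i w y = \sum_a \sum_b (w 0 a * w' 0 b) *: (chm g i b y *m chm g i a y).
  rewrite exchange_big/= {1}/chv mulmx_suml; apply: eq_bigr => b _.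
  rewrite /chv mulmx_sumr; apply: eq_bigr => a _.
  by rewrite -scalemxAl -scalemxAr scalerA mulrC.
rewrite !E1 !E2 [X in _ - X + _]exchange_big/= [X in _ + (_ - X)]exchange_big/=.
rewrite -!sumrB -big_split/=; apply: eq_bigr => a _.
rewrite -!sumrB -big_split/=; apply: eq_bigr => b _.
by rewrite curvmE scalerDr !scalerBr [v 0 b * u 0 a]mulrC.
Qed.

Lemma flat_chv : flat g -> forall u v y, cdom i y ->
  dmx u (chv g i v) y - dmx v (chv g i u) y
  + (chv g i v y *m chv g i u y - chv g i u y *m chv g i v y) = 0.
Proof.
move=> /(flatP g atX) fg u v y Uy; rewrite -(curvm_sum u v Uy) big1// => a _.
by rewrite big1// => b _; rewrite fg// scaler0.
Qed.

End Koszul.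

(** * Flatness of the base *)

Section DmxBlocks.
Variables (R : realType) (V : normedModType R).

Lemma dmx_row_mx (m n1 n2 : nat) (F : V -> 'M[R]_(m, n1)) (H : V -> 'M[R]_(m, n2)) v x :
  dmx v (fun z => row_mx (F z) (H z)) x = row_mx (dmx v F x) (dmx v H x).
Proof.
apply/matrixP => a b; rewrite dmxE; case: (split_ordP b) => c ->.
  rewrite row_mxEl dmxE; apply: (congr1 (fun f => derive f x v)).
  by apply/funext => z; rewrite row_mxEl.
rewrite row_mxEr dmxE; apply: (congr1 (fun f => derive f x v)).
by apply/funext => z; rewrite row_mxEr.
Qed.

Lemma dmx_col_mx (m1 m2 n : nat) (F : V -> 'M[R]_(m1, n)) (H : V -> 'M[R]_(m2, n)) v x :
  dmx v (fun z => col_mx (F z) (H z)) x = col_mx (dmx v F x) (dmx v H x).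
Proof.
apply/matrixP => a b; rewrite dmxE; case: (split_ordP a) => c ->.
  rewrite col_mxEu dmxE; apply: (congr1 (fun f => derive f x v)).
  by apply/funext => z; rewrite col_mxEu.
rewrite col_mxEd dmxE; apply: (congr1 (fun f => derive f x v)).
by apply/funext => z; rewrite col_mxEd.
Qed.

Lemma mulmx_dmx (U : set V) (m n p : nat) (A : 'M[R]_(m, n)) (F : V -> 'M[R]_(n, p)) v x :
  U x -> mC 1 U F -> A *m dmx v F x = dmx v (fun z => A *m F z) x.
Proof.
move=> Ux cF; rewrite (dmx_mulmx v Ux (@mC_cst R V U 1 _ _ A) cF).
by rewrite dmx_cst mul0mx add0r.
Qed.

Lemma dmx_comp_affine (V' : normedModType R) (m n : nat) (F : V -> 'M[R]_(m, n))
    (h : V' -> V) (x v : V') (w : V) :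
  (forall t : R, h (t *: v + x) = t *: w + h x) ->
  dmx w F (h x) = dmx v (fun z => F (h z)) x.
Proof.
move=> hE; apply/matrixP => a b; rewrite [LHS]dmxE [RHS]dmxE.
exact: (esym (derive_comp_affine (fun z => F z a b) hE).2).
Qed.

End DmxBlocks.

Lemma dmxDdir (R : realType) (m n l : nat) (U : set 'rV[R]_n)
    (F : 'rV[R]_n -> 'M[R]_(m, l)) u v x :
  open U -> U x -> mC 1 U F -> dmx (u + v) F x = dmx u F x + dmx v F x.
Proof.
move=> oU Ux cF; apply/matrixP => a b.
rewrite [RHS]mxE [LHS]dmxE [X in _ = X + _]dmxE [X in _ = _ + X]dmxE.
have df : differentiable (fun z => F z a b) x by exact: (differentiable_C1 oU Ux).
by have := deriveDdir u v 1 df; rewrite !scale1r.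
Qed.

Lemma eq_opp0 (R : realDomainType) (d : R) : d = - d -> d = 0.
Proof. by move=> ?; lra. Qed.

(** * The zero section as a totally geodesic submanifold *)

Section ZeroSection.
Variables (R : realType) (n : nat) (M : charted R n) (g : bilin M) (G : bilin (TM M)).
Variables (alpha beta : R -> R).
Hypotheses (atM : atlas M) (coverM : forall p : pt M, exists i, dom i p).
Hypotheses (rg : riemannian g) (rG : riemannian G).
Hypothesis chG : characterized_by g G alpha beta.
Variable i : idx M.
Implicit Types (q u v w : 'rV[R]_n).

Let atTM : atlas (TM M). Proof. exact: TM_atlas. Qed.
Let gE := bil_gmat atM coverM rg rG chG.
Let oM : open (cdom i). Proof. exact: (open_cdom atM). Qed.
Let oT : open (cdom (X := TM M) i). Proof. exact: (open_cdom atTM). Qed.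
Let zT q : cdom i q -> cdom (X := TM M) i (row_mx q 0).
Proof. by move/(cdom_TM atM i q 0). Qed.

Let zero_affine u q (t : R) :
  row_mx (t *: u + q) 0 = t *: row_mx u 0 + row_mx q 0 :> 'rV[R]_(n + n).
Proof. by rewrite scale_row_mx scaler0 add_row_mx addr0. Qed.

(** At [y = 0] the vertical part of [row_mx w 0] is zero, so along the zero section only the term
    [g(w, a)] of [G] remains to be differentiated. *)
Lemma zero_dgmat_hor u w A q : cdom i q ->
  bil (dmx (row_mx u 0) (gmat G i) (row_mx q 0)) (row_mx w 0) A =
  bil (dmx u (gmat g i) q) w (lsubmx A).
Proof.
move=> Uq; rewrite -(bil_dgmat atTM rG _ _ _ (zT Uq)) -(bil_dgmat atM rg _ _ _ Uq).
have [_ <-] := @derive_comp_affine R _ _ _ (fun z => bil (gmat G i z) (row_mx w 0) A)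
  (fun q' : 'rV[R]_n => row_mx q' 0) q u _ (zero_affine u q).
apply: (eq_derive_on _ oM Uq) => z; rewrite inE => Uz /=.
rewrite gE// /Gform /vpart row_mxKl row_mxKr mul0mx !addr0.
by rewrite !bil0l !mulr0 !addr0.
Qed.

(* the horizontal block of [G] is an even function of the fibre coordinate *)
Lemma zero_dgmat_ver b u w q : cdom i q ->
  bil (dmx (row_mx 0 b) (gmat G i) (row_mx q 0)) (row_mx u 0) (row_mx w 0) = 0.
Proof.
move=> Uq; have Uz := zT Uq; rewrite -(bil_dgmat atTM rG _ _ _ Uz).
set f := fun z => _; pose h (z : 'rV[R]_(n + n)) : 'rV[R]_(n + n) :=
  row_mx (lsubmx z) (- rsubmx z).
have h0 : h (row_mx q 0) = row_mx q 0 by rewrite /h row_mxKl row_mxKr oppr0.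
have aff (t : R) : h (t *: row_mx 0 b + row_mx q 0) = t *: row_mx 0 (- b) + h (row_mx q 0).
  by rewrite h0 !scale_row_mx !add_row_mx /h row_mxKl row_mxKr !addr0 scalerN.
have [_ e1] := derive_comp_affine f aff.
have e2 : 'D_(row_mx 0 b) (f \o h) (row_mx q 0) = 'D_(row_mx 0 b) f (row_mx q 0).
  apply: (eq_derive_on _ oT Uz) => z; rewrite inE => Wz.
  have Wq : cdom i (lsubmx z) by apply/(cdom_TM atM i _ (rsubmx z)); rewrite hsubmxK.
  rewrite /f /= -[in RHS](hsubmxK z) /h !gE// /Gform /vpart !row_mxKl !row_mxKr !add0r.
  have bN S x y : bil S (- x) y = - bil S x y :> R by rewrite -scaleN1r bilZl mulN1r.
  have bNr S x y : bil S x (- y) = - bil S x y :> R by rewrite -scaleN1r bilZr mulN1r.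
  by rewrite !mulNmx !bN !bNr !opprK.
have df : derivable f (row_mx q 0) (row_mx 0 b).
  have [] := derive_bil (row_mx 0 b) Uz oT (gmat_C atTM rG i 1)
    (@mC_cst R _ (cdom (X := TM M) i) 1 _ _ (row_mx u 0)) (@mC_cst R _ (cdom (X := TM M) i) 1 _ _ (row_mx w 0)).
  by [].
have bN : row_mx 0 (- b) = -1 *: row_mx 0 b :> 'rV[R]_(n + n).
  by rewrite scale_row_mx scaler0 scaleN1r.
rewrite e2 h0 bN (deriveZdir (-1) df).2 scaleN1r in e1.
exact: eq_opp0 e1.
Qed.

(** The zero section is totally geodesic and carries the connection of [g]. In the Koszul formula
    [A] is split into its base and fibre components; the fibre component contributes nothing,
    because the horizontal block is even in the fibre coordinate. *)
Lemma zero_chv u w q : cdom i q ->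
  row_mx w 0 *m chv G i (row_mx u 0) (row_mx q 0) = row_mx (w *m chv g i u q) 0.
Proof.
move=> Uq; have Uz := zT Uq; apply: (chv_eq atTM rG Uz) => A.
have -> : dmx A (gmat G i) (row_mx q 0) =
    dmx (row_mx (lsubmx A) 0) (gmat G i) (row_mx q 0) +
    dmx (row_mx 0 (rsubmx A)) (gmat G i) (row_mx q 0).
  rewrite -(dmxDdir _ _ oT Uz (gmat_C atTM rG i 1)).
  by rewrite add_row_mx addr0 add0r hsubmxK.
have E1 := zero_dgmat_hor u w A Uq; have E2 := zero_dgmat_hor w u A Uq.
have E3 := zero_dgmat_hor (lsubmx A) u (row_mx w 0) Uq.
have E4 := zero_dgmat_ver (rsubmx A) u w Uq.
apply: etrans; first exact: (congr1 (fun b => _ - b) (bil_mxD _ _ _ _)).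
apply: (etrans (congr2 (fun a b => a - b) (congr2 +%R E1 E2) (congr2 +%R E3 E4))).
rewrite addr0 row_mxKl -(koszul atM rg _ _ _ Uq).
rewrite gE// /Gform /vpart row_mxKl row_mxKr mul0mx !addr0 !bil0l.
by rewrite !mulr0 !addr0.
Qed.

(** [row_mx u 0] is tangent to the zero section, so [zero_chv] may be differentiated in this
    direction. *)
Lemma zero_dmx_chv u v w q : cdom i q ->
  row_mx w 0 *m dmx (row_mx u 0) (chv G i (row_mx v 0)) (row_mx q 0) =
  row_mx (w *m dmx u (chv g i v) q) 0.
Proof.
move=> Uq; have Uz := zT Uq.
rewrite (mulmx_dmx _ _ Uz (chv_C atTM rG i _ 1)) (mulmx_dmx _ _ Uq (chv_C atM rg i _ 1)).
rewrite (@dmx_comp_affine R _ _ _ _ _ (fun q' : 'rV[R]_n => row_mx q' 0) q u _ (zero_affine u q)).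
transitivity (dmx u (fun z => row_mx (w *m chv g i v z) (0 : 'rV[R]_n)) q).
  apply: (eq_dmx oM _ Uq) => z; rewrite inE => Uz'; exact: (zero_chv v w Uz').
by rewrite dmx_row_mx dmx_cst.
Qed.

(** Gauss equation with vanishing second fundamental form: on vectors tangent to the zero section
    the curvatures of [G] and [g] agree. *)
Lemma flat_zero_section : flat G -> forall u v q, cdom i q ->
  dmx u (chv g i v) q - dmx v (chv g i u) q
  + (chv g i v q *m chv g i u q - chv g i u q *m chv g i v q) = 0.
Proof.
move=> fG u v q Uq; have Uz := zT Uq.
apply/row_matrixP => a; rewrite rowE [RHS]rowE mulmx0; set w := delta_mx 0 a.
have := congr1 (fun A => row_mx w 0 *m A) (flat_chv atTM rG fG (row_mx u 0) (row_mx v 0) Uz).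
rewrite mulmx0 mulmxDr !mulmxBr (zero_dmx_chv u v w Uq) (zero_dmx_chv v u w Uq) !mulmxA.
rewrite (zero_chv u w Uq) (zero_chv v w Uq) (zero_chv u _ Uq) (zero_chv v _ Uq).
rewrite !opp_row_mx !add_row_mx => /(congr1 lsubmx).
by rewrite row_mxKl linear0 -!mulmxA -!mulmxBr -mulmxDr.
Qed.

End ZeroSection.

Lemma flat_base (R : realType) (n : nat) (M : charted R n) (g : bilin M) (G : bilin (TM M))
    (alpha beta : R -> R) : atlas M -> (forall p : pt M, exists i, dom i p) ->
    riemannian g -> riemannian G -> characterized_by g G alpha beta ->
  flat G -> flat g.
Proof.
move=> atM coverM rg rG chG fG; apply/(flatP g atM) => i q a b Uq.
rewrite curvmE.
have E c : chm g i c = chv g i (bvec R c) by apply/funext => z; rewrite chv_bvec.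
rewrite !E; exact: (flat_zero_section atM coverM rg rG chG fG).
Qed.

(** * The fibres *)

Section FibreCalculus.
Variables (R : realType) (n : nat) (M : charted R n) (g : bilin M).
Hypotheses (atM : atlas M) (rg : riemannian g).
Variable i : idx M.
Implicit Types (q y u w : 'rV[R]_n) (z Z : 'rV[R]_(n + n)).

Let atTM : atlas (TM M). Proof. exact: TM_atlas. Qed.
Let W := cdom (X := TM M) i.
Let oM : open (cdom i). Proof. exact: (open_cdom atM). Qed.

Lemma open_cdomTM : open W. Proof. exact: (open_cdom atTM). Qed.
Let oT := open_cdomTM.

Lemma cdom_lsubmx z : W z -> cdom i (lsubmx z).
Proof. by move=> Wz; apply/(cdom_TM atM i _ (rsubmx z)); rewrite hsubmxK. Qed.

(** The square of the norm of the fibre vector, which is the argument of [alpha] and [beta]. *)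
Definition fnorm z : R := bil (gmat g i (lsubmx z)) (rsubmx z) (rsubmx z).

Lemma mC_lsubmx k (m l : nat) (F : 'rV[R]_n -> 'M[R]_(m, l)) :
  mC k (cdom i) F -> mC k W (fun z => F (lsubmx z)).
Proof.
move=> cF a b; apply: (C_on_sub cdom_lsubmx).
by apply: (C_on_comp_lin _ (cF a b)) => z; exact: continuous_lsubmx.
Qed.

Lemma mC_rsubmx k : mC k W (fun z : 'rV[R]_(n + n) => rsubmx z).
Proof.
move=> a b; rewrite (_ : (fun z => _) = fun z : 'rV[R]_(n + n) => z a (rshift n b)).
  exact: C_on_coord.
by apply/funext => z; rewrite mxE.
Qed.

Lemma dmx_lsubmx (m l : nat) (F : 'rV[R]_n -> 'M[R]_(m, l)) z Z :
  dmx Z (fun z => F (lsubmx z)) z = dmx (lsubmx Z) F (lsubmx z).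
Proof.
by apply/esym/(@dmx_comp_affine R _ _ _ _ _ lsubmx) => t; rewrite linearP.
Qed.

Lemma dmx_rsubmx z Z : dmx Z (fun z : 'rV[R]_(n + n) => rsubmx z) z = rsubmx Z.
Proof.
apply/matrixP => a b; rewrite ord1 dmxE mxE.
transitivity ('D_Z (fun z : 'rV[R]_(n + n) => z 0 (rshift n b)) z).
  by apply: (congr1 (fun f => derive f z Z)); apply/funext => z'; rewrite mxE.
have := derive_id z Z; rewrite derive_mx; last exact: derivable_id.
by move/rowP => /(_ (rshift n b)); rewrite mxE.
Qed.

Let SC k : mC k W (fun z => gmat g i (lsubmx z)).
Proof. by apply: mC_lsubmx; exact: (gmat_C atM rg). Qed.

Lemma bil_chv B q u1 u2 :
  bil (chv g i B q *m gmat g i q + gmat g i q *m (chv g i B q)^T) u1 u2 =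
  bil (gmat g i q) (u1 *m chv g i B q) u2 + bil (gmat g i q) u1 (u2 *m chv g i B q).
Proof. by rewrite /bil mulmxDr mulmxDl mxE trmx_mul !mulmxA. Qed.

Lemma is_derive_gcst z Z u w : W z ->
  is_derive z Z (fun z => bil (gmat g i (lsubmx z)) u w)
   (bil (gmat g i (lsubmx z)) (u *m chv g i (lsubmx Z) (lsubmx z)) w +
    bil (gmat g i (lsubmx z)) u (w *m chv g i (lsubmx Z) (lsubmx z))).
Proof.
move=> Wz; have Uq := cdom_lsubmx Wz.
have cst x : mC 1 W (fun _ => x : 'rV[R]_n) := @mC_cst R _ W 1 _ _ x.
apply: is_derive_eq (derive_bil Z Wz oT (SC 1) (cst u) (cst w)) _.
rewrite !dmx_cst bil0l bil0r !addr0 dmx_lsubmx (chv_compat atM rg _ Uq).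
exact: bil_chv.
Qed.

(** The covariant derivative of the tautological section [y] along [Z] is [vpart] of [Z]; the
    formula is metric compatibility. *)
Lemma is_derive_gfib z Z w : W z ->
  is_derive z Z (fun z => bil (gmat g i (lsubmx z)) (rsubmx z) w)
   (bil (gmat g i (lsubmx z)) (vpart g i (lsubmx z) (rsubmx z) Z) w +
    bil (gmat g i (lsubmx z)) (rsubmx z) (w *m chv g i (lsubmx Z) (lsubmx z))).
Proof.
move=> Wz; have Uq := cdom_lsubmx Wz.
have cst x : mC 1 W (fun _ => x : 'rV[R]_n) := @mC_cst R _ W 1 _ _ x.
apply: is_derive_eq (derive_bil Z Wz oT (SC 1) (mC_rsubmx 1) (cst w)) _.
rewrite !dmx_cst bil0r addr0 dmx_lsubmx (chv_compat atM rg _ Uq) dmx_rsubmx.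
rewrite bil_chv /vpart bilDl; ring.
Qed.

(** Parallel transport preserves norms, so only the vertical part of [Z] changes the squared
    norm. *)
Lemma is_derive_fnorm z Z : W z ->
  is_derive z Z fnorm
   (2 * bil (gmat g i (lsubmx z)) (rsubmx z) (vpart g i (lsubmx z) (rsubmx z) Z)).
Proof.
move=> Wz; have Uq := cdom_lsubmx Wz.
apply: is_derive_eq (derive_bil Z Wz oT (SC 1) (mC_rsubmx 1) (mC_rsubmx 1)) _.
rewrite dmx_lsubmx (chv_compat atM rg _ Uq) dmx_rsubmx bil_chv /vpart.
have sg := gmat_sym atM rg Uq.
rewrite bilDr (bilC (rsubmx Z) _ sg) (bilC (_ *m _) _ sg); ring.
Qed.

Lemma fnorm_C k : C_on k W fnorm.
Proof.
have c1 := mC_mulmx oT (mC_rsubmx k) (SC k).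
have c2 := mC_mulmx oT c1 (mC_tr (mC_rsubmx k)).
exact: (c2 0 0).
Qed.

Lemma bil_ge0 q y : cdom i q -> 0 <= bil (gmat g i q) y y.
Proof.
move=> Uq; have [->|y0] := eqVneq y 0; first by rewrite bil0l.
exact/ltW/(gmat_pos atM rg).
Qed.

Lemma fnorm_ge0 z : W z -> 0 <= fnorm z.
Proof. by move=> /cdom_lsubmx; exact: bil_ge0. Qed.

Lemma is_derive_half (a : R -> R) z Z : halfsmooth a -> W z ->
  is_derive z Z (fun z => a (fnorm z))
   (halfder a (fnorm z) * (2 * bil (gmat g i (lsubmx z)) (rsubmx z)
       (vpart g i (lsubmx z) (rsubmx z) Z))).
Proof.
move=> sa Wz; have [d e] := is_derive_fnorm Z Wz.
have [d1 e1] := halfder_chain oT Wz fnorm_ge0 (sa 0%N _ (fnorm_ge0 Wz)) d.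
by apply: DeriveDef; [exact: d1|rewrite -e; exact: e1].
Qed.

Lemma half_C k (a : R -> R) : halfsmooth a -> C_on k W (fun z => a (fnorm z)).
Proof. by move=> sa; exact: (C_on_halfsmooth oT sa fnorm_ge0 (fnorm_C k)). Qed.

End FibreCalculus.

(** * Connection and curvature of a fibre *)

Section Fibre.
Variables (R : realType) (n : nat) (M : charted R n) (g : bilin M) (G : bilin (TM M)).
Variables (alpha beta : R -> R).
Hypotheses (atM : atlas M) (coverM : forall p : pt M, exists i, dom i p).
Hypotheses (rg : riemannian g) (rG : riemannian G).
Hypothesis chG : characterized_by g G alpha beta.
Variable i : idx M.
Implicit Types (q y u v w : 'rV[R]_n) (z A Z : 'rV[R]_(n + n)).

Let atTM : atlas (TM M). Proof. exact: TM_atlas. Qed.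
Let W := cdom (X := TM M) i.
Let oT : open W. Proof. exact: (open_cdom atTM). Qed.
Let sa : halfsmooth alpha := cb_alpha_smooth chG.
Let sb : halfsmooth beta := cb_beta_smooth chG.

Lemma bil_gmatTM z A A' : W z ->
  bil (gmat G i z) A A' = Gform g alpha beta i (lsubmx z) (rsubmx z) A A'.
Proof.
move=> Wz; have := bil_gmat atM coverM rg rG chG (rsubmx z) A A' (cdom_lsubmx atM Wz).
by rewrite hsubmxK.
Qed.

Let S z := gmat g i (lsubmx z).

(** Supplies the first two terms of the Koszul formula for two vertical directions. Along a vertical
    direction the base point is frozen, so only the squared norm, [y] and the vertical part of [A]
    vary. *)
Lemma dgmat_ver w w' A z : W z ->
  let y := rsubmx z in let B := vpart g i (lsubmx z) y A in
  let C := chv g i (lsubmx A) (lsubmx z) in let t := fnorm g i z in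
  bil (dmx (row_mx 0 w) (gmat G i) z) (row_mx 0 w') A =
  halfder alpha t * (2 * bil (S z) y w) * bil (S z) w' B + alpha t * bil (S z) w' (w *m C)
  + halfder beta t * (2 * bil (S z) y w) * bil (S z) y w' * bil (S z) y B
  + beta t * (bil (S z) w w' * bil (S z) y B + bil (S z) y w' * (bil (S z) w B + bil (S z) y (w *m C))).
Proof.
move=> Wz y B C t; have Uq := cdom_lsubmx atM Wz.
pose Z : 'rV[R]_(n + n) := row_mx 0 w.
have lZ : lsubmx Z = 0 by rewrite row_mxKl.
have rZ : rsubmx Z = w by rewrite row_mxKr.
have vZ : vpart g i (lsubmx z) y Z = w by rewrite /vpart lZ rZ chv0 mulmx0 addr0.
have Ia := is_derive_half atM rg Z sa Wz; have Ib := is_derive_half atM rg Z sb Wz.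
have Iw := is_derive_gfib atM rg Z w' Wz.
rewrite -/y vZ in Ia Ib Iw; rewrite lZ chv0 mulmx0 bil0r addr0 in Iw.
pose vp z := vpart g i (lsubmx z) (rsubmx z) A.
have cchv := mC_lsubmx atM (chv_C atM rg i (lsubmx A) 1).
have ccst : mC 1 W (fun=> rsubmx A) := @mC_cst R _ W 1 _ _ _.
have cyc := mC_mulmx oT (mC_rsubmx (M := M) i 1) cchv.
have cvp : mC 1 W vp := mC_add oT ccst cyc.
have dvp : dmx Z vp z = w *m C.
  rewrite (dmx_add Z Wz ccst cyc).
  rewrite dmx_cst add0r (dmx_mulmx Z Wz (mC_rsubmx (M := M) i 1) cchv) dmx_rsubmx rZ.
  rewrite (dmx_lsubmx (chv g i (lsubmx A))) lZ.
  rewrite (_ : dmx 0 _ _ = 0) ?mulmx0 ?addr0//.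
  by apply/matrixP => a b; rewrite dmxE derive0 mxE.
have SC := mC_lsubmx atM (gmat_C atM rg i 1).
have dS : dmx Z (fun z => gmat g i (lsubmx z)) z = 0.
  rewrite dmx_lsubmx lZ; by apply/matrixP => a b; rewrite dmxE derive0 mxE.
have bil0 u1 u2 : bil (0 : 'M[R]_n) u1 u2 = 0 by rewrite /bil mulmx0 mul0mx mxE.
have Ib1 : is_derive z Z (fun z => bil (S z) w' (vp z)) (bil (S z) w' (w *m C)).
  apply: is_derive_eq (derive_bil Z Wz oT SC (@mC_cst R _ W 1 _ _ w') cvp) _.
  by rewrite dS bil0 dmx_cst bil0l !add0r dvp.
have Ib2 : is_derive z Z (fun z => bil (S z) (rsubmx z) (vp z))
    (bil (S z) w B + bil (S z) y (w *m C)).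
  apply: is_derive_eq (derive_bil Z Wz oT SC (mC_rsubmx (M := M) i 1) cvp) _.
  by rewrite dS bil0 add0r dmx_rsubmx rZ dvp.
rewrite -(bil_dgmat atTM rG _ _ _ Wz).
have I := is_deriveD (is_deriveM Ia Ib1) (is_deriveM (is_deriveM Ib Iw) Ib2).
transitivity ('D_Z ((fun z => alpha (fnorm g i z)) * (fun z => bil (S z) w' (vp z)) +
  (fun z => beta (fnorm g i z)) * (fun z => bil (S z) (rsubmx z) w') * (fun z => bil (S z) (rsubmx z) (vp z))) z).
  apply: (eq_derive_on _ oT Wz) => z'; rewrite inE => Wz'.
  rewrite (bil_gmatTM _ _ Wz') /Gform.
  have -> : vpart g i (lsubmx z') (rsubmx z') (row_mx 0 w') = w'.
    by rewrite /vpart row_mxKl row_mxKr chv0 mulmx0 addr0.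
  by rewrite row_mxKl bil0l add0r.
have [_ ->] := I; rewrite /GRing.scale/= -/t -[vp z]/B -[rsubmx z]/y -[gmat g i (lsubmx z)]/(S z).
by rewrite -[(_ * _) z]/(beta t * bil (S z) y w'); ring.
Qed.

(** The third term of the same Koszul formula. Here [A] is arbitrary, but on two vertical vectors
    [G] reduces to its fibre part. *)
Lemma dgmat_verver A w w' z : W z ->
  let y := rsubmx z in let B := vpart g i (lsubmx z) y A in
  let C := chv g i (lsubmx A) (lsubmx z) in let t := fnorm g i z in
  bil (dmx A (gmat G i) z) (row_mx 0 w) (row_mx 0 w') =
  halfder alpha t * (2 * bil (S z) y B) * bil (S z) w w'
  + alpha t * (bil (S z) (w *m C) w' + bil (S z) w (w' *m C))
  + halfder beta t * (2 * bil (S z) y B) * bil (S z) y w * bil (S z) y w'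
  + beta t * ((bil (S z) B w + bil (S z) y (w *m C)) * bil (S z) y w'
      + bil (S z) y w * (bil (S z) B w' + bil (S z) y (w' *m C))).
Proof.
move=> Wz y B C t; have Uq := cdom_lsubmx atM Wz.
have Ia := is_derive_half atM rg A sa Wz; have Ib := is_derive_half atM rg A sb Wz.
have I1 := is_derive_gfib atM rg A w Wz; have I2 := is_derive_gfib atM rg A w' Wz.
have I3 := is_derive_gcst atM rg A w w' Wz.
rewrite -(bil_dgmat atTM rG _ _ _ Wz).
have I := is_deriveD (is_deriveM Ia I3) (is_deriveM (is_deriveM Ib I1) I2).
transitivity ('D_A ((fun z => alpha (fnorm g i z)) * (fun z => bil (S z) w w') +
  (fun z => beta (fnorm g i z)) * (fun z => bil (S z) (rsubmx z) w) * (fun z => bil (S z) (rsubmx z) w')) z).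
  apply: (eq_derive_on _ oT Wz) => z'; rewrite inE => Wz'.
  rewrite (bil_gmatTM _ _ Wz') /Gform /vpart !row_mxKl !row_mxKr chv0 mulmx0 !addr0.
  by rewrite bil0l add0r.
have [_ ->] := I; rewrite /GRing.scale/= -/t -/B -[rsubmx z]/y -[gmat g i (lsubmx z)]/(S z).
by rewrite -[(_ * _) z]/(beta t * bil (S z) y w); ring.
Qed.

(** The three coefficients solve the Koszul equation of the fibre metric. Matching the components
    along [w] and [w'] gives [pcoef]; the component along [y] carries the factor [alpha + t beta],
    since [beta g(y, _) y] also acts on it, and yields [acoef] from the terms in [g(w, w')] and
    [bcoef] from those in [g(y, w) g(y, w')]. *)
Definition pcoef t : R := halfder alpha t / alpha t.
Definition acoef t : R := (beta t - halfder alpha t) / (alpha t + t * beta t).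
Definition bcoef t : R :=
  (halfder beta t - 2 * beta t * pcoef t) / (alpha t + t * beta t).

(* Levi-Civita connection of the metric [alpha g + beta y y] on a fibre *)
Definition fibLC q y w w' : 'rV[R]_n :=
  let S := gmat g i q in let t := bil S y y in
  pcoef t *: (bil S y w *: w' + bil S y w' *: w)
  + (acoef t * bil S w w' + bcoef t * (bil S y w * bil S y w')) *: y.

Let alpha_neq0 t : 0 <= t -> alpha t != 0.
Proof. by move=> t0; rewrite gt_eqF// (cb_alpha_pos chG). Qed.

Let alphabeta_neq0 t : 0 <= t -> alpha t + t * beta t != 0.
Proof. by move=> t0; rewrite gt_eqF// (cb_beta_pos chG). Qed.

Lemma fibLC_algebra (a b a' b' t yw yw' ww' yB wB w'B : R) :
  a != 0 -> a + t * b != 0 ->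
  2 * (a * (a' / a * (yw * w'B + yw' * wB)
        + ((b - a') / (a + t * b) * ww' + (b' - 2 * b * (a' / a)) / (a + t * b) * (yw * yw')) * yB)
    + b * (a' / a * (yw * yw' + yw' * yw)
        + ((b - a') / (a + t * b) * ww' + (b' - 2 * b * (a' / a)) / (a + t * b) * (yw * yw')) * t) * yB) =
  2 * (a' * (yw * w'B + yw' * wB - yB * ww') + b' * yw * yw' * yB + b * ww' * yB).
Proof. by move=> a0 ab0; field; rewrite ?a0 ?ab0. Qed.

(** The fibres are totally geodesic: the terms with the Christoffel matrix [C] cancel between the
    three Koszul terms, so [A] enters only through its vertical part and horizontal [A] give
    zero. *)
Lemma chv_ver w w' q y : cdom i q ->
  row_mx 0 w' *m chv G i (row_mx 0 w) (row_mx q y) = row_mx 0 (fibLC q y w w').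
Proof.
move=> Uq; have Wz : W (row_mx q y) by apply/(cdom_TM atM i q y).
apply: (chv_eq atTM rG Wz) => A.
rewrite (bil_gmat atM coverM rg rG chG y _ A Uq) /Gform.
have -> : vpart g i q y (row_mx 0 (fibLC q y w w')) = fibLC q y w w'.
  by rewrite /vpart row_mxKl row_mxKr chv0 mulmx0 addr0.
have E1 := dgmat_ver w w' A Wz; have E2 := dgmat_ver w' w A Wz.
have E3 := dgmat_verver A w w' Wz.
apply: (etrans (congr2 (fun a b => a - b) (congr2 +%R E1 E2) E3)).
rewrite /S /fnorm row_mxKl row_mxKr row_mxKl bil0l add0r.
set B := vpart g i q y A; set C := chv g i (lsubmx A) q; set T := gmat g i q.
set t := bil T y y.
have t0 : 0 <= t by exact: (bil_ge0 atM rg).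
have sT : T^T = T by exact: (gmat_sym atM rg Uq).
rewrite /fibLC /acoef /bcoef /pcoef -/T -/t; clearbody B C.
rewrite !(bilDl, bilDr, bilZl, bilZr) -/t.
rewrite (fibLC_algebra _ _ _ _ _ _ _ _ (alpha_neq0 t0) (alphabeta_neq0 t0)).
rewrite (bilC w' w sT) (bilC B w sT) (bilC B w' sT) (bilC (w *m C) w' sT).
ring.
Qed.

Lemma dmx_chv_ver (c : 'cV[R]_n) u w w' q y : cdom i q ->
  (row_mx 0 w' *m dmx (row_mx 0 u) (chv G i (row_mx 0 w)) (row_mx q y) *m col_mx 0 c) 0 0 =
  'D_u (fun y => (fibLC q y w w' *m c) 0 0) y.
Proof.
move=> Uq; have Wz y' : W (row_mx q y') by apply/(cdom_TM atM i q y').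
have cC := chv_C atTM rG i (row_mx 0 w) 1.
have cwC : mC 1 W (fun z => row_mx 0 w' *m chv G i (row_mx 0 w) z) :=
  mC_mulmx oT (@mC_cst R _ W 1 _ _ _) cC.
rewrite (mulmx_dmx _ _ (Wz y) cC).
have -> : dmx (row_mx 0 u) (fun z => row_mx 0 w' *m chv G i (row_mx 0 w) z) (row_mx q y) *m col_mx 0 c =
    dmx (row_mx 0 u) (fun z => row_mx 0 w' *m chv G i (row_mx 0 w) z *m col_mx 0 c) (row_mx q y).
  by rewrite (dmx_mulmx _ (Wz y) cwC (@mC_cst R _ W 1 _ _ _)) dmx_cst mulmx0 addr0.
have aff (t : R) : row_mx q (t *: u + y) = t *: row_mx 0 u + row_mx q y :> 'rV[R]_(n + n).
  by rewrite scale_row_mx scaler0 add_row_mx add0r.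
rewrite (@dmx_comp_affine R _ _ _ _ _ (fun y' : 'rV[R]_n => row_mx q y') y u _ aff) dmxE.
apply: (congr1 (fun f => derive f y u)); apply/funext => y'.
by rewrite (chv_ver _ _ _ Uq) mul_row_col mulmx0 add0r.
Qed.

(** This is [R(u, v) v = 0] paired with [u]. The pairing uses [T], which is constant on the fibre,
    in place of the fibre metric, so that it commutes with the derivatives. *)
Lemma flat_fibre u v q y : flat G -> cdom i q -> let T := gmat g i q in
  'D_u (fun y => bil T (fibLC q y v v) u) y - 'D_v (fun y => bil T (fibLC q y u v) u) y
  + (bil T (fibLC q y u (fibLC q y v v)) u - bil T (fibLC q y v (fibLC q y u v)) u) = 0.
Proof.
move=> fG Uq T; have Wz : W (row_mx q y) by apply/(cdom_TM atM i q y).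
have := congr1 (fun A : 'M[R]_(n + n) => (row_mx 0 v *m A *m col_mx 0 (T *m u^T)) 0 0)
  (flat_chv atTM rG fG (row_mx 0 u) (row_mx 0 v) Wz).
rewrite mulmx0 mul0mx [RHS]mxE mulmxDr !mulmxBr mulmxDl !mulmxBl !mulmxA.
rewrite !(chv_ver _ _ _ Uq) !mul_row_col !mulmx0 !add0r !mulmxA => H.
have E a b c : 'D_a (fun y => bil T (fibLC q y b c) u) y =
   (row_mx 0 c *m dmx (row_mx 0 a) (chv G i (row_mx 0 b)) (row_mx q y) *m col_mx 0 (T *m u^T)) 0 0.
  rewrite (dmx_chv_ver _ _ _ _ _ Uq); apply: (congr1 (fun f => derive f y a)).
  by apply/funext => y'; rewrite /bil mulmxA.
have mxB (A B C D : 'M[R]_1) : A 0 0 - B 0 0 + (C 0 0 - D 0 0) = (A - B + (C - D)) 0 0.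
  by rewrite !mxE.
apply: (etrans (congr2 (fun a b => a - b + _) (E u v v) (E v u v))).
exact: (etrans (mxB _ _ _ _) H).
Qed.

Lemma acoef_C : C_on 1 W (fun z => acoef (fnorm g i z)).
Proof.
have ca := half_C atM rg i 1 sa; have cb := half_C atM rg i 1 sb.
have ca' := half_C atM rg i 1 (halfsmooth_halfder sa).
have cf := fnorm_C atM rg i 1.
have cab := C_on_add oT ca (C_on_mul oT cf cb).
apply: (C_on_mul oT (C_on_sub2 oT cb ca') (C_on_inv oT _ cab)) => z Wz.
by apply: alphabeta_neq0; exact: (fnorm_ge0 atM rg Wz).
Qed.

Lemma pcoef_C : C_on 1 W (fun z => pcoef (fnorm g i z)).
Proof.
have ca := half_C atM rg i 1 sa.
have ca' := half_C atM rg i 1 (halfsmooth_halfder sa).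
apply: (C_on_mul oT ca' (C_on_inv oT _ ca)) => z Wz.
by apply: alpha_neq0; exact: (fnorm_ge0 atM rg Wz).
Qed.

(** The factor [s] vanishes at [0], so in the product rule the derivative of [a] is multiplied by
    zero and only its value remains. *)
Lemma derive_radial (a : R -> R) q y u : cdom i q ->
    C_on 1 W (fun z => a (fnorm g i z)) -> let T := gmat g i q in
  'D_1 (fun s : R => a (bil T (s *: u + y) (s *: u + y)) * s) 0 = a (bil T y y).
Proof.
move=> Uq ca T; have Wz : W (row_mx q y) by apply/(cdom_TM atM i q y).
pose h (s : R) := a (bil T (s *: u + y) (s *: u + y)).
have hE : h = (fun z => a (fnorm g i z)) \o (fun s : R => row_mx q (s *: u + y)).
  by apply/funext => s; rewrite /h /= /fnorm row_mxKl row_mxKr.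
have aff (t : R) : row_mx q ((t *: (1 : R) + 0) *: u + y) =
    t *: row_mx 0 u + row_mx q (0 *: u + y) :> 'rV[R]_(n + n).
  rewrite scale_row_mx scaler0 add_row_mx add0r scale0r add0r addr0.
  by rewrite [_ *: 1]mulr1.
have [d _] := @derive_comp_affine R R _ _ (fun z => a (fnorm g i z))
  (fun s : R => row_mx q (s *: u + y)) 0 1 _ aff.
have dh : derivable h 0 1.
  rewrite hE; apply/d; rewrite scale0r add0r; exact: (C_on_derivable ca Wz).
have := deriveM dh (@derivable_id _ _ (0 : R) (1 : R)).
rewrite derive_id scale0r addr0 /h scale0r add0r => E.
by apply: (etrans E); exact: mulr1.
Qed.

(** After multiplication by [a ^+ 2 * (a + t * b)] the two terms in [a * a' * t * b] cancel, which
    makes the equation linear in [b]. *)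
Lemma radial_algebra (a b a' t : R) : a != 0 -> a + t * b != 0 ->
  (b - a') / (a + t * b) - a' / a + a' / a * t * ((b - a') / (a + t * b)) = 0 ->
  b = (t * a' ^+ 2 + 2 * a * a') / a.
Proof.
move=> a0 ab0 H.
have : (a * b - (t * a' ^+ 2 + 2 * a * a')) * a = 0.
  transitivity (a ^+ 2 * (a + t * b) * ((b - a') / (a + t * b) - a' / a + a' / a * t * ((b - a') / (a + t * b)))).
    by field; rewrite ?a0 ?ab0.
  by rewrite H mulr0.
move/eqP; rewrite mulf_eq0 (negbTE a0) orbF subr_eq0 => /eqP <-.
by rewrite mulrAC mulfV// mul1r.
Qed.

(** For [u] and [v] orthonormal and orthogonal to [y] all terms with [bcoef] vanish, and the two
    derivatives reduce to values of [acoef] and [pcoef]; the curvature equation becomes algebraic in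
    [t]. *)
Lemma flat_beta q t : flat G -> (3 <= n)%N -> cdom i q -> 0 <= t ->
  beta t = (t * halfder alpha t ^+ 2 + 2 * alpha t * halfder alpha t) / alpha t.
Proof.
move=> fG n3 Uq t0; set T := gmat g i q.
have [P PT] := orthonormalize (gmat_sym atM rg Uq) (fun w => gmat_pos atM rg Uq).
pose k0 := Ordinal (leq_trans (isT : 0 < 3)%N n3).
pose k1 := Ordinal (leq_trans (isT : 1 < 3)%N n3).
pose k2 := Ordinal (leq_trans (isT : 2 < 3)%N n3).
have oP k l : bil T (row k P) (row l P) = (k == l)%:R.
  by rewrite !rowE bil_mul PT bil_delta mxE.
(* Three orthonormal rows are used, which is where the dimension enters; the scaling gives [y]
   squared norm [t], and [y = 0] for [t = 0] is allowed. *)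
pose y := Num.sqrt t *: row k0 P; pose u := row k1 P; pose v := row k2 P.
have yy : bil T y y = t.
  by rewrite bilZl bilZr oP eqxx mulr1 -expr2 sqr_sqrtr.
have yu : bil T y u = 0 by rewrite bilZl oP mulr0.
have yv : bil T y v = 0 by rewrite bilZl oP mulr0.
have uy : bil T u y = 0 by rewrite bilZr oP mulr0.
have vy : bil T v y = 0 by rewrite bilZr oP mulr0.
have uu : bil T u u = 1 by rewrite oP.
have vv : bil T v v = 1 by rewrite oP.
have uv : bil T u v = 0 by rewrite oP.
have vu : bil T v u = 0 by rewrite oP.
clearbody y u v.
have Lvv : fibLC q y v v = acoef t *: y.
  by rewrite /fibLC -/T yy yv vv mulr1 mul0r mulr0 addr0 !scale0r addr0 scaler0 add0r.
have Luv : fibLC q y u v = 0.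
  by rewrite /fibLC -/T yu yv uv !mul0r !mulr0 addr0 !scale0r !addr0 scaler0.
(* At [s *: u + y] the connection on [(v, v)] is [acoef] times the base vector [s *: u + y], whose
   product with [u] is [s]. *)
have D1 : 'D_u (fun y => bil T (fibLC q y v v) u) y = acoef t.
  have [_ e] := derive_line (fun y => bil T (fibLC q y v v) u) y u 0.
  rewrite scale0r add0r in e; rewrite -e -yy -(derive_radial y u Uq acoef_C).
  apply: derive_ext => s.
  rewrite /fibLC -/T; set r := bil T (s *: _ + y) (s *: _ + y).
  clearbody r; rewrite !(bilDl, bilZl) uv yv vv vu yu uu; ring.
(* At [s *: v + y] the connection on [(u, v)] keeps only [pcoef] times [s *: u]. *)
have D2 : 'D_v (fun y => bil T (fibLC q y u v) u) y = pcoef t.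
  have [_ e] := derive_line (fun y => bil T (fibLC q y u v) u) y v 0.
  rewrite scale0r add0r in e; rewrite -e -yy -(derive_radial y v Uq pcoef_C).
  apply: derive_ext => s.
  rewrite /fibLC -/T; set r := bil T (s *: _ + y) (s *: _ + y).
  clearbody r; rewrite !(bilDl, bilZl) uv yv vv vu yu uu; ring.
have := flat_fibre u v y fG Uq; rewrite /= -/T D1 D2 Lvv Luv.
have -> : bil T (fibLC q y u (acoef t *: y)) u = pcoef t * t * acoef t.
  rewrite /fibLC -/T !(bilDl, bilZl, bilZr) yy yu uy uu; ring.
have -> : bil T (fibLC q y v 0) u = 0.
  by rewrite /fibLC -/T !bil0r scaler0 scale0r addr0 scaler0 !mulr0 addr0 scale0r addr0 bil0l.
rewrite subr0; exact: radial_algebra (alpha_neq0 t0) (alphabeta_neq0 t0).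
Qed.

End Fibre.

(** * Flatness of the total space *)

Section BlockSmooth.
Variables (R : realType) (V : normedModType R) (U : set V).

Lemma mC_row_mx k (m n1 n2 : nat) (F : V -> 'M[R]_(m, n1)) (H : V -> 'M[R]_(m, n2)) :
  mC k U F -> mC k U H -> mC k U (fun z => row_mx (F z) (H z)).
Proof.
move=> cF cH a b; case: (split_ordP b) => c ->.
  rewrite (_ : (fun z => _) = fun z => F z a c) //; apply/funext => z.
  by rewrite row_mxEl.
rewrite (_ : (fun z => _) = fun z => H z a c) //; apply/funext => z.
by rewrite row_mxEr.
Qed.

Lemma mC_col_mx k (m1 m2 n : nat) (F : V -> 'M[R]_(m1, n)) (H : V -> 'M[R]_(m2, n)) :
  mC k U F -> mC k U H -> mC k U (fun z => col_mx (F z) (H z)).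
Proof.
move=> cF cH a b; case: (split_ordP a) => c ->.
  rewrite (_ : (fun z => _) = fun z => F z c b) //; apply/funext => z.
  by rewrite col_mxEu.
rewrite (_ : (fun z => _) = fun z => H z c b) //; apply/funext => z.
by rewrite col_mxEd.
Qed.

Lemma mC_diag_block k (n : nat) (F : V -> 'M[R]_n) :
  mC k U F -> mC k U (fun z => block_mx (F z) 0 0 (F z)).
Proof.
move=> cF; have c0 : mC k U (fun=> 0 : 'M[R]_n) := @mC_cst R V U k _ _ 0.
by apply: mC_col_mx; exact: mC_row_mx.
Qed.

Lemma dmx_diag_block (n : nat) (F : V -> 'M[R]_n) v x :
  dmx v (fun z => block_mx (F z) 0 0 (F z)) x = block_mx (dmx v F x) 0 0 (dmx v F x).
Proof. by rewrite /block_mx dmx_col_mx !dmx_row_mx !dmx_cst. Qed.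

End BlockSmooth.

Lemma bil_diag_block (R : comPzRingType) (n : nat) (S : 'M[R]_n) (u1 u2 w1 w2 : 'rV[R]_n) :
  bil (block_mx S 0 0 S) (row_mx u1 u2) (row_mx w1 w2) = bil S u1 w1 + bil S u2 w2.
Proof.
rewrite /bil mul_row_block !mulmx0 addr0 add0r tr_row_mx mul_row_col.
by rewrite mxE.
Qed.

(** [K] is the second derivative of [zeta], [F] and [H] are the mixed terms, and the hypothesis is
    the curvature of [g] applied to [zeta]. *)
Lemma torsion_algebra (V : zmodType) (D E F H K P Q : V) :
  D - E + (P - Q) = 0 -> F + P + (K + (H + D)) = H + Q + (K + (F + E)).
Proof.
rewrite addrACA -opprD => /subr0_eq e.
rewrite [LHS](AC (2*(1*2)) ((1*4*3)*(5*2))) [RHS](AC (2*(1*2)) ((4*1*3)*(5*2))).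
exact: (congr1 (fun x => F + H + K + x) e).
Qed.

(** * The coframe (dx, D zeta) and its connection *)

Section FlatTotal.
Variables (R : realType) (n : nat) (M : charted R n) (g : bilin M) (G : bilin (TM M)).
Variables (alpha beta : R -> R).
Hypotheses (atM : atlas M) (coverM : forall p : pt M, exists i, dom i p).
Hypotheses (rg : riemannian g) (rG : riemannian G).
Hypothesis chG : characterized_by g G alpha beta.
Hypothesis fg : flat g.
Hypothesis betaE : forall t, 0 <= t ->
  beta t = (t * halfder alpha t ^+ 2 + 2 * alpha t * halfder alpha t) / alpha t.
Variable i : idx M.
Implicit Types (q y u v w : 'rV[R]_n) (z A Z : 'rV[R]_(n + n)).

Let atTM : atlas (TM M). Proof. exact: TM_atlas. Qed.
Let W := cdom (X := TM M) i.
Let oT : open W. Proof. exact: (open_cdom atTM). Qed.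
Let sa : halfsmooth alpha := cb_alpha_smooth chG.

(** The factor by which [zeta] rescales the fibre vector. *)
Definition radius z : R := Num.sqrt (alpha (fnorm g i z)).

(* The fibrewise diffeomorphism y |-> sqrt(alpha(|y|^2)) y; it commutes with
   parallel transport and carries the fibre metric to the Euclidean one. *)
Definition zeta z : 'rV[R]_n := radius z *: rsubmx z.

Let alpha_gt0 z : W z -> 0 < alpha (fnorm g i z).
Proof. by move=> Wz; apply: (cb_alpha_pos chG); exact: (fnorm_ge0 atM rg Wz). Qed.

Lemma radius_C k : C_on k W radius.
Proof. exact: (C_on_sqrt oT alpha_gt0 (half_C atM rg i k sa)). Qed.

Lemma zeta_C k : mC k W zeta.
Proof. exact: (mC_scale oT (radius_C k) (mC_rsubmx (M := M) i k)). Qed.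

(** The Christoffel term completes the derivative of [zeta] to a covariant one. The tautological
    section contributes [B], and the rescaling factor is differentiated through the squared norm,
    whose derivative is [2 g(y, B)]. *)
Lemma dmx_zeta z A : W z ->
  let y := rsubmx z in let B := vpart g i (lsubmx z) y A in
  dmx A zeta z + zeta z *m chv g i (lsubmx A) (lsubmx z) =
  radius z *: B + (halfder alpha (fnorm g i z) * bil (gmat g i (lsubmx z)) y B / radius z) *: y.
Proof.
move=> Wz y B; have r0 : radius z != 0 by rewrite gt_eqF// sqrtr_gt0 alpha_gt0.
have [d e] := is_derive_half atM rg A sa Wz.
have [_ e2] := derive_sqrt_comp (alpha_gt0 Wz) d.
rewrite (dmx_scale A Wz (radius_C 1) (mC_rsubmx (M := M) i 1)) dmx_rsubmx.
have -> : 'D_A radius z = halfder alpha (fnorm g i z) * bil (gmat g i (lsubmx z)) y B / radius z.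
  apply: (etrans e2); rewrite e -/y -/B -/(radius z); field; exact: r0.
move: (halfder alpha _ * _ / _) => c.
by rewrite /zeta -scalemxAl /B /vpart scalerDr -addrA addrC.
Qed.

Let Gam A z := chv g i (lsubmx A) (lsubmx z).

(** Values of [dx] and of the covariant differential [D zeta] on the coordinate vector of index
    [a]. *)
Definition frame_row (a : 'I_(n + n)) z : 'rV[R]_(n + n) :=
  row_mx (lsubmx (bvec R a)) (dmx (bvec R a) zeta z + zeta z *m Gam (bvec R a) z).

Definition frame_mx z : 'M[R]_(n + n) := \matrix_(a, j) frame_row a z 0 j.

Lemma row_frame_mx a z : row a (frame_mx z) = frame_row a z.
Proof. by apply/rowP => j; rewrite !mxE. Qed.

Let GamC A k : mC k W (Gam A).
Proof. exact: (mC_lsubmx atM (chv_C atM rg i (lsubmx A) k)). Qed.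

Lemma frame_row_C a k : mC k W (frame_row a).
Proof.
have c1 : mC k W (dmx (bvec R a) zeta) := mC_dmx (bvec R a) (zeta_C k.+1).
have c2 := mC_mulmx oT (zeta_C k) (GamC (bvec R a) k).
exact: (mC_row_mx (@mC_cst R _ W k _ _ _) (mC_add oT c1 c2)).
Qed.

Lemma frame_mx_C k : mC k W frame_mx.
Proof.
move=> a j; rewrite (_ : (fun z => _) = fun z => frame_row a z 0 j).
  exact: frame_row_C.
by apply/funext => z; rewrite mxE.
Qed.

(** Expanding the product of two values of [D zeta] gives [alpha g(B, B')] and two cross terms
    [alpha' g(y, B) g(y, B')], plus a square term with coefficient [t alpha'^2 / alpha]. Their sum
    is the vertical part of [G] precisely by [betaE]. *)
Lemma gmat_frame z : W z ->
  gmat G i z = frame_mx z *m block_mx (gmat g i (lsubmx z)) 0 0 (gmat g i (lsubmx z)) *m (frame_mx z)^T.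
Proof.
move=> Wz; have Uq := cdom_lsubmx atM Wz.
apply/matrixP => a b; rewrite -[LHS]bil_delta -[RHS]bil_delta -bil_mul -!rowE !row_frame_mx.
rewrite (bil_gmatTM atM coverM rg rG chG _ _ Wz) /Gform.
rewrite /frame_row (dmx_zeta (bvec R a) Wz) (dmx_zeta (bvec R b) Wz) bil_diag_block; apply: (congr1 (fun x => _ + x)).
set S := gmat g i _; set y := rsubmx z; set B := vpart _ _ _ _ _; set B' := vpart _ _ _ _ _.
have t0 := fnorm_ge0 atM rg Wz; have ap := alpha_gt0 Wz.
rewrite (betaE t0) -/(fnorm g i z); set t := fnorm g i z in t0 ap *.
have tE : bil S y y = t by [].
have rr : radius z ^+ 2 = alpha t by rewrite sqr_sqrtr// ltW.
have r0 : radius z != 0 by rewrite gt_eqF// sqrtr_gt0.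
rewrite -rr; clearbody B B'; rewrite !(bilDl, bilDr, bilZl, bilZr).
rewrite (bilC B y (gmat_sym atM rg Uq)) tE; field; exact: r0.
Qed.

(** On the [dx] block this is the symmetry of the Christoffel symbols. On the other block, the
    exterior covariant derivative of [D zeta] is the curvature of [g] applied to [zeta], which
    vanishes. *)
Lemma frame_torsion a b z : W z ->
  row b (frame_mx z *m block_mx (Gam (bvec R a) z) 0 0 (Gam (bvec R a) z)
         + dmx (bvec R a) frame_mx z) =
  row a (frame_mx z *m block_mx (Gam (bvec R b) z) 0 0 (Gam (bvec R b) z)
         + dmx (bvec R b) frame_mx z).
Proof.
move=> Wz; have Uq := cdom_lsubmx atM Wz.
have rE c d : row d (frame_mx z *m block_mx (Gam (bvec R c) z) 0 0 (Gam (bvec R c) z)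
         + dmx (bvec R c) frame_mx z) =
   row_mx (lsubmx (bvec R d) *m Gam (bvec R c) z)
     ((dmx (bvec R d) zeta z + zeta z *m Gam (bvec R d) z) *m Gam (bvec R c) z
      + (dmx (bvec R c) (dmx (bvec R d) zeta) z + (dmx (bvec R c) zeta z *m Gam (bvec R d) z
      + zeta z *m dmx (bvec R c) (Gam (bvec R d)) z))).
  have -> : row d (frame_mx z *m block_mx (Gam (bvec R c) z) 0 0 (Gam (bvec R c) z)
         + dmx (bvec R c) frame_mx z) =
    frame_row d z *m block_mx (Gam (bvec R c) z) 0 0 (Gam (bvec R c) z) + dmx (bvec R c) (frame_row d) z.
    rewrite -row_frame_mx -row_mul; apply/rowP => j; rewrite [LHS]mxE [LHS]mxE [RHS]mxE.
    apply: congr2; first by rewrite [RHS]mxE.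
    rewrite dmxE [RHS]dmxE; apply: derive_ext => z'; by rewrite mxE.
  rewrite /frame_row mul_row_block !mulmx0 addr0 add0r dmx_row_mx dmx_cst add_row_mx addr0.
  have c1 := mC_dmx (bvec R d) (zeta_C 2).
  have c2 := mC_mulmx oT (zeta_C 1) (GamC (bvec R d) 1).
  by rewrite (dmx_add _ Wz c1 c2) (dmx_mulmx _ Wz (zeta_C 1) (GamC (bvec R d) 1)).
rewrite !rE; apply: congr2; first exact: (chv_sym atM rg _ _ Uq).
have sch : dmx (bvec R a) (dmx (bvec R b) zeta) z = dmx (bvec R b) (dmx (bvec R a) zeta) z.
  apply/matrixP => c e.
  have E f : (fun z => dmx (bvec R f) zeta z c e) = 'D_(bvec R f) (fun z => zeta z c e).
    by apply/funext => z'; rewrite dmxE.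
  have H := derive_schwarz (bvec R a) (bvec R b) oT Wz (zeta_C 2 c e).
  rewrite [LHS]dmxE [RHS]dmxE.
  exact: (etrans (congr1 (fun h => 'D_(bvec R a) h z) (E b))
    (etrans H (congr1 (fun h => 'D_(bvec R b) h z) (esym (E a))))).
have dG c d : dmx (bvec R c) (Gam (bvec R d)) z =
    dmx (lsubmx (bvec R c)) (chv g i (lsubmx (bvec R d))) (lsubmx z) by exact: dmx_lsubmx.
have := congr1 (fun A : 'M[R]_n => zeta z *m A) (flat_chv atM rg fg (lsubmx (bvec R a)) (lsubmx (bvec R b)) Uq).
rewrite -!dG mulmx0 mulmxDr !mulmxBr !mulmxA sch !mulmxDl.
exact: torsion_algebra.
Qed.

(** The connection matrices in the frame are two copies of those of [g] pulled back by the
    projection, so their curvature is that of [g]; invertibility of the frame carries its vanishing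
    to coordinates. *)
Lemma flat_total_chart a b z : W z -> curvm G i a b z = 0.
Proof.
move=> Wz.
pose D z := block_mx (gmat g i (lsubmx z)) 0 0 (gmat g i (lsubmx z)).
pose om a z := block_mx (Gam (bvec R a) z) 0 0 (Gam (bvec R a) z).
have SC := mC_lsubmx atM (gmat_C atM rg i 1).
have DC : mC 1 W D := mC_diag_block SC.
have omC c : mC 1 W (om c) := mC_diag_block (GamC (bvec R c) 1).
have Dcompat c z' : W z' -> dmx (bvec R c) D z' = om c z' *m D z' + D z' *m (om c z')^T.
  move=> Wz'; have Uq := cdom_lsubmx atM Wz'.
  rewrite /D dmx_diag_block dmx_lsubmx (chv_compat atM rg _ Uq) /om tr_block_mx !trmx0.
  by rewrite !mulmx_block !mulmx0 !mul0mx !addr0 !add0r add_block_mx !addr0.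
have sW : W `<=` cdom (X := TM M) i by [].
have K := frame_curvature atTM rG oT sW (frame_mx_C 2) DC omC gmat_frame Dcompat frame_torsion a b Wz.
have uth := frame_unit atTM rG sW gmat_frame Wz.
apply: (can_inj (mulmxK uth)); rewrite mul0mx; apply: (etrans K).
rewrite /om !dmx_diag_block !mulmx_block !mulmx0 !mul0mx !addr0 !add0r.
rewrite !opp_block_mx !add_block_mx !oppr0 !addr0.
have F := flat_chv atM rg fg (lsubmx (bvec R a)) (lsubmx (bvec R b)) (cdom_lsubmx atM Wz).
rewrite !dmx_lsubmx F.
by rewrite block_mx0 mulmx0.
Qed.

End FlatTotal.

Theorem corollary4p2 (R : realType) (n : nat) (M : charted R n)
  (g : bilin M) (G : bilin (TM M)) (alpha beta : R -> R)
  (n_ge3 : (3 <= n)%N) (M_manifold : manifold M) (g_riemannian : riemannian g)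
  (G_natural : natural_metric g G)
  (G_char : characterized_by g G alpha beta) :
  flat G <->
  flat g /\
  (forall t : R, 0 <= t ->
     beta t = (t * halfder alpha t ^+ 2 + 2 * alpha t * halfder alpha t)
              / alpha t).
Proof.
have atM := manifold_atlas M_manifold; have cov := mf_cover M_manifold.
have rG := nm_riemannian G_natural.
split=> [fG|[fg bE]].
  split; first exact: (flat_base atM cov g_riemannian rG G_char fG).
  (* A single fibre yields the formula for every [t], and [M] has at least one point. *)
  have [p _] := mf_nonempty M_manifold; have [i di] := cov p.
  move=> t t0.
  exact: (flat_beta atM cov g_riemannian rG G_char fG n_ge3 (cdom_chart di) t0).
apply/(flatP G (TM_atlas atM)) => i z a b Wz.
exact: (flat_total_chart atM cov g_riemannian rG G_char fg bE).
Qed.
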